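(* Let $\varepsilon>0$. Suppose the standing assumptions on $(X,Y,f,F)$, the stochastic oracle assumption, the paired-oracle assumption, and the $\mu$-strong concavity assumption of the context hold, and let $\overline B\ge B$ be a known bound. Let $C_\star=140$. Run unregularized VR-SPDE (see context) with the parameters $h_{\rm sc},\alpha_{\rm sc},k_{\rm sc},\beta_{\rm sc}$ and with $$T=\max\left\{1,\left\lceil\frac{256L\overline B}{\beta_{\rm sc}\varepsilon^2}\right\rceil\right\},\quad B_{\rm r}=\max\left\{1,\left\lceil\frac{1536C_\star\sigma^2}{\beta_{\rm sc}^2\varepsilon^2}\right\rceil\right\},\quad A_{{\rm vr},{\rm sc}}:=\frac{16C_\star\chi^2}{\beta_{\rm sc}^2},$$ $$q=\max\left\{1,\left\lfloor\sqrt{B_{\rm r}/A_{{\rm vr},{\rm sc}}}\right\rfloor\right\},\qquad b=\lceil A_{{\rm vr},{\rm sc}}q\rceil.$$ Then the output $(x_{\rm out},y_{\rm out})=(x_{J+1},y_{J+1})$ satisfies $\mathbb E[\mathcal R(x_{\rm out},y_{\rm out})^2]\le\varepsilon^2$, and the number $N_{{\rm vr},{\rm sc}}$ of SFO calls satisfies $$N_{{\rm vr},{\rm sc}}\le B_{\rm r}+18T\min\left\{B_{\rm r},\sqrt{A_{{\rm vr},{\rm sc}}B_{\rm r}}\right\}.$$ For fixed positive $\sigma$ and $\chi$, $$T=O(\sqrt\kappa\,\varepsilon^{-2}),\quad B_{\rm r}=O(\kappa\varepsilon^{-2}),\quad q=\Theta((\chi\varepsilon)^{-1}),\quad b=O(\chi\kappa\varepsilon^{-1}),\quad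 N_{{\rm vr},{\rm sc}}=O\!\left(\kappa\varepsilon^{-2}+\chi\kappa^{3/2}\varepsilon^{-3}\right).$$ If $\sigma=0$, then $B_{\rm r}=q=1$ and $N_{{\rm vr},{\rm sc}}\le3T=O(\sqrt\kappa\,\varepsilon^{-2})$.
   Context: **Standing assumptions.** All norms are Euclidean. $X\subseteq\mathbb R^n$ is nonempty, closed, convex; $Y\subseteq\mathbb R^p$ is nonempty, compact, convex with $D_Y:=\max_{y\in Y}\|y\|>0$. $\omega\sim\mathcal D$ is random and $F(x,y)=\mathbb E_{\omega\sim\mathcal D}[f(x,y;\omega)]$. For almost every $\omega$, $f(\cdot,\cdot;\omega)$ is differentiable on a neighborhood of $X\times Y$. $F$ is continuously differentiable on a neighborhood of $X\times Y$ and $\nabla F$ is $L$-Lipschitz on $X\times Y$ for some $L>0$. For every $x\in X$, $F(x,\cdot)$ is concave on $Y$. $\phi(x):=\max_{y\in Y}F(x,y)$ and $\phi_{\inf}:=\inf_{x\in X}\phi(x)>-\infty$. $\Pi_C$ and $N_C$ denote Euclidean projection onto, and the normal cone of, a closed convex set $C$. **Strong concavity.** There is $\mu>0$ such that for all $x\in X$, $y,y'\in Y$: $F(x,y')\le F(x,y)+\langle\nabla_yF(x,y),y'-y\rangle-\frac\mu2\|y'-y\|^2$; moreover $0<\mu\le L$, and $\kappa:=L/\mu\ge1$. **Stochastic oracle.** There is a constant $\sigma\ge0$ such that for every sigma-algebra $\mathcal A$ of pre-query information and every $\mathcal A$-measurable $u\in X\times Y$, a fresh sample $\omega\sim\mathcal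 D$ independent of $\mathcal A$ satisfies $\mathbb E[\nabla f(u;\omega)\mid\mathcal A]=\nabla F(u)$ and $\mathbb E[\|\nabla f(u;\omega)-\nabla F(u)\|^2\mid\mathcal A]\le\sigma^2$. Samples within a batch are independent draws from $\mathcal D$, independent of all information available before the batch is drawn. Each evaluation of $\nabla f(u;\omega)$ at one point is one stochastic first-order oracle (SFO) call. **Paired oracle.** $\nabla f(u;\omega)$ and $\nabla f(u';\omega)$ can be evaluated with the same sample (cost: two SFO calls), and there is $\ell\ge L$ such that for every pre-query $\mathcal A$ and $\mathcal A$-measurable $u,u'\in X\times Y$, a fresh $\omega\sim\mathcal D$ independent of $\mathcal A$ satisfies $\mathbb E[\|\nabla f(u;\omega)-\nabla f(u';\omega)\|^2\mid\mathcal A]\le\ell^2\|u-u'\|^2$. Set $\chi:=\ell/L\ge1$. **Residual.** For $(x,y)\in X\times Y$, $\mathcal R(x,y)^2:=\operatorname{dist}^2(0,\nabla_xF(x,y)+N_X(x))+\operatorname{dist}^2(0,-\nabla_yF(x,y)+N_Y(y))$. **Unregularized VR-SPDE.** Given deterministic $x_0\in X$, $y_0\in Y$, integers $T,q,B_{\rm r},b\ge1$, and parameters $h,\alpha,k,\beta$, set $z_0=x_0$, $\xi_0=0$, $n_0=v_0=0$. The algorithm makes estimator requests $j=0,\dots,3T-1$ at points $u_{3t}=(x_t,y_t)$, $u_{3t+1}=(\widetilde x_t,\widetilde y_t)$, $u_{3t+2}=(x_{t+1},y_{t+1})$, with fresh samples at each request (drawn after the query point is determined): $\mathsf g_j=\frac1{B_{\rm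 r}}\sum_{i=1}^{B_{\rm r}}\nabla f(u_j;\omega_{j,i})$ if $j\equiv0\pmod q$ (refresh), and $\mathsf g_j=\mathsf g_{j-1}+\frac1b\sum_{i=1}^b[\nabla f(u_j;\omega_{j,i})-\nabla f(u_{j-1};\omega_{j,i})]$ otherwise. Write $\widehat g_t^{(r)}=\mathsf g_{3t+r}=(\widehat g^{(r)}_{x,t},\widehat g^{(r)}_{y,t})$, $r=0,1,2$. For $t=0,\dots,T-1$: (1) $\widetilde x_t=\Pi_X(x_t-h(\widehat g^{(0)}_{x,t}+2L(x_t-z_t)+\xi_t))$, $\widetilde y_t=\Pi_Y(y_t+h(\widehat g^{(0)}_{y,t}-n_t+v_t))$. (2) $\bar v_t=\alpha v_t+k\widehat g^{(1)}_{y,t}$; $x_{t+1}=\Pi_X(x_t-h(\widehat g^{(1)}_{x,t}+2L(\widetilde x_t-z_t)))$; $\xi_{t+1}=\frac{x_t-x_{t+1}}h-\widehat g^{(1)}_{x,t}-2L(\widetilde x_t-z_t)$; $y_{t+1}=\Pi_Y(y_t+h(\widehat g^{(1)}_{y,t}+\bar v_t))$; $n_{t+1}=\frac1{1+k}\left(\frac{y_t-y_{t+1}}h+\widehat g^{(1)}_{y,t}+\bar v_t\right)$. (3) $v_{t+1}=\alpha v_t+k(\widehat g^{(2)}_{y,t}-n_{t+1})$; $z_{t+1}=z_t+\beta(x_{t+1}-z_t)$. Finally $J\sim\operatorname{Unif}\{0,\dots,T-1\}$ is drawn independently of all oracle samples and the output is $(x_{J+1},y_{J+1})$. A refresh costs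 $B_{\rm r}$ SFO calls and any other request costs at most $2b$. **Parameters.** $s_{\rm sc}=\sqrt{2L\mu}$, $h=h_{\rm sc}=\frac1{192L}$, $\alpha=\alpha_{\rm sc}=(1+h_{\rm sc}s_{\rm sc}/16)^{-1}$, $k=k_{\rm sc}=\frac{h_{\rm sc}(8L-s_{\rm sc})}{16+h_{\rm sc}s_{\rm sc}}$, $\beta=\beta_{\rm sc}=\frac{h_{\rm sc}s_{\rm sc}}{4096}=\frac{\sqrt2}{786432}\kappa^{-1/2}$. **Initial quantity.** $B:=\phi(x_0)-\phi_{\inf}+2D_Y\|\nabla_yF(x_0,y_0)\|+\frac{\|\nabla_xF(x_0,y_0)\|^2+2\|\nabla_yF(x_0,y_0)\|^2}{L}+\left(3+\frac1{64}\right)LD_Y^2$. **Asymptotic notation.** $O(\cdot),\Theta(\cdot)$ suppress constants independent of $\varepsilon$ and of parameters whose dependence is displayed explicitly ($\kappa$, $\chi$); they are understood for $\varepsilon\downarrow0$ with $L,\overline B$ and the quantities declared fixed held fixed. *)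

(* Defs.v *)
From HB Require Import structures.
From mathcomp Require Import all_boot all_order all_algebra.
From mathcomp Require Import all_classical all_reals all_analysis.
From mathcomp Require Import measurable_realfun.
Import Order.TTheory GRing.Theory Num.Theory.
Import numFieldNormedType.Exports.

Set Implicit Arguments.
Unset Strict Implicit.
Unset Printing Implicit Defensive.

Local Open Scope classical_set_scope.
Local Open Scope ring_scope.

(* The library norm on row vectors is the sup norm; it is only used for the
   topology and for differentiability, which do not depend on the choice of a
   norm in finite dimension.  All quantitative statements use [enorm]. *)
Section Euclidean.
Context {R : realType}.

Definition dotv {m} (x y : 'rV[R]_m) : R := \sum_i x 0 i * y 0 i.

Definition enorm {m} (x : 'rV[R]_m) : R := Num.sqrt (dotv x x).

Definition enormp {n p} (u : 'rV[R]_n * 'rV[R]_p) : R :=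
  Num.sqrt (enorm u.1 ^+ 2 + enorm u.2 ^+ 2).

(* The minimizer exists and is unique when C is nonempty, closed and convex. *)
Definition eproj {m} (C : set 'rV[R]_m) (x : 'rV[R]_m) : 'rV[R]_m :=
  xget 0 [set c | C c /\ forall c', C c' -> enorm (x - c) <= enorm (x - c')].

Definition normal_cone {m} (C : set 'rV[R]_m) (x : 'rV[R]_m) : set 'rV[R]_m :=
  [set g | C x /\ forall c, C c -> dotv g (c - x) <= 0].

Definition dist0 {m} (S : set 'rV[R]_m) : R := inf [set enorm v | v in S].

Definition gradx {n p} (G : 'rV[R]_n * 'rV[R]_p -> R) u : 'rV[R]_n :=
  \row_i 'D_((delta_mx 0 i, 0)) G u.

Definition grady {n p} (G : 'rV[R]_n * 'rV[R]_p -> R) u : 'rV[R]_p :=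
  \row_i 'D_((0, delta_mx 0 i)) G u.

Definition grad {n p} (G : 'rV[R]_n * 'rV[R]_p -> R) u :
  'rV[R]_n * 'rV[R]_p := (gradx G u, grady G u).

End Euclidean.

Section ConditionalExpectation.

Definition is_sub_sigma_algebra d (O : measurableType d) (A : set (set O)) :=
  sigma_algebra setT A /\ A `<=` measurable.

Definition measurable_wrt (O : Type) d (S : measurableType d)
    (A : set (set O)) (g : O -> S) :=
  forall B, measurable B -> A (g @^-1` B).

Definition borel (T : ptopologicalType) := g_sigma_algebraType (@open T).

Context {R : realType} {d} {O : measurableType d} (P : probability O R).

(* C is a version of E[Y | A], for Y >= 0; no integrability is required. *)
Definition is_cond_exp_ge0 (A : set (set O)) (Y C : O -> \bar R) :=
  [/\ measurable_wrt A C, (forall w, (0 <= C w)%E) &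
      forall E, A E -> (\int[P]_(w in E) C w = \int[P]_(w in E) Y w)%E].

(* Z = E[Y | A] = E[Y^+ | A] - E[Y^- | A] almost surely, both terms being
   finite almost surely.  Y itself need not be integrable: with an unbounded X
   the query points, hence the sampled gradients, need not be. *)
Definition is_cond_exp (A : set (set O)) (Y Z : O -> R) :=
  measurable_wrt A Z /\
  exists Cp Cn : O -> \bar R,
    [/\ is_cond_exp_ge0 A (fun w => (Num.max (Y w) 0)%:E) Cp,
        is_cond_exp_ge0 A (fun w => (Num.max (- Y w) 0)%:E) Cn &
        {ae P, forall w, (Z w)%:E = (Cp w - Cn w)%E}].

(* E[Y | A] <= Z almost surely, for Y >= 0 *)
Definition cond_exp_ge0_le (A : set (set O)) (Y Z : O -> R) :=
  exists2 C, is_cond_exp_ge0 A (EFin \o Y) C &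
    {ae P, forall w, (C w <= (Z w)%:E)%E}.

End ConditionalExpectation.

Section Problem.
Context {R : realType} {n p : nat}.
Local Notation V := ('rV[R]_n * 'rV[R]_p)%type.
Local Notation BV := (borel 'rV[R]_n * borel 'rV[R]_p)%type.
Context {dW} {W : measurableType dW} (D : probability W R).
Implicit Types (X : set 'rV[R]_n) (Y : set 'rV[R]_p) (f : V -> W -> R).

Definition objective f : V -> R := fun u => Rintegral D setT (f u).

Definition sgrad f (u : V) (w : W) : V := grad (fun v => f v w) u.

Definition radius Y : R := sup [set enorm y | y in Y].

Definition primal Y (F : V -> R) (x : 'rV[R]_n) : R :=
  sup [set F (x, y) | y in Y].

Definition primal_inf X Y (F : V -> R) : R := inf [set primal Y F x | x in X].

Record standing_assumptions X Y f (L : R) : Prop := {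
  sa_X_nonempty : X !=set0;
  sa_X_closed : closed X;
  sa_X_convex : convex_set X;
  sa_Y_nonempty : Y !=set0;
  sa_Y_compact : compact Y;
  sa_Y_convex : convex_set Y;
  sa_radius_gt0 : 0 < radius Y;
  sa_differentiable : {ae D, forall w, exists U : set V,
    [/\ open U, X `*` Y `<=` U &
        forall u, U u -> differentiable (fun v => f v w) u]};
  sa_C1 : exists U : set V,
    [/\ open U, X `*` Y `<=` U &
        forall u, U u -> [/\ D.-integrable setT (EFin \o f u),
                             differentiable (objective f) u &
                             {for u, continuous (grad (objective f))}]];
  sa_L_gt0 : 0 < L;
  sa_lipschitz : forall u u', (X `*` Y) u -> (X `*` Y) u' ->
    enormp (grad (objective f) u - grad (objective f) u')
      <= L * enormp (u - u');
  sa_concave : forall x, X x ->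
    convex_function Y (fun y => - objective f (x, y));
  sa_bounded_below : has_lbound [set primal Y (objective f) x | x in X] }.

Definition strong_concavity X Y (F : V -> R) (L mu : R) : Prop :=
  [/\ 0 < mu, mu <= L &
      forall x y y', X x -> Y y -> Y y' ->
        F (x, y') <= F (x, y) + dotv (grady F (x, y)) (y' - y)
                     - mu / 2 * enorm (y' - y) ^+ 2].

Section Oracle.
Context {d} {O : measurableType d} (P : probability O R).

Definition fresh_sample (A : set (set O)) (omega : O -> W) :=
  [/\ measurable_fun setT omega,
      (forall B, measurable B -> P (omega @^-1` B) = D B) &
      forall E B, A E -> measurable B ->
        P (E `&` omega @^-1` B) = (P E * P (omega @^-1` B))%E].

Definition admissible_query X Y (A : set (set O)) (u : O -> V) :=
  measurable_wrt A (u : O -> BV) /\ forall w, (X `*` Y) (u w).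

(* The first field makes the sampled gradient at a random point a random
   vector, as is implicit in conditioning on pre-query information. *)
Record stochastic_oracle X Y f (sigma : R) : Prop := {
  so_measurable :
    measurable_fun ((X `*` Y) `*` setT : set (BV * W))
      (fun z : BV * W => sgrad f z.1 z.2 : BV);
  so_sigma_ge0 : 0 <= sigma;
  so_unbiased_x : forall A u omega, is_sub_sigma_algebra A ->
    admissible_query X Y A u -> fresh_sample A omega -> forall i,
    is_cond_exp P A (fun w => (sgrad f (u w) (omega w)).1 0 i)
                    (fun w => (grad (objective f) (u w)).1 0 i);
  so_unbiased_y : forall A u omega, is_sub_sigma_algebra A ->
    admissible_query X Y A u -> fresh_sample A omega -> forall i,
    is_cond_exp P A (fun w => (sgrad f (u w) (omega w)).2 0 i)
                    (fun w => (grad (objective f) (u w)).2 0 i);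
  so_variance : forall A u omega, is_sub_sigma_algebra A ->
    admissible_query X Y A u -> fresh_sample A omega ->
    cond_exp_ge0_le P A
      (fun w => enormp (sgrad f (u w) (omega w)
                        - grad (objective f) (u w)) ^+ 2)
      (fun=> sigma ^+ 2) }.

Definition paired_oracle X Y f (L ell : R) : Prop :=
  L <= ell /\
  forall A u u' omega, is_sub_sigma_algebra A ->
    admissible_query X Y A u -> admissible_query X Y A u' ->
    fresh_sample A omega ->
    cond_exp_ge0_le P A
      (fun w => enormp (sgrad f (u w) (omega w) - sgrad f (u' w) (omega w))
                ^+ 2)
      (fun w => ell ^+ 2 * enormp (u w - u' w) ^+ 2).

End Oracle.

Definition residual_sq X Y (F : V -> R) (x : 'rV[R]_n) (y : 'rV[R]_p) : R :=
  dist0 [set gradx F (x, y) + g | g in normal_cone X x] ^+ 2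
  + dist0 [set - grady F (x, y) + g | g in normal_cone Y y] ^+ 2.

Definition initial_quantity X Y (F : V -> R) (L : R) x0 y0 : R :=
  primal Y F x0 - primal_inf X Y F
  + 2 * radius Y * enorm (grady F (x0, y0))
  + (enorm (gradx F (x0, y0)) ^+ 2 + 2 * enorm (grady F (x0, y0)) ^+ 2) / L
  + (3 + 1 / 64) * L * radius Y ^+ 2.

End Problem.

Section Algorithm.
Context {R : realType} {n p : nat}.
Local Notation V := ('rV[R]_n * 'rV[R]_p)%type.
Context {W : Type}.

(* The iterates after a step, with the last query point and the last estimate. *)
Record state := State {
  st_x : 'rV[R]_n; st_y : 'rV[R]_p; st_z : 'rV[R]_n; st_xi : 'rV[R]_n;
  st_n : 'rV[R]_p; st_v : 'rV[R]_p;
  st_query : V; st_est : V }.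

Context (X : set 'rV[R]_n) (Y : set 'rV[R]_p) (G : V -> W -> V).
Context (L h alpha k beta : R) (q Br b : nat).
(* [omega j i] is the i-th sample drawn at request j. *)
Context (omega : nat -> nat -> W).

(* The j-th estimate at u, given the previous query point u' and estimate g'. *)
Definition vr_estimate (j : nat) (u u' g' : V) : V :=
  if (q %| j)%N then Br%:R^-1 *: \sum_(i < Br) G u (omega j i)
  else g' + b%:R^-1 *: \sum_(i < b) (G u (omega j i) - G u' (omega j i)).

Definition vr_spde_init (x0 : 'rV[R]_n) (y0 : 'rV[R]_p) : state :=
  {| st_x := x0; st_y := y0; st_z := x0; st_xi := 0; st_n := 0; st_v := 0;
     (* never read: request 0 is a refresh *)
     st_query := (x0, y0); st_est := 0 |}.

Definition vr_spde_step (t : nat) (s : state) : state :=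
  let x := st_x s in let y := st_y s in let z := st_z s in
  let xi := st_xi s in let nu := st_n s in let v := st_v s in
  let g0 := vr_estimate (3 * t)%N (x, y) (st_query s) (st_est s) in
  let xt := eproj X (x - h *: (g0.1 + (2 * L) *: (x - z) + xi)) in
  let yt := eproj Y (y + h *: (g0.2 - nu + v)) in
  let g1 := vr_estimate (3 * t + 1)%N (xt, yt) (x, y) g0 in
  let vbar := alpha *: v + k *: g1.2 in
  let x' := eproj X (x - h *: (g1.1 + (2 * L) *: (xt - z))) in
  let xi' := h^-1 *: (x - x') - g1.1 - (2 * L) *: (xt - z) in
  let y' := eproj Y (y + h *: (g1.2 + vbar)) in
  let nu' := (1 + k)^-1 *: (h^-1 *: (y - y') + g1.2 + vbar) in
  let g2 := vr_estimate (3 * t + 2)%N (x', y') (xt, yt) g1 in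
  let v' := alpha *: v + k *: (g2.2 - nu') in
  let z' := z + beta *: (x' - z) in
  {| st_x := x'; st_y := y'; st_z := z'; st_xi := xi'; st_n := nu';
     st_v := v'; st_query := (x', y'); st_est := g2 |}.

Fixpoint vr_spde (x0 : 'rV[R]_n) (y0 : 'rV[R]_p) (t : nat) : state :=
  if t is t'.+1 then vr_spde_step t' (vr_spde x0 y0 t')
  else vr_spde_init x0 y0.

End Algorithm.

Definition batch_size (q Br b j : nat) : nat := if (q %| j)%N then Br else b.

(* [c j] is the number of SFO calls of request j.  It is only bounded for a
   recursive request, as an implementation may save calls when two successive
   query points coincide. *)
Definition sfo_costs (q Br b : nat) (c : nat -> nat) : Prop :=
  forall j, if (q %| j)%N then c j = Br else (c j <= 2 * b)%N.

Definition sfo_total (T : nat) (c : nat -> nat) : nat :=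
  (\sum_(j < 3 * T) c j)%N.

Section Sampling.
Context {R : realType} {dW} {W : measurableType dW} (D : probability W R).
Context {d} {O : measurableType d} (P : probability O R).
Context (T q Br b : nat) (omega : nat -> nat -> O -> W).

Definition past_samples (j : nat) : set (set O) :=
  <<s [set E | exists j' i B, [/\ (j' < j)%N, (i < batch_size q Br b j')%N,
                                  measurable B & E = omega j' i @^-1` B]] >>.

(* [fb_indep] is both the mutual independence of the batch and its
   independence of all earlier samples. *)
Record fresh_batches : Prop := {
  fb_measurable : forall j i, (j < 3 * T)%N -> (i < batch_size q Br b j)%N ->
    measurable_fun setT (omega j i);
  fb_law : forall j i B, (j < 3 * T)%N -> (i < batch_size q Br b j)%N ->
    measurable B -> P (omega j i @^-1` B) = D B;
  fb_indep : forall j E (B : nat -> set W), (j < 3 * T)%N ->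
    past_samples j E -> (forall i, measurable (B i)) ->
    P (E `&` \big[setI/setT]_(i < batch_size q Br b j) (omega j i @^-1` B i))
    = (P E * \prod_(i < batch_size q Br b j) P (omega j i @^-1` B i))%E }.

Record uniform_index (J : O -> 'I_T) : Prop := {
  ui_measurable : forall t, measurable (J @^-1` [set t]);
  ui_law : forall t, P (J @^-1` [set t]) = (T%:R^-1)%:E;
  ui_indep : forall E t, past_samples (3 * T)%N E ->
    P (E `&` J @^-1` [set t]) = (P E * P (J @^-1` [set t]))%E }.

End Sampling.

Section StepSizesAndBatches.
Context {R : realType}.
Implicit Types L mu ell sigma eps Bbar : R.

Definition s_sc L mu : R := Num.sqrt (2 * L * mu).
Definition h_sc L : R := 1 / (192 * L).
Definition alpha_sc L mu : R := (1 + h_sc L * s_sc L mu / 16)^-1.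
Definition k_sc L mu : R :=
  h_sc L * (8 * L - s_sc L mu) / (16 + h_sc L * s_sc L mu).
Definition beta_sc L mu : R := h_sc L * s_sc L mu / 4096.

Definition C_star : R := 140.

Definition T_sc L mu Bbar eps : nat :=
  maxn 1 `|Num.ceil (256 * L * Bbar / (beta_sc L mu * eps ^+ 2))|%N.
Definition Br_sc L mu sigma eps : nat :=
  maxn 1 `|Num.ceil (1536 * C_star * sigma ^+ 2
                     / (beta_sc L mu ^+ 2 * eps ^+ 2))|%N.
Definition A_vrsc L mu ell : R :=
  16 * C_star * (ell / L) ^+ 2 / beta_sc L mu ^+ 2.
Definition q_sc L mu ell sigma eps : nat :=
  maxn 1 `|Num.floor (Num.sqrt ((Br_sc L mu sigma eps)%:R
                                / A_vrsc L mu ell))|%N.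
Definition b_sc L mu ell sigma eps : nat :=
  `|Num.ceil (A_vrsc L mu ell * (q_sc L mu ell sigma eps)%:R)|%N.

End StepSizesAndBatches.

(* Main.v *)
Require Import Defs.
From mathcomp Require Import all_boot all_order all_algebra.
From mathcomp Require Import all_classical all_reals all_analysis.
From mathcomp Require Import measurable_realfun ring lra.
Import Order.TTheory GRing.Theory Num.Theory.
Import numFieldNormedType.Exports.

(** Each step of the algorithm is a projected extragradient step of size [h],
    with a momentum [v] in the dual variable, for the saddle function
    [F (x, y) + L |x - z|^2]; the proximal center [z] then moves by a small
    fraction [beta] towards the new [x].  The added square makes this function
    strongly convex in [x] while it stays strongly concave in [y], so it has a
    saddle point [s z] ([regularized_saddle_exists]), and its saddle value is the
    Moreau envelope at [z] of the primal function of [F].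

    _Deterministic part._  Write [a = grad_x F + 2 L (x - z) + xi] and
    [b = grad_y F - nu] for the residual fields, in which [xi] and [nu] are the
    normal vectors left over by the projections.  The potential is
    [|a|^2 / 2 + |b + v|^2 / 2] plus a multiple of the gap between the saddle
    value and the current value, plus [|m|^2 / 4] where [m] corrects the momentum
    by the distance from [y] to the dual component of [s z], plus [L] times the
    saddle value.  With [z] fixed, the displacement of a step is, up to the
    difference between the two query points, the one of an implicit Euler step;
    strong monotonicity then makes the potential decrease by a multiple of
    [|a|^2 + |b|^2].  Moving [z] costs terms of order [beta] only, and it produces
    the missing decrease [beta L^2 |x - z|^2] because the gradient of the
    saddle value at [z] is [2 L] times the vector from the proximal point to
    [z].  Altogether ([potential_step]) the potential decreases by [beta / 16]
    times a bound of the squared residual plus [beta L^2] times the squared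
    distances between successive query points, up to [beta^-1] times the squared
    errors of the three gradient estimates.  It starts at most [L]
    times the initial quantity above [L] times the infimum of the primal function
    ([initial_potential]) and never falls below the latter ([potential_ge]);
    telescoping gives [descent_bound], which holds for every outcome of the
    samples.

    _Stochastic part._  A refresh has mean square error at most [sigma^2 / Br].
    A recursive request adds increments that are centered given everything known
    before, so mean square errors add up ([mean_sq_pythagoras],
    [batch_mean_sq]), and their contribution is at most [ell^2] times the squared move
    of the query point, divided by the batch size ([update_error]).  Between two
    refreshes a move is counted at most [q] times ([spider_sum]).  Hence the moves
    that feed the errors are the very moves that the potential controls, and the
    choice [b >= A q] makes the first contribution smaller than the second
    ([mean_rb_sum]).  Cancelling it requires all moments to be finite, which is
    shown by induction along the run ([random_run]); that every sample is
    independent of the past at which its query point is measurable is a pi-lambda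
    argument ([fresh]).  Since the index [J] is independent of the run, the
    expected residual at the output is the average over the steps
    ([output_residual]), and the choice of [T] and [Br] makes it at most [eps^2].

    _Cost._  A refresh every [q] requests costs [Br / q] per request and a
    recursive request [2 b], about [2 A q]; [q = sqrt (Br / A)] balances the two at
    the order of [sqrt (A Br)] ([sfo_total_bound]).  As [beta^-2] is proportional
    to [kappa], all the rates follow by rounding. *)

Set Implicit Arguments.
Unset Strict Implicit.
Unset Printing Implicit Defensive.

Local Open Scope classical_set_scope.
Local Open Scope ring_scope.

(** * Euclidean geometry *)

Section EuclideanGeometry.
Context {R : realType}.

Section RowVectors.
Context {m : nat}.
Implicit Types (x y z : 'rV[R]_m) (c : R).

Lemma dotvC x y : dotv x y = dotv y x.
Proof. by apply: eq_bigr => i _; rewrite mulrC. Qed.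

Lemma dotvDl x y z : dotv (x + y) z = dotv x z + dotv y z.
Proof. by rewrite -big_split; apply: eq_bigr => i _; rewrite mxE mulrDl. Qed.

Lemma dotvZl c x y : dotv (c *: x) y = c * dotv x y.
Proof. by rewrite /dotv mulr_sumr; apply: eq_bigr => i _; rewrite mxE mulrA. Qed.

Lemma dotvDr x y z : dotv x (y + z) = dotv x y + dotv x z.
Proof. by rewrite dotvC dotvDl !(dotvC x). Qed.

Lemma dotvZr c x y : dotv x (c *: y) = c * dotv x y.
Proof. by rewrite dotvC dotvZl dotvC. Qed.

Lemma dotvNl x y : dotv (- x) y = - dotv x y.
Proof. by rewrite -scaleN1r dotvZl mulN1r. Qed.

Lemma dotvNr x y : dotv x (- y) = - dotv x y.
Proof. by rewrite dotvC dotvNl dotvC. Qed.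

Lemma dotv0l x : dotv 0 x = 0.
Proof. by rewrite -(scale0r 0) dotvZl mul0r. Qed.

Lemma dotv0r x : dotv x 0 = 0.
Proof. by rewrite dotvC dotv0l. Qed.

Lemma dotv_ge0 x : 0 <= dotv x x.
Proof. by apply: sumr_ge0 => i _; rewrite -expr2 sqr_ge0. Qed.

Lemma coord_sq_le x i : x 0 i ^+ 2 <= dotv x x.
Proof.
rewrite /dotv (bigD1 i)//= -expr2 lerDl; apply: sumr_ge0 => j _.
by rewrite -expr2 sqr_ge0.
Qed.

Lemma dotv_eq0 x : dotv x x <= 0 -> x = 0.
Proof.
move=> x0; apply/rowP => i; rewrite mxE; apply/eqP.
by rewrite -sqrf_eq0 eq_le sqr_ge0 andbT (le_trans (coord_sq_le x i)).
Qed.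

Lemma enorm_ge0 x : 0 <= enorm x.
Proof. exact: sqrtr_ge0. Qed.

Lemma sqr_enorm x : enorm x ^+ 2 = dotv x x.
Proof. by rewrite sqr_sqrtr// dotv_ge0. Qed.

Lemma ler_enorm x y : (enorm x <= enorm y) = (dotv x x <= dotv y y).
Proof. by rewrite ler_sqrt// dotv_ge0. Qed.

Lemma dotvBB x y : dotv (x - y) (x - y) = dotv (y - x) (y - x).
Proof. by rewrite -opprB dotvNl dotvNr opprK. Qed.

End RowVectors.

Lemma dotv_sqD {m} (x y : 'rV[R]_m) (c : R) : dotv (x + c *: y) (x + c *: y) =
  dotv x x + 2 * dotv x (c *: y) + c ^+ 2 * dotv y y.
Proof. by rewrite !(dotvDl, dotvDr, dotvZl, dotvZr) (dotvC y x); ring. Qed.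

Definition dotvE := (@dotvDl, @dotvDr, @dotvNl, @dotvNr, @dotvZl, @dotvZr,
  @dotv0l, @dotv0r).

Section Pairs.
Context {n p : nat}.
Local Notation V := ('rV[R]_n * 'rV[R]_p)%type.
Implicit Types u v w : V.

Definition dotp u v : R := dotv u.1 v.1 + dotv u.2 v.2.

Lemma dotpC u v : dotp u v = dotp v u.
Proof. by rewrite /dotp dotvC [dotv u.2 _]dotvC. Qed.

Lemma dotpDl u v w : dotp (u + v) w = dotp u w + dotp v w.
Proof. by rewrite /dotp !dotvDl addrACA. Qed.

Lemma dotpDr u v w : dotp w (u + v) = dotp w u + dotp w v.
Proof. by rewrite dotpC dotpDl !(dotpC w). Qed.

Lemma dotpZl c u v : dotp (c *: u) v = c * dotp u v.
Proof. by rewrite /dotp !dotvZl mulrDr. Qed.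

Lemma dotpZr c u v : dotp u (c *: v) = c * dotp u v.
Proof. by rewrite dotpC dotpZl dotpC. Qed.

Lemma dotpNl u v : dotp (- u) v = - dotp u v.
Proof. by rewrite -scaleN1r dotpZl mulN1r. Qed.

Lemma dotpNr u v : dotp u (- v) = - dotp u v.
Proof. by rewrite dotpC dotpNl dotpC. Qed.

Lemma dotp_ge0 u : 0 <= dotp u u.
Proof. by rewrite addr_ge0// dotv_ge0. Qed.

Lemma enormpE u : enormp u = Num.sqrt (dotp u u).
Proof. by rewrite /enormp !sqr_enorm. Qed.

Lemma enormp_ge0 u : 0 <= enormp u.
Proof. exact: sqrtr_ge0. Qed.

Lemma sqr_enormp u : enormp u ^+ 2 = dotp u u.
Proof. by rewrite enormpE sqr_sqrtr// dotp_ge0. Qed.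

(** Expand the square of [<v, v> u - <u, v> v]. *)
Lemma dotp_CS u v : dotp u v ^+ 2 <= dotp u u * dotp v v.
Proof.
have H : 0 <= dotp (dotp v v *: u - dotp u v *: v) (dotp v v *: u - dotp u v *: v).
  exact: dotp_ge0.
rewrite !(dotpDl, dotpDr, dotpNl, dotpNr, dotpZl, dotpZr) (dotpC v u) in H.
have [v0|v0] := eqVneq (dotp v v) 0.
  have v00 : v = 0.
    have := dotv_ge0 v.1; have := dotv_ge0 v.2; move: v0; rewrite /dotp => v0 h1 h2.
    rewrite [v]surjective_pairing; congr pair; apply: dotv_eq0; lra.
  by rewrite v00 -(scale0r (0 : V)) dotpZr mul0r expr0n/= mulr_ge0// ?dotp_ge0.
have vp : 0 < dotp v v by rewrite lt_neqAle eq_sym v0 dotp_ge0.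
by rewrite -subr_ge0 -(pmulr_rge0 _ vp); move: H; congr (0 <= _); ring.
Qed.

Lemma dotp_le u v : `|dotp u v| <= enormp u * enormp v.
Proof.
rewrite -(@ler_pXn2r _ 2)// ?nnegrE ?mulr_ge0 ?enormp_ge0//.
by rewrite real_normK ?num_real// exprMn !sqr_enormp dotp_CS.
Qed.

Lemma ler_enormpD u v : enormp (u + v) <= enormp u + enormp v.
Proof.
rewrite -(@ler_pXn2r _ 2)// ?nnegrE ?addr_ge0 ?enormp_ge0// sqrrD !sqr_enormp.
rewrite dotpDl !dotpDr (dotpC v u).
have := ler_norm (dotp u v); have := dotp_le u v; lra.
Qed.

Lemma enormpN u : enormp (- u) = enormp u.
Proof. by rewrite !enormpE dotpNl dotpNr opprK. Qed.

Lemma ler_dist_enormp u v : `|enormp u - enormp v| <= enormp (u - v).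
Proof.
rewrite ler_norml; apply/andP; split.
  have := ler_enormpD (v - u) u; rewrite subrK -(enormpN (v - u)) opprB; lra.
by have := ler_enormpD (u - v) v; rewrite subrK; lra.
Qed.

End Pairs.

Lemma dotv_le {m} (x y : 'rV[R]_m) : dotv x y <= enorm x * enorm y.
Proof.
have := @dotp_le m 0 (x, 0) (y, 0); rewrite !enormpE /dotp/= !dotv0l !addr0.
exact/le_trans/ler_norm.
Qed.

Lemma ler_enormD {m} (x y : 'rV[R]_m) : enorm (x + y) <= enorm x + enorm y.
Proof.
have := @ler_enormpD m 0 (x, 0) (y, 0).
by rewrite !enormpE /dotp/= !addr0 !dotv0l !addr0.
Qed.

Lemma enormN {m} (x : 'rV[R]_m) : enorm (- x) = enorm x.
Proof. by rewrite /enorm dotvNl dotvNr opprK. Qed.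

(** The topology of row vectors comes from the sup norm; continuity of the
    squared Euclidean distances carries closedness, minimization and limits over
    to the Euclidean norm. *)
Lemma continuous_sqdist {m} (c : 'rV[R]_m) :
  continuous (fun x : 'rV[R]_m => dotv (x - c) (x - c)).
Proof.
move=> x.
have hc i : (fun x' : 'rV[R]_m => x' 0 i - c 0 i) @ x --> (x 0 i - c 0 i).
  apply: (@cvgB _ _ _ (nbhs x) _ (fun x' : 'rV[R]_m => x' 0 i) (fun=> c 0 i)).
    exact: coord_continuous.
  exact: cvg_cst.
pose f i (x' : 'rV[R]_m) := (x' 0 i - c 0 i) * (x' 0 i - c 0 i).
have -> : (fun x' : 'rV[R]_m => dotv (x' - c) (x' - c)) = \sum_i f i.
  by rewrite fct_sumE; apply/funext => x'; apply: eq_bigr => i _; rewrite !mxE.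
elim/big_ind : _ => [|g g' cg cg'|i _].
- exact: (@cst_continuous _ _ (0 : R)).
- exact: (@continuousD _ _ _ g g' x cg cg').
- exact: (@cvgM _ _ (nbhs x) _ (fun x' : 'rV[R]_m => x' 0 i - c 0 i)
    (fun x' : 'rV[R]_m => x' 0 i - c 0 i) _ _ (hc i) (hc i)).
Qed.

Lemma closed_sqball {m} (c : 'rV[R]_m) (r : R) :
  closed [set x : 'rV[R]_m | dotv (x - c) (x - c) <= r].
Proof.
have := @preimage_closed 'rV[R]_m R (fun x => dotv (x - c) (x - c))
  [set t | t <= r].
apply; last exact: closed_le.
by move=> x _; exact: continuous_sqdist.
Qed.

Lemma compact_sqball {m} (c : 'rV[R]_m) (r : R) :
  compact [set x : 'rV[R]_m | dotv (x - c) (x - c) <= r].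
Proof.
apply: bounded_closed_compact; last exact: closed_sqball.
exists (1 + `|r| + `|c|); split => [|M rM x /= xr]; first exact: num_real.
have xc : `|x - c| <= 1 + `|r|.
  rewrite [leLHS]/Num.norm/= mx_normrE; apply: bigmax_le => [|[i j] _].
    by rewrite addr_ge0.
  rewrite (ord1 i)/=; have := le_trans (coord_sq_le (x - c) j) xr.
  rewrite -real_normK ?num_real// => h.
  have := ler_norm r; have := sqr_ge0 (`|(x - c) 0 j| - 1); rewrite sqrrB; nra.
have := ler_normD (x - c) c; rewrite subrK; lra.
Qed.

Lemma convex_segment {m} (C : set 'rV[R]_m) x y (s : R) : convex_set C ->
  C x -> C y -> 0 <= s <= 1 -> C (x + s *: (y - x)).
Proof.
move=> cC Cx Cy /andP[s0 s1].
have := cC y x (Itv01 s0 s1); rewrite !inE => /(_ Cy Cx).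
by rewrite /conv/= /unstable.onem scalerBl scale1r scalerBr addrCA.
Qed.

Section Projection.
Context {m : nat} (C : set 'rV[R]_m).
Hypotheses (C0 : C !=set0) (Ccl : closed C) (Ccv : convex_set C).

Lemma eprojP x : C (eproj C x) /\
  forall c, C c -> dotv (x - eproj C x) (x - eproj C x) <= dotv (x - c) (x - c).
Proof.
(* Only the points no farther than a given [c0] compete, and they form a
   compact set. *)
have [c0 Cc0] := C0.
pose r := dotv (c0 - x) (c0 - x).
pose K := C `&` [set y | dotv (y - x) (y - x) <= r].
have cK : compact K.
  apply: (subclosed_compact _ (@compact_sqball _ x r)); last by move=> ? [].
  by apply: closedI => //; exact: closed_sqball.
have [c /set_mem[Cc /= cr] cmin] : exists2 c, c \in K &
    forall y, y \in K -> dotv (c - x) (c - x) <= dotv (y - x) (y - x).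
  apply: compact_EVT_min => //; first by exists c0; split => //=.
  by apply: continuous_subspaceT => y; exact: continuous_sqdist.
have main c' : C c' -> enorm (x - c) <= enorm (x - c').
  move=> Cc'; rewrite ler_enorm dotvBB (dotvBB x).
  have [h|/ltW h] := leP (dotv (c' - x) (c' - x)) r; last exact: le_trans h.
  by apply: cmin; rewrite inE.
rewrite /eproj; case: xgetP => [e _ [/= Ce emin]|/(_ c) []//].
by split => // c'' Cc''; rewrite -ler_enorm emin.
Qed.

Lemma eproj_in x : C (eproj C x).
Proof. by have [] := eprojP x. Qed.

(** Comparing the projection with the points of a short segment towards [c]
    and letting the segment shrink gives its variational characterization. *)
Lemma eproj_vi x c : C c -> dotv (x - eproj C x) (c - eproj C x) <= 0.
Proof.
move=> Cc; have [Cp pmin] := eprojP x; set e := eproj C x in Cp pmin *.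
rewrite leNgt; apply/negP => t0.
set t := dotv (x - e) (c - e) in t0.
set N := dotv (c - e) (c - e).
have N0 : 0 <= N by exact: dotv_ge0.
pose s := t / (N + t).
have s0 : 0 < s by rewrite divr_gt0// ltr_wpDl.
have sNt : s * (N + t) = t by rewrite /s mulfVK// gt_eqF// ltr_wpDl.
have s1 : s <= 1 by rewrite /s ler_pdivrMr ?mul1r ?lerDr// ltr_wpDl.
have s01 : 0 <= s <= 1 by rewrite ltW.
have := pmin _ (convex_segment Ccv Cp Cc s01).
rewrite opprD addrA -scaleNr dotv_sqD !dotvZr -/t -/N; nra.
Qed.

(** Adding the two variational inequalities, each tested at the other point,
    leaves the squared distance on the small side. *)
Lemma eproj_unique x c : C c ->
  (forall c', C c' -> dotv (x - c) (c' - c) <= 0) -> eproj C x = c.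
Proof.
move=> Cc vi; have h1 := vi _ (eproj_in x); have h2 := eproj_vi x Cc.
apply/eqP; rewrite -subr_eq0; apply/eqP/dotv_eq0.
set e := eproj C x in h1 h2 *.
have -> : dotv (e - c) (e - c) = dotv (x - c) (e - c) + dotv (x - e) (c - e).
  by rewrite !dotvE (dotvC c e); ring.
by lra.
Qed.

(** The squared distance of the arguments exceeds that of the projections by
    the squared distance of the residuals and by the two variational
    inequalities, each of which has the right sign. *)
Lemma eproj_nonexp x y :
  dotv (eproj C x - eproj C y) (eproj C x - eproj C y) <= dotv (x - y) (x - y).
Proof.
have h1 := eproj_vi x (eproj_in y); have h2 := eproj_vi y (eproj_in x).
set e := eproj C x in h1 h2 *; set f := eproj C y in h1 h2 *.
have h3 := dotv_ge0 ((x - e) - (y - f)).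
have <- : dotv (e - f) (e - f) + 2 * (- dotv (x - e) (f - e) - dotv (y - f) (e - f))
  + dotv ((x - e) - (y - f)) ((x - e) - (y - f)) = dotv (x - y) (x - y).
  rewrite !dotvE (dotvC y x) (dotvC e x) (dotvC f x) (dotvC e y) (dotvC f y) (dotvC f e).
  ring.
by lra.
Qed.

Lemma eproj_id x : C x -> eproj C x = x.
Proof. by move=> Cx; apply: eproj_unique => // c _; rewrite subrr dotv0l. Qed.

End Projection.

End EuclideanGeometry.

(** * Regularized saddle points *)

Section LineDerivative.
Context {R : realType} {n p : nat}.
Local Notation V := ('rV[R]_n * 'rV[R]_p)%type.
Implicit Types (F : V -> R) (u v : V).

(** The gradient is defined by partial derivatives, so the derivative in the
    direction [v] comes from linearity of the differential on the decomposition
    of [v] along the coordinate directions of the two factors. *)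
Lemma derive_gradE F u v : differentiable F u ->
  'D_v F u = dotp (grad F u) v.
Proof.
move=> dF; rewrite deriveE//.
have -> : v = (v.1, 0) + (0, v.2).
  by case: v => x y; congr pair; rewrite ?addr0 ?add0r.
rewrite linearD /dotp/= addr0 add0r; congr (_ + _).
- rewrite {1}(row_sum_delta v.1).
  rewrite (big_morph (fun x => 'd F u (x, 0)) (id1 := 0) (op1 := +%R)); first last.
  + exact: linear0.
  + by move=> x y; rewrite -linearD; congr ('d F u (_, _)); rewrite /= ?addr0.
  apply: eq_bigr => i _; rewrite mxE deriveE// mulrC.
  rewrite -[_ * _]/(_ *: _) -linearZ; congr ('d F u (_, _)).
  by rewrite /= scaler0.
- rewrite {1}(row_sum_delta v.2).
  rewrite (big_morph (fun x => 'd F u (0, x)) (id1 := 0) (op1 := +%R)); first last.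
  + exact: linear0.
  + by move=> x y; rewrite -linearD; congr ('d F u (_, _)); rewrite /= ?addr0.
  apply: eq_bigr => i _; rewrite mxE deriveE// mulrC.
  rewrite -[_ * _]/(_ *: _) -linearZ; congr ('d F u (_, _)).
  by rewrite /= scaler0.
Qed.

Lemma is_derive_line F u v (s : R) : differentiable F (u + s *: v) ->
  is_derive s 1 (fun t : R => F (u + t *: v)) (dotp (grad F (u + s *: v)) v).
Proof.
move=> dF.
have E : (fun h : R => h^-1 *: (((fun t : R => F (u + t *: v)) \o shift s) (h *: (1 : R))
    - F (u + s *: v))) =
  (fun h : R => h^-1 *: ((F \o shift (u + s *: v)) (h *: v) - F (u + s *: v))).
  apply/funext => h /=; congr (_ *: (F _ - _)).
  by rewrite [h *: 1]mulr1 scalerDl addrCA.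
have dv : derivable F (u + s *: v) v by exact: diff_derivable.
split; first by rewrite /derivable E.
by rewrite -derive_gradE// /derive E.
Qed.

(** A gradient that is [L]-Lipschitz along a segment keeps the function above
    its tangent up to [L/2] times the squared length: the derivative of the
    difference along the segment is nonnegative once [L |v|^2 s^2 / 2] has been
    added. *)
Lemma lipschitz_grad_lower F u v (L : R) : 
  (forall s, 0 <= s <= 1 -> differentiable F (u + s *: v)) ->
  (forall s, 0 <= s <= 1 -> enormp (grad F (u + s *: v) - grad F u)
     <= L * enormp (s *: v)) ->
  F u + dotp (grad F u) v - L / 2 * dotp v v <= F (u + v).
Proof.
move=> dF lF; set N := dotp v v; set c := dotp (grad F u) v.
pose psi (s : R) := F (u + s *: v) + (L / 2 * N * s ^+ 2 - c * s).
pose dpsi (s : R) := dotp (grad F (u + s *: v)) v + (L / 2 * N * (2 * s) - c).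
have dpsiP (s : R) : 0 <= s <= 1 -> is_derive s 1 psi (dpsi s).
  move=> s01; have h := is_derive_line (dF _ s01).
  apply: is_deriveD; apply: is_deriveB.
    apply: is_derive_eq; rewrite /GRing.scale/=; ring.
  by apply: is_derive_eq; rewrite /GRing.scale/= mulr1.
have [||s s01] := @MVT _ psi dpsi 0 1 ltr01.
- by move=> s; rewrite in_itv/= => /andP[/ltW s0 /ltW s1]; apply: dpsiP; rewrite s0.
- apply: derivable_within_continuous => s; rewrite in_itv/= => s01.
  by have [] := dpsiP _ s01.
have {}s01 : 0 <= s <= 1 by move: s01; rewrite in_itv/= => /andP[/ltW-> /ltW->].
have : 0 <= dpsi s.
  have /ler_normlP[+ _] := dotp_le (grad F (u + s *: v) - grad F u) v.
  have := ler_wpM2r (enormp_ge0 v) (lF _ s01).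
  have -> : enormp (s *: v) = s * enormp v.
    rewrite !enormpE dotpZl dotpZr mulrA -expr2 sqrtrM ?sqr_ge0// sqrtr_sqr ger0_norm//.
    by case/andP: s01.
  rewrite -mulrA -(mulrA s) -expr2 sqr_enormp dotpDl dotpNl -/c -/N /dpsi; lra.
rewrite subr0 mulr1 => + E; rewrite -E /psi.
by rewrite !scale0r !scale1r addr0 expr1n expr0n/= !mulr0 !mulr1; lra.
Qed.

End LineDerivative.

(** The deterministic analysis depends on the objective only through these
    facts.  The map [G] is kept abstract because differentiability serves a
    single purpose, the weak convexity in [x]. *)
Record saddle_problem {R : realType} {n p : nat} (X : set 'rV[R]_n)
    (Y : set 'rV[R]_p) (F : 'rV[R]_n * 'rV[R]_p -> R)
    (G : 'rV[R]_n * 'rV[R]_p -> 'rV[R]_n * 'rV[R]_p) (L mu : R) : Prop := {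
  sp_mu_gt0 : 0 < mu;
  sp_mu_le : mu <= L;
  sp_X0 : X !=set0;
  sp_Xcl : closed X;
  sp_Xcv : convex_set X;
  sp_Y0 : Y !=set0;
  sp_Ycl : closed Y;
  sp_Ycv : convex_set Y;
  sp_lip : forall u u', (X `*` Y) u -> (X `*` Y) u' ->
    dotp (G u - G u') (G u - G u') <= L ^+ 2 * dotp (u - u') (u - u');
  sp_weak_convex : forall x x' y, X x -> X x' -> Y y ->
    F (x, y) + dotv (G (x, y)).1 (x' - x) - L / 2 * dotv (x' - x) (x' - x)
      <= F (x', y);
  sp_strong_concave : forall x y y', X x -> Y y -> Y y' ->
    F (x, y') <= F (x, y) + dotv (G (x, y)).2 (y' - y)
                 - mu / 2 * dotv (y' - y) (y' - y) }.

Lemma standing_saddle_problem {R : realType} {n p : nat} (X : set 'rV[R]_n)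
    (Y : set 'rV[R]_p) dW (W : measurableType dW) (D : probability W R)
    (f : 'rV[R]_n * 'rV[R]_p -> W -> R) (L mu : R) :
  standing_assumptions D X Y f L -> strong_concavity X Y (objective D f) L mu ->
  saddle_problem X Y (objective D f) (grad (objective D f)) L mu.
Proof.
move=> sa [mu0 muL sc]; have L0 := sa_L_gt0 sa.
have [U [_ XYU UF]] := sa_C1 sa.
split => //.
- exact: sa_X_nonempty sa.
- exact: sa_X_closed sa.
- exact: sa_X_convex sa.
- exact: sa_Y_nonempty sa.
- by apply: compact_closed (sa_Y_compact sa); exact: norm_hausdorff.
- exact: sa_Y_convex sa.
- move=> u u' uXY uXY'; rewrite -!sqr_enormp -exprMn.
  rewrite ler_pXn2r ?nnegrE ?mulr_ge0 ?enormp_ge0 ?(ltW L0)//.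
  exact: sa_lipschitz sa _ _ uXY uXY'.
- move=> x x' y Xx Xx' Yy.
  have inXY s : 0 <= s <= 1 -> (X `*` Y) ((x, y) + s *: (x' - x, 0)).
    move=> s01; rewrite /= scaler0 addr0; split => //=.
    exact: convex_segment (sa_X_convex sa) Xx Xx' s01.
  have := @lipschitz_grad_lower _ _ _ (objective D f) (x, y) (x' - x, 0) L.
  have -> : (x, y) + (x' - x, 0) = (x', y) :> 'rV[R]_n * 'rV[R]_p.
    by congr pair; rewrite /= ?addr0// addrCA subrr addr0.
  rewrite /dotp/= !dotv0r !addr0; apply.
    by move=> s s01; have [] := UF _ (XYU _ (inXY _ s01)).
  move=> s s01; apply: le_trans (sa_lipschitz sa (inXY _ s01) _) _; first by split.
  by rewrite addrAC subrr add0r.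
- by move=> x y y' Xx Yy Yy'; rewrite -sqr_enorm; apply: sc.
Qed.

Section SaddlePoint.
Context {R : realType} {n p : nat} (X : set 'rV[R]_n) (Y : set 'rV[R]_p).
Local Notation V := ('rV[R]_n * 'rV[R]_p)%type.
Context (F : V -> R) (G : V -> V) (L mu : R).
Hypothesis H : saddle_problem X Y F G L mu.
Local Notation XY := (X `*` Y).
Local Notation mu_gt0 := (sp_mu_gt0 H).

Lemma sp_L_gt0 : 0 < L.
Proof. exact: lt_le_trans (sp_mu_gt0 H) (sp_mu_le H). Qed.

(** Adding [2 L <x - z, .>] in [x] turns the weakly convex part into a strongly
    convex one, so [(grad_x + 2 L (x - z), - grad_y)] is strongly monotone. *)
Lemma strong_monotone u u' : XY u -> XY u' ->
  - L * dotv (u'.1 - u.1) (u'.1 - u.1) + mu * dotv (u'.2 - u.2) (u'.2 - u.2)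
    <= dotv ((G u').1 - (G u).1) (u'.1 - u.1)
       - dotv ((G u').2 - (G u).2) (u'.2 - u.2).
Proof.
case: u u' => [x y] [x' y'] [/= Xx Yy] [/= Xx' Yy'].
have h1 := sp_weak_convex H Xx Xx' Yy; have h2 := sp_weak_convex H Xx' Xx Yy'.
have h3 := sp_strong_concave H Xx Yy Yy'; have h4 := sp_strong_concave H Xx' Yy' Yy.
move: h1 h2 h3 h4; rewrite -(opprB x') -(opprB y').
move: (x' - x) (y' - y) => dx dy.
by rewrite !(dotvNr, dotvNl, dotvDl) /=; lra.
Qed.

(** The first-order form of a saddle point of [F (x, y) + L |x - z|^2]; convexity
    makes it equivalent to the inequalities of [saddle_min] and [saddle_max]. *)
Definition regularized_saddle (z : 'rV[R]_n) (s : V) : Prop :=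
  [/\ XY s,
      forall x, X x -> 0 <= dotv ((G s).1 + (2 * L) *: (s.1 - z)) (x - s.1) &
      forall y, Y y -> dotv (G s).2 (y - s.2) <= 0].

Definition saddle_step (z : 'rV[R]_n) (eta : R) (u : V) : V :=
  (eproj X (u.1 - eta *: ((G u).1 + (2 * L) *: (u.1 - z))),
   eproj Y (u.2 + eta *: (G u).2)).

Lemma saddle_step_in z eta u : XY (saddle_step z eta u).
Proof.
by split; apply: eproj_in; [exact: sp_X0 H|exact: sp_Xcl H|exact: sp_Y0 H|exact: sp_Ycl H].
Qed.

(** A forward step along a strongly monotone Lipschitz field contracts when the
    step is small, and projecting keeps the contraction. *)
Lemma saddle_step_contraction z (eta : R) u u' : XY u -> XY u' -> 0 <= eta ->
  dotp (saddle_step z eta u - saddle_step z eta u')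
       (saddle_step z eta u - saddle_step z eta u')
  <= (1 - 2 * eta * mu + 10 * eta ^+ 2 * L ^+ 2) * dotp (u - u') (u - u').
Proof.
move=> uXY uXY' eta0.
have lx := eproj_nonexp (sp_X0 H) (sp_Xcl H) (sp_Xcv H)
  (u.1 - eta *: ((G u).1 + (2 * L) *: (u.1 - z)))
  (u'.1 - eta *: ((G u').1 + (2 * L) *: (u'.1 - z))).
have ly := eproj_nonexp (sp_Y0 H) (sp_Ycl H) (sp_Ycv H)
  (u.2 + eta *: (G u).2) (u'.2 + eta *: (G u').2).
rewrite {1}/dotp/=; apply: le_trans (lerD lx ly) _; clear lx ly.
have sm := strong_monotone uXY' uXY; have lip := sp_lip H uXY uXY'.
move: sm lip; rewrite /dotp/=.
set gx := (G u).1 - _; set gy := (G u).2 - _; set dx := u.1 - u'.1; set dy := u.2 - u'.2.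
have -> : u.1 - eta *: ((G u).1 + (2 * L) *: (u.1 - z)) -
  (u'.1 - eta *: ((G u').1 + (2 * L) *: (u'.1 - z))) =
    dx + (- eta) *: (gx + (2 * L) *: dx).
  by apply/rowP => i; rewrite /dx /gx !mxE; ring.
have -> : u.2 + eta *: (G u).2 - (u'.2 + eta *: (G u').2) = dy + eta *: gy.
  by apply/rowP => i; rewrite /dy /gy !mxE; ring.
move: gx gy dx dy => gx gy dx dy.
rewrite !dotv_sqD !dotvZr dotvDr dotvZr (dotvC dx gx) (dotvC dy gy) => sm lip.
have L0 := sp_L_gt0; have muL := sp_mu_le H.
have nx := dotv_ge0 dx; have ny := dotv_ge0 dy.
have hh : dotv gx gx + 2 * (2 * L * dotv gx dx) + (2 * L) ^+ 2 * dotv dx dx <=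
    2 * dotv gx gx + 8 * L ^+ 2 * dotv dx dx.
  have := dotv_ge0 (gx + (- (2 * L)) *: dx).
  rewrite dotv_sqD !dotvZr; lra.
have e2 := sqr_ge0 eta.
have h1 := ler_wpM2l e2 hh; have h2 := ler_wpM2l e2 lip.
have h3 := ler_wpM2l eta0 sm.
have h4 : eta * mu * dotv dx dx <= eta * L * dotv dx dx.
  by rewrite ler_wpM2r// ler_wpM2l.
have gy0 : 0 <= eta ^+ 2 * dotv gy gy by exact: mulr_ge0 e2 (dotv_ge0 _).
have h5 : 0 <= eta ^+ 2 * L ^+ 2 * dotv dy dy by exact: mulr_ge0 (mulr_ge0 e2 (sqr_ge0 L)) ny.
lra.
Qed.

(** A saddle point is a fixed point of the projected forward step, a contraction
    [T].  The displacement [|u - T u|] attains its minimum on a ball that [T]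
    maps to itself; at a minimizer it vanishes, since [T] shrinks it by a factor
    less than one. *)
Lemma regularized_saddle_exists z : exists s, regularized_saddle z s.
Proof.
have [x0 Xx0] := sp_X0 H; have [y0 Yy0] := sp_Y0 H.
have L0 := sp_L_gt0; have mu0 := sp_mu_gt0 H; have muL := sp_mu_le H.
pose eta := mu / (10 * L ^+ 2); pose rho := 1 - mu ^+ 2 / (10 * L ^+ 2).
have eta0 : 0 < eta by rewrite divr_gt0// mulr_gt0// exprn_gt0.
have L2 : 0 < 10 * L ^+ 2 by rewrite mulr_gt0// exprn_gt0.
have rho1 : rho < 1 by rewrite ltrBlDr ltrDl divr_gt0// exprn_gt0.
have rho0 : 0 <= rho.
  rewrite subr_ge0 ler_pdivrMr// mul1r; have := sqr_ge0 L; nra.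
pose pr (u : V) : V := (eproj X u.1, eproj Y u.2).
have prXY u : XY (pr u).
  by split; apply: eproj_in; [exact: sp_X0 H|exact: sp_Xcl H|exact: sp_Y0 H|exact: sp_Ycl H].
have pr_lip u u' : dotp (pr u - pr u') (pr u - pr u') <= dotp (u - u') (u - u').
  apply: lerD; apply: eproj_nonexp;
  [exact: sp_X0 H|exact: sp_Xcl H|exact: sp_Xcv H|exact: sp_Y0 H|exact: sp_Ycl H|exact: sp_Ycv H].
pose T u := saddle_step z eta (pr u).
have TXY u : XY (T u) by exact: saddle_step_in.
pose q := Num.sqrt rho.
have q1 : q < 1 by rewrite /q -sqrtr1 ltr_sqrt.
have q0 : 0 <= q by exact: sqrtr_ge0.
have T_lip u u' : enormp (T u - T u') <= q * enormp (u - u').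
  rewrite !enormpE -sqrtrM// ler_sqrt ?mulr_ge0 ?dotp_ge0//.
  apply: le_trans (saddle_step_contraction z (prXY u) (prXY u') (ltW eta0)) _.
  have -> : 1 - 2 * eta * mu + 10 * eta ^+ 2 * L ^+ 2 = rho.
    by rewrite /eta /rho; field; rewrite gt_eqF.
  exact: ler_wpM2l.
pose f u := enormp (u - T u).
have f_lip u u' : `|f u - f u'| <= 2 * enormp (u - u').
  apply: le_trans (ler_dist_enormp _ _) _.
  have -> : u - T u - (u' - T u') = (u - u') - (T u - T u').
    by rewrite !opprB addrACA [RHS]addrACA [- T u + _]addrC (addrC (- u')).
  apply: le_trans (ler_enormpD _ _) _; rewrite enormpN.
  have := T_lip u u'; have := enormp_ge0 (u - u'); nra.
pose u0 : V := (x0, y0).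
(* the radius for which [|T u0 - u0| + q r = r] *)
pose r := f u0 / (1 - q).
have r0 : 0 <= r by rewrite divr_ge0 ?enormp_ge0// subr_ge0 ltW.
pose K := [set u : V | enormp (u - u0) <= r].
have K0 : K u0 by rewrite /K/= subrr enormpE /dotp !dotv0l addr0 sqrtr0.
have TK u : K u -> K (T u).
  rewrite /K/= => Ku.
  have -> : T u - u0 = (T u - T u0) + (- (u0 - T u0)) by rewrite opprB addrA subrK.
  apply: le_trans (ler_enormpD _ _) _; rewrite enormpN -/(f u0).
  have -> : f u0 = r * (1 - q) by rewrite /r mulfVK// gt_eqF// subr_gt0.
  have := T_lip u u0; nra.
have dist_cont (c : V) : continuous (fun u : V => enormp (u - c)).
  move=> u; rewrite (_ : (fun _ => _) = Num.sqrt \o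
    (((fun x => dotv (x - c.1) (x - c.1)) \o fst) \+
     ((fun x => dotv (x - c.2) (x - c.2)) \o snd))); last first.
    by apply/funext => v /=; rewrite enormpE.
  apply: continuous_comp; last exact: sqrt_continuous.
  apply: continuousD; apply: continuous_comp;
  [exact: cvg_fst|exact: continuous_sqdist|exact: cvg_snd|exact: continuous_sqdist].
have cK : compact K.
  have cB := compact_setX (@compact_sqball R n x0 (r ^+ 2))
    (@compact_sqball R p y0 (r ^+ 2)).
  apply: subclosed_compact cB _.
    have := @preimage_closed V R (fun u => enormp (u - u0)) [set t | t <= r].
    apply; last exact: closed_le.
    by move=> u _; exact: dist_cont.
  move=> u; rewrite /K/= -(@ler_pXn2r _ 2)// ?nnegrE ?enormp_ge0// sqr_enormp /dotp/=.
  have := dotv_ge0 (u.1 - x0); have := dotv_ge0 (u.2 - y0).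
  by move=> h1 h2 h3; split; lra.
have cf : continuous f.
  move=> u; apply/cvgrPdist_lt => e e0.
  have : enormp (u' - u) @[u' --> u] --> (0 : R).
    have := dist_cont u u; rewrite /continuous_at subrr.
    by rewrite [X in _ --> X]enormpE /dotp !dotv0l addr0 sqrtr0.
  move=> /cvgrPdist_lt/(_ (e / 2)); rewrite divr_gt0// => /(_ isT).
  apply: filterS => u'; rewrite sub0r normrN ger0_norm ?enormp_ge0// => h.
  by rewrite distrC; apply: le_lt_trans (f_lip _ _) _; lra.
have [u /set_mem Ku umin] : exists2 u, u \in K & forall t, t \in K -> f u <= f t.
  by apply: compact_EVT_min => //; [exists u0|exact: continuous_subspaceT].
have fu0 : f u = 0.
  have := umin (T u); rewrite inE => /(_ (TK _ Ku)).
  have : f (T u) <= q * f u by exact: T_lip.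
  have fu0 : 0 <= f u by exact: enormp_ge0.
  move=> h1 h2; have q1' : 0 < 1 - q by rewrite subr_gt0.
  have : (1 - q) * f u <= 0.
    by rewrite mulrBl mul1r subr_le0; exact: le_trans h2 h1.
  by rewrite pmulr_rle0// => ?; apply/eqP; rewrite eq_le fu0 andbT.
have uT : u = T u.
  apply/eqP; rewrite -subr_eq0; apply/eqP.
  have : dotp (u - T u) (u - T u) = 0 by rewrite -sqr_enormp -/(f u) fu0 expr0n.
  rewrite /dotp => d0; have h1 := dotv_ge0 (u - T u).1; have h2 := dotv_ge0 (u - T u).2.
  rewrite [LHS]surjective_pairing; congr pair; apply: dotv_eq0; lra.
have uXY : XY u by rewrite uT.
have pru : pr u = u.
  case: (u) uXY => x y [/= Xx Yy]; congr pair; apply: eproj_id => //;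
  [exact: sp_X0 H|exact: sp_Xcl H|exact: sp_Xcv H|exact: sp_Y0 H|exact: sp_Ycl H|exact: sp_Ycv H].
move: uT; rewrite /T pru /saddle_step => uT.
have ux := congr1 fst uT; have uy := congr1 snd uT; rewrite /= in ux uy.
exists u; split => // [x Xx|y Yy].
- have := eproj_vi (sp_X0 H) (sp_Xcl H) (sp_Xcv H)
    (u.1 - eta *: ((G u).1 + (2 * L) *: (u.1 - z))) Xx.
  rewrite -ux addrAC subrr add0r dotvNl dotvZl oppr_le0 pmulr_rge0//.
- have := eproj_vi (sp_Y0 H) (sp_Ycl H) (sp_Ycv H) (u.2 + eta *: (G u).2) Yy.
  by rewrite -uy addrAC subrr add0r dotvZl pmulr_rle0.
Qed.

Definition saddle_value (z : 'rV[R]_n) (s : V) : R :=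
  F s + L * dotv (s.1 - z) (s.1 - z).

Lemma saddle_min z s x : regularized_saddle z s -> X x ->
  saddle_value z s + L / 2 * dotv (x - s.1) (x - s.1) <= saddle_value z (x, s.2).
Proof.
move=> [[Xs Ys] vx _] Xx; have := vx _ Xx.
have := sp_weak_convex H Xs Xx Ys; rewrite -surjective_pairing.
have E : x - z = (s.1 - z) + 1 *: (x - s.1).
  by rewrite scale1r [RHS]addrC addrA subrK.
rewrite /saddle_value /= E; move: (x - s.1) (s.1 - z) => d r.
rewrite dotv_sqD dotvDl dotvZl dotvZr; lra.
Qed.

Lemma saddle_max z s y : regularized_saddle z s -> Y y ->
  F (s.1, y) <= F s - mu / 2 * dotv (y - s.2) (y - s.2).
Proof.
move=> [[Xs Ys] _ vy] Yy; have := vy _ Yy.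
have := sp_strong_concave H Xs Ys Yy; rewrite -surjective_pairing; lra.
Qed.

(** Moving the proximal center perturbs the saddle value as if the saddle point
    were fixed: the envelope inequality behind the descent in [z]. *)
Lemma saddle_value_le z z' s s' :
  regularized_saddle z s -> regularized_saddle z' s' ->
  saddle_value z' s' <= F s + L * dotv (s.1 - z') (s.1 - z').
Proof.
move=> Hs Hs'; have [[Xs _] _ _] := Hs; have [[_ Ys'] _ _] := Hs'.
have := saddle_min Hs' Xs; have := saddle_max Hs Ys'.
have : 0 <= L / 2 * dotv (s.1 - s'.1) (s.1 - s'.1).
  by rewrite mulr_ge0 ?dotv_ge0// divr_ge0// ltW// sp_L_gt0.
have : 0 <= mu / 2 * dotv (s'.2 - s.2) (s'.2 - s.2).
  by rewrite mulr_ge0 ?dotv_ge0// divr_ge0// ltW// (sp_mu_gt0 H).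
rewrite [saddle_value z' (_, _)]/saddle_value /=; lra.
Qed.

(** Adding the four saddle inequalities at [s] and [s'] bounds the dual
    distance by the change of center: the primal distances appear in a complete
    square, [L |(s'.1 - s.1) - (z' - z)|^2]. *)
Lemma saddle_stable z z' s s' :
  regularized_saddle z s -> regularized_saddle z' s' ->
  mu * dotv (s'.2 - s.2) (s'.2 - s.2) <= L * dotv (z' - z) (z' - z).
Proof.
move=> Hs Hs'; have [[Xs Ys] _ _] := Hs; have [[Xs' Ys'] _ _] := Hs'.
have := saddle_min Hs Xs'; have := saddle_max Hs Ys'.
have := saddle_min Hs' Xs; have := saddle_max Hs' Ys.
rewrite /saddle_value/= (dotvBB s.2 s'.2) (dotvBB s.1 s'.1).
set r := s.1 - z; set d := s'.1 - s.1; set e := z' - z.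
have -> : s'.1 - z = r + 1 *: d.
  by apply/rowP => i; rewrite /r /d !mxE; ring.
have -> : s'.1 - z' = (r + 1 *: d) + (-1) *: e.
  by apply/rowP => i; rewrite /r /d /e !mxE; ring.
have -> : s.1 - z' = r + (-1) *: e.
  by apply/rowP => i; rewrite /r /e !mxE; ring.
clearbody r d e; move: (s'.2 - s.2) => dy.
have := mulr_ge0 (ltW sp_L_gt0) (dotv_ge0 (d + (-1) *: e)).
rewrite !dotv_sqD !dotvDl !dotvZl !dotvZr.
lra.
Qed.

End SaddlePoint.

(** * Decrease of the potential in one step *)

Section OneStep.
Context {R : realType}.

Lemma young {m} (c : R) (x y : 'rV[R]_m) : 0 < c ->
  2 * dotv x y <= c * dotv x x + c^-1 * dotv y y.
Proof.
move=> c0; have ci : 0 < c^-1 by rewrite invr_gt0.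
have := mulr_ge0 (ltW ci) (dotv_ge0 (c *: x + (-1) *: y)).
have -> : c^-1 * dotv (c *: x + (-1) *: y) (c *: x + (-1) *: y) =
    c * dotv x x + c^-1 * dotv y y - 2 * dotv x y.
  by rewrite dotv_sqD !dotvZl !dotvZr; field; rewrite gt_eqF.
by rewrite subr_ge0.
Qed.

(** The shape in which a coefficient that depends on [th] is replaced by a
    constant: [w] may be negative, its bound [M] may not. *)
Lemma le_scale (c k w M : R) : 0 <= c -> c <= k -> w <= M -> 0 <= M ->
  c * w <= k * M.
Proof.
move=> c0 ck wM M0; apply: le_trans (ler_wpM2l c0 wM) _.
exact: ler_wpM2r.
Qed.

Lemma youngN {m} (c : R) (x y : 'rV[R]_m) : 0 < c ->
  - (2 * dotv x y) <= c * dotv x x + c^-1 * dotv y y.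
Proof.
by move=> c0; have := young (- x) y c0; rewrite !dotvNl dotvNr opprK; lra.
Qed.

Lemma sq_sum3 {m} (x y z : 'rV[R]_m) :
  dotv (x + y + z) (x + y + z) <= 3 * (dotv x x + dotv y y + dotv z z).
Proof.
have := dotv_ge0 (x - y); have := dotv_ge0 (x - z); have := dotv_ge0 (y - z).
rewrite !dotvE (dotvC y x) (dotvC z x) (dotvC z y); lra.
Qed.

Lemma sq_sum2 {m} (x y : 'rV[R]_m) :
  dotv (x + y) (x + y) <= 2 * (dotv x x + dotv y y).
Proof. by have := dotv_ge0 (x - y); rewrite !dotvE (dotvC y x); lra. Qed.

(** The decrease of the potential for a fixed center, as a quadratic inequality
    between free vectors: [ta] and [ra] are the displacement direction in [x] and
    its deviation, [b] the new dual residual, [v] the new momentum, [de] the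
    deviation of its sum with [b], [e] an estimation error and [q] the
    scaled dual distance to the saddle point.  All cross terms are split by
    Young's inequality.  The momentum is only damped at the rate [th], so its
    product with the error costs [1 / th]; this is where the factor [beta^-1]
    in front of the errors comes from. *)
Lemma energy_decrease {n p} (ta ra : 'rV[R]_n) (b v de e q : 'rV[R]_p)
    (th S D E X a2 : R) :
  0 < th -> th <= 1 / 11 -> dotv ra ra <= D -> dotv de de <= S ->
  S <= D / 1000 + 4 * E -> dotv e e <= E -> a2 <= 2 * dotv ta ta + 2 * S ->
  0 <= X ->
  - dotv ta ta + dotv ((1 / 2 - th) *: (b + e) - th *: v) (b + v - de)
  + 96 * S - 96 * D + (3 / 4 - 2 * th) * (dotv ta ta + dotv ra ta)
  - (3 / 4 - 2 * th) * dotv b (b + v - de)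
  + 1 / 2 * dotv (v + q) ((1 / 2 - th) *: e - th *: de) + 1 / 4 * dotv v b
  + th / 4 * (a2 / 2 - X / 2 - 64 * dotv q q)
  <= - (dotv ta ta / 10) - dotv b b / 20 - th / 2 * dotv v v
     - 10 * th * dotv q q - th / 8 * X - 80 * D + 60 * E / th.
Proof.
move=> th0 th1 raD deS SD eE a2S X0.
have th0' := ltW th0; have thi : 0 < th^-1 by rewrite invr_gt0.
have nta := dotv_ge0 ta; have nb := dotv_ge0 b; have nv := dotv_ge0 v.
have nde := dotv_ge0 de; have ne := dotv_ge0 e; have nq := dotv_ge0 q.
have nra := dotv_ge0 ra.
have E0 : 0 <= E := le_trans ne eE.
have D0 : 0 <= D := le_trans nra raD.
have S0 : 0 <= S := le_trans nde deS.
set t := th^-1 in thi *.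
have tE : 11 * E <= t * E.
  apply: ler_wpM2r => //; rewrite /t -[leLHS]invrK lef_pV2 ?posrE//.
  by move: th1; rewrite mul1r.
have te : t * dotv e e <= t * E by rewrite ler_wpM2l// ltW.
have nte : 0 <= t * dotv e e by rewrite mulr_ge0// ltW.
have half_gt0 : 0 < 1 / 2 :> R by lra.
have th_3 : 0 < th / 3 by lra.
have th2 : 0 <= 1 / 2 - th by lra.
have th3 : 0 <= 1 / 4 - th by lra.
have th4 : 0 <= 3 / 4 - 2 * th by lra.
have thA := mulr_ge0 th0' nta; have thB := ler_wpM2r nb th1.
have thV := mulr_ge0 th0' nv; have thQ := mulr_ge0 th0' nq.
have thS := ler_wpM2r S0 th1; have thD := ler_wpM2r nde th1.
have tha := ler_wpM2l th0' a2S.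
have f1 : (3 / 4 - 2 * th) * dotv ra ta <= 3 / 4 * (4 * dotv ra ra + dotv ta ta / 16).
  have := @young _ 8 ra ta (ltr0Sn R 7) => h.
  by apply: le_scale => //; lra.
have f2 : (1 / 4 - th) * dotv b de <= 1 / 4 * (4 * dotv de de + dotv b b / 16).
  have := @young _ 8 de b (ltr0Sn R 7); rewrite (dotvC de b) => h.
  by apply: le_scale => //; lra.
have f5 : (1 / 2 - th) * dotv b e <= 1 / 2 * (4 * dotv e e + dotv b b / 16).
  have := @young _ 8 e b (ltr0Sn R 7); rewrite (dotvC e b) => h.
  by apply: le_scale => //; lra.
have f8 : (1 / 2 - th) * - dotv e de <= 1 / 2 * (dotv e e / 2 + dotv de de / 2).
  have := @youngN _ 1 e de ltr01; rewrite invr1 => h.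
  by apply: le_scale => //; lra.
have f6 : (1 / 2 - th) * dotv v e <= 1 / 2 * (th * dotv v v / 6 + 3 / 2 * (t * dotv e e)).
  have := @young _ (th / 3) v e th_3; rewrite invf_div -/t => h.
  by apply: le_scale => //; lra.
have f7 : (1 / 2 - th) * dotv q e <= 1 / 2 * (th * dotv q q / 2 + 1 / 2 * (t * dotv e e)).
  have := @young _ th q e th0; rewrite -/t => h.
  by apply: le_scale => //; lra.
have f3 : th * dotv v de <= th * (dotv v v / 4 + dotv de de).
  have := @young _ (1 / 2) v de half_gt0; rewrite invf_div divr1 => h.
  by rewrite ler_wpM2l//; lra.
have f4 : th * - dotv q de <= th * (dotv q q / 4 + dotv de de).
  have := @youngN _ (1 / 2) q de half_gt0; rewrite invf_div divr1 => h.
  by rewrite ler_wpM2l//; lra.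
have -> : 60 * E / th = 60 * (t * E) by rewrite /t; ring.
rewrite !dotvE (dotvC v b) (dotvC e b) (dotvC e v).
clearbody t; lra.
Qed.

End OneStep.

(** The bookkeeping that combines the decrease at a fixed center, the change of
    center and the squared moves.  The terms due to the center have the factor
    [be = th / (192 * 256)], small enough for the decrease at a fixed center to
    absorb them. *)
Lemma step_arith {R : realType}
  (th be A B Vv Q Xs D S E Et d2 a2 mm mG GG ad Xd P0 P1 P2 p1 p2 e0 : R) :
  192 * (P1 - P0) <= - (A / 10) - B / 20 - th / 2 * Vv - 10 * th * Q - th / 8 * Xs
    - 80 * D + 60 * Et ->
  P2 <= P1 + be * (- 2 * ad + 2 * be * d2 - (2 - be) * d2 + (7 / 2 - 4 * th) * Xd)
    - 1 / 2 * mG + 1 / 4 * GG ->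
  p1 <= 1 / (192 * 192) * (3 * A + 9 * (B + Vv + S) + 3 * D + 3 * E) ->
  p2 <= 2 / (192 * 192) * (D + e0) ->
  GG <= be ^+ 2 * d2 / 128 ->
  a2 <= 2 * A + 2 * S ->
  - (2 * ad) <= 4 * a2 + 4^-1 * d2 ->
  (7 / 4 - 2 * th) * Xd <= 7 / 4 * (2 * Xs + d2 / 8) ->
  - (2 * mG) <= 16 * be * mm + be * d2 / (16 * 128) ->
  mm <= 2 * (Vv + Q) -> e0 <= E -> S <= D / 1000 + 4 * E ->
  0 <= A -> 0 <= B -> 0 <= Vv -> 0 <= Q -> 0 <= Xs -> 0 <= D -> 0 <= S -> 0 <= E ->
  0 <= d2 -> 0 < be -> be <= 1 / (11 * 192 * 256) -> 11 * E <= Et ->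
  th = 192 * 256 * be ->
  P2 + be / 16 * (2 * a2 + 8 * d2 + B) + be * (p1 + p2) <= P0 + 192 * 256 * Et.
Proof.
move=> fc cs pl ul gl c1 c2 c3 c4 c5 e0E SD nA nB nV nQ nX nD nS nE nd b0 b1 EEt thb.
subst th; have b0' := ltW b0.
have bA := ler_wpM2r nA b1; have bB := ler_wpM2r nB b1.
have bS := ler_wpM2r nS b1; have bD := ler_wpM2r nD b1; have bE := ler_wpM2r nE b1.
have bbd := ler_wpM2l b0' (ler_wpM2r nd b1).
have {}pl := ler_wpM2l b0' pl; have {}ul := ler_wpM2l b0' ul.
have {}c1 := ler_wpM2l b0' c1; have {}c2 := ler_wpM2l b0' c2.
have {}c3 := ler_wpM2l b0' c3; have {}c5 := ler_wpM2l b0' c5.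
have bX := mulr_ge0 b0' nX; have bQ := mulr_ge0 b0' nQ; have bV := mulr_ge0 b0' nV.
have bd := mulr_ge0 b0' nd; have be0 := ler_wpM2l b0' e0E.
lra.
Qed.

(** Strong convexity in [x] turns the optimality residual of [x], in which the
    normal vector [xi] may be included, into a bound on the primal gap. *)
Lemma saddle_gap {R : realType} {n p : nat} (X : set 'rV[R]_n) (Y : set 'rV[R]_p)
    (F : 'rV[R]_n * 'rV[R]_p -> R) G (L mu : R) z s x' y' xi :
  saddle_problem X Y F G L mu -> regularized_saddle X Y G L z s ->
  (X `*` Y) (x', y') -> normal_cone X x' xi ->
  saddle_value F L z (x', y') - saddle_value F L z s <=
  dotv ((G (x', y')).1 + (2 * L) *: (x' - z) + xi)
       ((G (x', y')).1 + (2 * L) *: (x' - z) + xi) / (2 * L).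
Proof.
move=> H Hs u'XY nx; set a := _ + xi => /=.
have [[Xs1 Ys2] _ _] := Hs; have L0 := sp_L_gt0 H.
have wc := sp_weak_convex H u'XY.1 Xs1 u'XY.2; rewrite /= in wc.
have sm := saddle_max H Hs u'XY.2; rewrite /= in sm.
have m0 : 0 <= mu / 2 * dotv (y' - s.2) (y' - s.2).
  by rewrite mulr_ge0 ?dotv_ge0// divr_ge0// ltW// (sp_mu_gt0 H).
have n1 := nx.2 _ Xs1; set r := s.1 - x' in wc n1.
have E0 : dotv (s.1 - z) (s.1 - z) = dotv (x' - z) (x' - z) + 2 * dotv (x' - z) r
    + dotv r r.
  have -> : s.1 - z = (x' - z) + 1 *: r.
    by rewrite scale1r [RHS]addrC addrA subrK.
  by rewrite dotv_sqD scale1r; ring.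
have E1 : dotv (G (x', y')).1 r = dotv a r - 2 * L * dotv (x' - z) r - dotv xi r.
  by rewrite -dotvZl -!dotvNl -!dotvDl; congr dotv;
    apply/rowP => i; rewrite /a !mxE; ring.
have := @youngN _ _ L^-1 a r; rewrite invr_gt0 invrK => /(_ L0) yg.
have -> : dotv a a / (2 * L) = L^-1 * dotv a a / 2 by field; rewrite gt_eqF.
by rewrite /saddle_value /= E0; lra.
Qed.

Section Step.
Context {R : realType} {n p : nat} (X : set 'rV[R]_n) (Y : set 'rV[R]_p).
Local Notation V := ('rV[R]_n * 'rV[R]_p)%type.
Context (F : V -> R) (G : V -> V) (L mu th : R).
Hypothesis H : saddle_problem X Y F G L mu.
Hypotheses (th_gt0 : 0 < th) (thE : 128 * th ^+ 2 * L = mu).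

(** The weight [3 / 4 - 2 th] of the gap exceeds the rate [1 / 2 - th] at which the
    momentum accumulates the dual residual; this makes the square of that
    residual enter the decrease with the right sign. *)
Definition potential (z xi : 'rV[R]_n) (nu v : 'rV[R]_p) (u s : V) : R :=
  let a := (G u).1 + (2 * L) *: (u.1 - z) + xi in
  let w := (G u).2 - nu + v in
  let m := v + (th * L) *: (u.2 - s.2) in
  1 / 2 * (dotv a a + dotv w w)
  + (3 / 4 - 2 * th) * L * (saddle_value F L z s - saddle_value F L z u)
  + 1 / 4 * dotv m m + L * saddle_value F L z s.

Context (x z xi xt x' xi' z' : 'rV[R]_n) (y nu v yt y' nu' v' : 'rV[R]_p).
Context (g0 g1 g2 s s' : V).
Let h := (192 * L)^-1.
Let al := (1 + th / 192)^-1.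
Let k := (1 / 2 - th) / 192 / (1 + th / 192).
Let beta := th / (192 * 256).
Hypotheses (Hxi : normal_cone X x xi) (Hnu : normal_cone Y y nu).
Hypothesis xtE : xt = eproj X (x - h *: (g0.1 + (2 * L) *: (x - z) + xi)).
Hypothesis ytE : yt = eproj Y (y + h *: (g0.2 - nu + v)).
Hypothesis x'E : x' = eproj X (x - h *: (g1.1 + (2 * L) *: (xt - z))).
Hypothesis xi'E : xi' = h^-1 *: (x - x') - g1.1 - (2 * L) *: (xt - z).
Hypothesis y'E : y' = eproj Y (y + h *: (g1.2 + (al *: v + k *: g1.2))).
Hypothesis nu'E :
  nu' = (1 + k)^-1 *: (h^-1 *: (y - y') + g1.2 + (al *: v + k *: g1.2)).
Hypothesis v'E : v' = al *: v + k *: (g2.2 - nu').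
Hypothesis z'E : z' = z + beta *: (x' - z).
Hypotheses (Hs : regularized_saddle X Y G L z s)
  (Hs' : regularized_saddle X Y G L z' s').

Let u : V := (x, y).
Let ut : V := (xt, yt).
Let u' : V := (x', y').
(* [ta] and [tw] are the directions actually followed, [x' - x = - h ta] and
   [y' - y = h tw]; [a], [w] and [a'], [w'] are their exact counterparts at the
   old and at the new point, from which they deviate by [D] and [S]. *)
Let e0 := g0 - G u.
Let e1 := g1 - G ut.
Let e2 := g2 - G u'.
Let a := (G u).1 + (2 * L) *: (x - z) + xi.
Let a' := (G u').1 + (2 * L) *: (x' - z) + xi'.
Let ta := g1.1 + (2 * L) *: (xt - z) + xi'.
Let b := (G u).2 - nu.
Let b' := (G u').2 - nu'.
Let w := b + v.
Let w' := b' + v'.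
Let tw := g1.2 - nu' + (al *: v + k *: (g1.2 - nu')).
Let ra := a - ta.
Let rw := w - tw.
Let de := w' - tw.
Let D := dotv ra ra + dotv rw rw.
Let S := dotv (a' - ta) (a' - ta) + dotv de de.
Let E := dotp e0 e0 + dotp e1 e1 + dotp e2 e2.

Local Notation L0 := (sp_L_gt0 H).

(* [mu <= L] gives [128 th^2 <= 1]. *)
Lemma th_le : th <= 1 / 11.
Proof.
have h1 := sp_mu_le H; rewrite -thE in h1.
have : 128 * th ^+ 2 <= 1 by rewrite -(ler_pM2r L0) mul1r.
by have := th_gt0; nra.
Qed.

Let L_neq0 : L != 0. Proof. by rewrite gt_eqF// L0. Qed.
Let th1_neq0 : 1 + th / 192 != 0.
Proof. by rewrite gt_eqF//; have := th_gt0; lra. Qed.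
Let h_gt0 : 0 < h. Proof. by rewrite invr_gt0 mulr_gt0// L0. Qed.
Let k_bounds : 0 <= k <= 1 / 384.
Proof.
have t0 := th_gt0; have t1 := th_le.
rewrite /k divr_ge0//= ?ler_pdivrMr; lra.
Qed.
Let k1_neq0 : 1 + k != 0.
Proof. by rewrite gt_eqF//; have /andP[] := k_bounds; lra. Qed.

(* The normal vectors are what the projections leave over, so that in terms of
   them each update is an unprojected step. *)
Let x'_x : x' - x = - (h *: ta).
Proof.
by apply/rowP => i; rewrite /ta xi'E !mxE /h; field.
Qed.

Let y'_y : y' - y = h *: tw.
Proof.
have : (1 + k) *: nu' = h^-1 *: (y - y') + g1.2 + (al *: v + k *: g1.2).
  by rewrite nu'E scalerA divff// scale1r.
move=> E'; have -> : tw = - (1 + k) *: nu' + (1 + k) *: g1.2 + al *: v.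
  by apply/rowP => i; rewrite /tw !mxE; ring.
rewrite scaleNr E'; apply/rowP => i; rewrite !mxE /h; field; exact: L_neq0.
Qed.

Let uXY : (X `*` Y) u.
Proof. by split; [case: Hxi|case: Hnu]. Qed.

Let utXY : (X `*` Y) ut.
Proof.
by split; rewrite /ut/= ?xtE ?ytE; apply: eproj_in;
 [exact: sp_X0 H|exact: sp_Xcl H|exact: sp_Y0 H|exact: sp_Ycl H].
Qed.

Let u'XY : (X `*` Y) u'.
Proof.
by split; rewrite /u'/= ?x'E ?y'E; apply: eproj_in;
 [exact: sp_X0 H|exact: sp_Xcl H|exact: sp_Y0 H|exact: sp_Ycl H].
Qed.

Lemma step_normal_x : normal_cone X x' xi'.
Proof.
split; first by case: u'XY.
move=> c Xc.
have := eproj_vi (sp_X0 H) (sp_Xcl H) (sp_Xcv H) (x - h *: (g1.1 + (2 * L) *: (xt - z))) Xc.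
rewrite -x'E.
have -> : x - h *: (g1.1 + (2 * L) *: (xt - z)) - x' = h *: xi'.
  by rewrite xi'E; apply/rowP => i; rewrite !mxE /h; field; exact: L_neq0.
by rewrite dotvZl pmulr_rle0.
Qed.

Lemma step_normal_y : normal_cone Y y' nu'.
Proof.
split; first by case: u'XY.
move=> c Yc.
have := eproj_vi (sp_Y0 H) (sp_Ycl H) (sp_Ycv H) (y + h *: (g1.2 + (al *: v + k *: g1.2))) Yc.
rewrite -y'E.
have -> : y + h *: (g1.2 + (al *: v + k *: g1.2)) - y' = (h * (1 + k)) *: nu'.
  rewrite nu'E scalerA mulfK//.
  by apply/rowP => i; rewrite !mxE /h; field; exact: L_neq0.
by rewrite dotvZl pmulr_rle0// mulr_gt0//; have /andP[] := k_bounds; lra.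
Qed.

(* The momentum follows an implicit damped step of length [1 / 192]. *)
Let v'_v : v' - v = (1 / 192) *: ((1 / 2 - th) *: (b' + e2.2) - th *: v').
Proof.
have -> : b' + e2.2 = g2.2 - nu' by rewrite /b' /e2 /= addrC addrA subrK.
by rewrite v'E; apply/rowP => i; rewrite !mxE /al /k; field; rewrite gt_eqF//; have := th_gt0; lra.
Qed.

(* Both points are projections, of points that differ by [h (ra + e0.1)] in [x]
   and by [h (rw + e0.2)] in [y]. *)
Let ut_u' : L ^+ 2 * dotp (ut - u') (ut - u') <= 2 / (192 * 192) * (D + dotp e0 e0).
Proof.
have hL : L ^+ 2 * (h ^+ 2 * 2) = 2 / (192 * 192) by rewrite /h; field.
rewrite -hL -[leRHS]mulrA; apply: ler_wpM2l; first exact: sqr_ge0.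
have hx : dotv (xt - x') (xt - x') <= h ^+ 2 * dotv (ra + e0.1) (ra + e0.1).
  have <- : eproj X (x - h *: ta) = x'.
    rewrite -x'_x addrC subrK.
    by apply: eproj_id; [exact: sp_X0 H|exact: sp_Xcl H|exact: sp_Xcv H|case: u'XY].
  rewrite xtE; apply: le_trans (eproj_nonexp (sp_X0 H) (sp_Xcl H) (sp_Xcv H) _ _) _.
  rewrite (_ : _ - _ = - h *: (ra + e0.1)).
    by rewrite dotvZl dotvZr mulrA mulrNN.
  by apply/rowP => i; rewrite /ra /e0 /a !mxE; ring.
have hy : dotv (yt - y') (yt - y') <= h ^+ 2 * dotv (rw + e0.2) (rw + e0.2).
  have <- : eproj Y (y + h *: tw) = y'.
    rewrite -y'_y addrC subrK.
    by apply: eproj_id; [exact: sp_Y0 H|exact: sp_Ycl H|exact: sp_Ycv H|case: u'XY].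
  rewrite ytE; apply: le_trans (eproj_nonexp (sp_Y0 H) (sp_Ycl H) (sp_Ycv H) _ _) _.
  rewrite (_ : _ - _ = h *: (rw + e0.2)).
    by rewrite dotvZl dotvZr mulrA.
  by apply/rowP => i; rewrite /rw /w /b /e0 !mxE; ring.
have := sq_sum2 ra e0.1; have := sq_sum2 rw e0.2.
move=> /(ler_wpM2l (sqr_ge0 h)) h1 /(ler_wpM2l (sqr_ge0 h)) h2.
rewrite /dotp /D /=; lra.
Qed.

Let deE : de = (1 + k) *: ((G u').2 - (G ut).2) + (- (1 + k)) *: e1.2 + k *: e2.2.
Proof.
have wE : w' = (G u').2 - nu' + (al *: v + k *: (g2.2 - nu')) by rewrite /w' v'E.
by rewrite /de wE; apply/rowP => i; rewrite /tw /e1 /e2 !mxE; ring.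
Qed.

(* The new point deviates from the followed direction by the Lipschitz constant
   times the distance of the two last query points, which is small as [h L] is,
   and by the errors. *)
Let S_le : S <= D / 1000 + 4 * E.
Proof.
have ax : a' - ta = ((G u').1 - (G ut).1) + (2 * L) *: (x' - xt) + (- 1) *: e1.1.
  by apply/rowP => i; rewrite /a' /ta /e1 !mxE; ring.
have /andP[k0 k1] := k_bounds.
have lip := sp_lip H u'XY utXY; have U := ut_u'.
have hx := sq_sum3 ((G u').1 - (G ut).1) ((2 * L) *: (x' - xt)) ((-1) *: e1.1).
rewrite -ax !dotvZl !dotvZr in hx.
have hy := sq_sum3 ((1 + k) *: ((G u').2 - (G ut).2)) ((- (1 + k)) *: e1.2) (k *: e2.2).
rewrite -deE !dotvZl !dotvZr in hy.
move: lip U hx hy; rewrite /S /E /dotp /=.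
rewrite (dotvBB xt) (dotvBB yt).
move: (dotv_ge0 ((G u').1 - (G ut).1)) (dotv_ge0 ((G u').2 - (G ut).2))
  (dotv_ge0 (x' - xt)) (dotv_ge0 (y' - yt)) (dotv_ge0 e0.1) (dotv_ge0 e0.2)
  (dotv_ge0 e1.1) (dotv_ge0 e1.2) (dotv_ge0 e2.1) (dotv_ge0 e2.2).
move: (dotv _ _) (dotv _ _) (dotv (x' - xt) _) (dotv (y' - yt) _) (dotv e0.1 _)
  (dotv e0.2 _) (dotv e1.1 _) (dotv e1.2 _) (dotv e2.1 _) (dotv e2.2 _).
move=> gx gy dx dy e0x e0y e1x e1y e2x e2y gx0 gy0 dx0 dy0 e0x0 e0y0 e1x0 e1y0 e2x0 e2y0.
move=> lip U hx hy.
have kk : (1 + k) * (1 + k) <= 11 / 10 by nra.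
have kk' : k * k <= 1 / 10 by nra.
have h1 := ler_wpM2r gy0 kk; have h2 := ler_wpM2r e1y0 kk.
have h3 := ler_wpM2r e2y0 kk'.
have D0 : 0 <= D by rewrite addr_ge0 ?dotv_ge0.
have ly := mulr_ge0 (sqr_ge0 L) dy0.
lra.
Qed.

(* Monotonicity of the normal cones and of the regularized gradient. *)
Let monotone_step : dotv (a' - a) ta + dotv (b' - b) tw <= - (1 / 192 * dotv ta ta).
Proof.
have sm := strong_monotone H uXY u'XY; rewrite /= in sm.
have n1 := Hxi.2 _ u'XY.1; have n2 := step_normal_x.2 _ uXY.1.
have n3 := Hnu.2 _ u'XY.2; have n4 := step_normal_y.2 _ uXY.2.
rewrite /= in n1 n2 n3 n4; rewrite -(opprB x') dotvNr in n2.
rewrite -(opprB y') dotvNr in n4.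
have m0 : 0 <= mu * dotv (y' - y) (y' - y).
  by rewrite mulr_ge0 ?dotv_ge0// ltW// (sp_mu_gt0 H).
have E1 : dotv (a' - a) (x' - x) = dotv ((G u').1 - (G u).1) (x' - x)
    + 2 * L * dotv (x' - x) (x' - x) + (dotv xi' (x' - x) - dotv xi (x' - x)).
  rewrite -dotvZl -dotvNl -!dotvDl; congr dotv.
  by apply/rowP => i; rewrite /a' /a !mxE; ring.
have E2 : dotv (b' - b) (y' - y) = dotv ((G u').2 - (G u).2) (y' - y)
    - (dotv nu' (y' - y) - dotv nu (y' - y)).
  rewrite -[in RHS]dotvNl -dotvDl -dotvNl -!dotvDl; congr dotv.
  by apply/rowP => i; rewrite /b' /b !mxE; ring.
have : L * dotv (x' - x) (x' - x) <= dotv (a' - a) (x' - x) - dotv (b' - b) (y' - y).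
  by rewrite E1 E2; lra.
rewrite x'_x y'_y !(dotvNr, dotvNl, dotvZr, dotvZl) opprK.
have -> : L * (h * (h * dotv ta ta)) = h * (1 / 192 * dotv ta ta).
  by rewrite /h; field.
by move=> hh; rewrite -(ler_pM2l h_gt0); lra.
Qed.

(* Convexity in [x] and concavity in [y] of the saddle function. *)
Let value_step : L * (saddle_value F L z u - saddle_value F L z u')
  <= 1 / 192 * (dotv a ta - dotv b' tw).
Proof.
have wc := sp_weak_convex H uXY.1 u'XY.1 uXY.2.
have sc := sp_strong_concave H u'XY.1 u'XY.2 uXY.2; rewrite /= -/u -/u' in wc sc.
have n1 := Hxi.2 _ u'XY.1; have n4 := step_normal_y.2 _ uXY.2; rewrite /= in n1 n4.
have m0 : 0 <= mu / 2 * dotv (y - y') (y - y').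
  by rewrite mulr_ge0 ?dotv_ge0// divr_ge0// ltW// (sp_mu_gt0 H).
have m1 : 0 <= L / 2 * dotv (x' - x) (x' - x).
  by rewrite mulr_ge0 ?dotv_ge0// divr_ge0// ltW// L0.
have E0 : dotv (x' - z) (x' - z) = dotv (x - z) (x - z) + 2 * dotv (x - z) (x' - x)
    + dotv (x' - x) (x' - x).
  have -> : x' - z = (x - z) + 1 *: (x' - x).
    by rewrite scale1r [RHS]addrC addrA subrK.
  by rewrite dotv_sqD scale1r; ring.
have E1 : dotv (G u).1 (x' - x) =
    dotv a (x' - x) - 2 * L * dotv (x - z) (x' - x) - dotv xi (x' - x).
  by rewrite -dotvZl -!dotvNl -!dotvDl; congr dotv;
    apply/rowP => i; rewrite /a !mxE; ring.
have E2 : dotv (G u').2 (y - y') = dotv b' (y - y') + dotv nu' (y - y').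
  by rewrite -dotvDl subrK.
have : saddle_value F L z u - saddle_value F L z u' <=
    - dotv a (x' - x) - dotv b' (y' - y).
  have E3 : dotv b' (y' - y) = - dotv b' (y - y') by rewrite -dotvNr opprB.
  rewrite /saddle_value /= E0 E3; lra.
move=> /(ler_wpM2l (ltW L0)) /le_trans; apply.
rewrite x'_x y'_y !(dotvNr, dotvZr) opprK -mulrBr mulrA.
by rewrite (_ : L * h = 1 / 192)// /h; field.
Qed.

Let yy := y' - s.2.
Let q := (th * L) *: yy.
Let m := v + (th * L) *: (y - s.2).
Let m' := v' + q.
Let Xs := L ^+ 2 * dotv (x' - s.1) (x' - s.1).

Let gap_le : saddle_value F L z u' - saddle_value F L z s <= dotv a' a' / (2 * L).
Proof. exact: saddle_gap H Hs u'XY step_normal_x. Qed.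

(* By strong concavity at the new point, the product of [b'] with [y' - s.2] is
   at most the gap above the saddle value, which [a'] controls. *)
Let momentum_gap : dotv b' q <=
  th * (dotv a' a' / 2 - Xs / 2 - 64 * dotv q q).
Proof.
have [[Xs1 Ys2] _ _] := Hs.
have sc := sp_strong_concave H u'XY.1 u'XY.2 Ys2; rewrite /= -/u' in sc.
have sm := saddle_min H Hs u'XY.1; rewrite /= in sm.
have n1 := step_normal_y.2 _ Ys2.
have E2 : dotv (G u').2 (s.2 - y') = dotv b' (s.2 - y') + dotv nu' (s.2 - y').
  by rewrite -dotvDl subrK.
have E3 : dotv b' yy = - dotv b' (s.2 - y') by rewrite -dotvNr opprB.
rewrite (dotvBB s.2) -/yy in sc.
have g := gap_le.
have h1 : dotv b' yy <= dotv a' a' / (2 * L) - L / 2 * dotv (x' - s.1) (x' - s.1)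
    - mu / 2 * dotv yy yy.
  move: sm g; rewrite /saddle_value /=; lra.
have tL : 0 < th * L by rewrite mulr_gt0// L0.
have {h1}/le_trans := ler_wpM2l (ltW tL) h1.
have -> : th * L * dotv b' yy = dotv b' q by rewrite /q dotvZr.
apply; rewrite /q dotvZl dotvZr /Xs -thE le_eqVlt; apply/orP; left; apply/eqP.
field; exact: L_neq0.
Qed.

(* The whole step, measured with the old center [z] and saddle point [s]. *)
Let fixed_center :
  192 * (1 / 2 * (dotv a' a' + dotv w' w')
  + (3 / 4 - 2 * th) * L * (saddle_value F L z s - saddle_value F L z u')
  + 1 / 4 * dotv m' m' + L * saddle_value F L z s
  - potential z xi nu v u s)
  <= - (dotv ta ta / 10) - dotv b' b' / 20 - th / 2 * dotv v' v'
     - 10 * th * dotv q q - th / 8 * Xs - 80 * D + 60 * E / th.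
Proof.
have nX : 0 <= Xs by rewrite mulr_ge0 ?sqr_ge0 ?dotv_ge0.
have raD : dotv ra ra <= D by rewrite lerDl dotv_ge0.
have deS : dotv de de <= S by rewrite lerDr dotv_ge0.
have eE : dotv e2.2 e2.2 <= E.
  have := dotv_ge0 e2.1; have := dotp_ge0 e0; have := dotp_ge0 e1.
  rewrite /E /dotp; lra.
have aS : dotv a' a' <= 2 * dotv ta ta + 2 * S.
  have := sq_sum2 ta (a' - ta); rewrite addrC subrK.
  have := dotv_ge0 de; rewrite /S; lra.
have := energy_decrease b' v' q th_gt0 th_le raD deS S_le eE aS nX.
apply: le_trans.
have twE : tw = b' + v' - de by rewrite /de /w' opprB addrC subrK.
have Ea : dotv a' a' = dotv a a + 2 * dotv (a' - a) ta
    + dotv (a' - ta) (a' - ta) - dotv ra ra.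
  rewrite /ra; move: (a) (a') (ta) => a0 a1 t0; rewrite !dotvE.
  by rewrite (dotvC t0 a0) (dotvC t0 a1); ring.
have Ew : dotv w' w' = dotv w w + 2 * (dotv (b' - b) tw + dotv (v' - v) tw)
    + dotv de de - dotv rw rw.
  have -> : dotv (b' - b) tw + dotv (v' - v) tw = dotv (w' - w) tw.
    by rewrite -dotvDl addrACA -opprD.
  rewrite /rw /de; move: (w) (w') (tw) => a0 a1 t0; rewrite !dotvE.
  by rewrite (dotvC t0 a0) (dotvC t0 a1); ring.
have mm : m' - m = (1 / 192) *: (1 / 2 *: b' + ((1 / 2 - th) *: e2.2 - th *: de)).
  have -> : m' - m = (v' - v) + (th * L) *: (y' - y).
    by rewrite /m' /m /q /yy; apply/rowP => i; rewrite !mxE; ring.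
  rewrite v'_v y'_y twE; apply/rowP => i; rewrite !mxE /h; field; exact: L_neq0.
have Em : dotv m' m' <= dotv m m + 2 * dotv m' (m' - m).
  move: (m) (m') => m0 m1; have := dotv_ge0 (m1 - m0).
  by rewrite !dotvE (dotvC m0 m1); lra.
have Em3 : dotv m' (m' - m) = 1 / 192 * (1 / 2 * dotv m' b'
    + dotv m' ((1 / 2 - th) *: e2.2 - th *: de)).
  by rewrite mm; move: (m') => m1; rewrite dotvZr dotvDr dotvZr.
rewrite Em3 in Em.
have mono := monotone_step; have vs := value_step; have mg := momentum_gap.
have thc : 0 <= 3 / 4 - 2 * th by have := th_le; lra.
have {}vs := ler_wpM2l thc vs.
have Eaa : dotv a ta = dotv ta ta + dotv ra ta by rewrite -dotvDl addrC subrK.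
rewrite v'_v dotvZl in Ew; rewrite Eaa twE in vs; rewrite twE in mono Ew.
have Em2 : dotv m' b' = dotv v' b' + dotv b' q by rewrite dotvDl (dotvC q).
have -> : potential z xi nu v u s = 1 / 2 * (dotv a a + dotv w w)
  + (3 / 4 - 2 * th) * L * (saddle_value F L z s - saddle_value F L z u)
  + 1 / 4 * dotv m m + L * saddle_value F L z s by [].
rewrite Em2 in Em.
rewrite /S /D -/m'.
lra.
Qed.

Let d := x' - z.
Let dv := L *: d.
Let Ga := (th * L) *: (s'.2 - s.2).

Let beta_gt0 : 0 < beta. Proof. by rewrite divr_gt0// mulr_gt0. Qed.

Let Ga_le : dotv Ga Ga <= beta ^+ 2 * dotv dv dv / 128.
Proof.
have st := saddle_stable H Hs Hs'.
have zz : z' - z = beta *: d by rewrite z'E addrC addKr.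
rewrite zz dotvZl dotvZr -thE in st; have {}st := ler_wpM2l (ltW L0) st.
rewrite /Ga /dv !(dotvZl, dotvZr).
have -> : th * L * (th * L * dotv (s'.2 - s.2) (s'.2 - s.2)) =
  L * (128 * th ^+ 2 * L * dotv (s'.2 - s.2) (s'.2 - s.2)) / 128 by field.
have -> : beta ^+ 2 * (L * (L * dotv d d)) / 128 =
  L * (L * (beta * (beta * dotv d d))) / 128 by field.
by rewrite ler_wpM2r.
Qed.

(* The change of center from [z] to [z']: [a] changes by [2 beta dv], the saddle
   value is bounded by [saddle_value_le], and the momentum correction by the
   displacement [Ga] of the dual component of the saddle point. *)
Let center_step :
  potential z' xi' nu' v' u' s' <=
  1 / 2 * (dotv a' a' + dotv w' w')
  + (3 / 4 - 2 * th) * L * (saddle_value F L z s - saddle_value F L z u')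
  + 1 / 4 * dotv m' m' + L * saddle_value F L z s
  + beta * (- 2 * dotv a' dv + 2 * beta * dotv dv dv - (2 - beta) * dotv dv dv
            + (7 / 2 - 4 * th) * dotv (L *: (x' - s.1)) dv)
  - 1 / 2 * dotv m' Ga + 1 / 4 * dotv Ga Ga.
Proof.
have xz' : x' - z' = (1 - beta) *: d.
  by rewrite z'E; apply/rowP => i; rewrite /d !mxE; ring.
have sz' : s.1 - z' = (1 - beta) *: d + (- 1) *: (x' - s.1).
  by rewrite z'E; apply/rowP => i; rewrite /d !mxE; ring.
have sz : s.1 - z = d + (- 1) *: (x' - s.1).
  by apply/rowP => i; rewrite /d !mxE; ring.
have -> : potential z' xi' nu' v' u' s' =
    1 / 2 * (dotv (a' + (- (2 * beta)) *: dv) (a' + (- (2 * beta)) *: dv) + dotv w' w')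
    + (3 / 4 - 2 * th) * L * (saddle_value F L z' s' - saddle_value F L z' u')
    + 1 / 4 * dotv (m' + (-1) *: Ga) (m' + (-1) *: Ga) + L * saddle_value F L z' s'.
  rewrite /potential /=.
  have -> : (G u').1 + (2 * L) *: (x' - z') + xi' = a' + (- (2 * beta)) *: dv.
    by rewrite xz'; apply/rowP => i; rewrite /a' /dv /d !mxE; ring.
  have -> // : v' + (th * L) *: (y' - s'.2) = m' + (-1) *: Ga.
  by apply/rowP => i; rewrite /m' /q /yy /Ga !mxE; ring.
have := saddle_value_le H Hs Hs'; rewrite sz'.
have thc : 0 <= (7 / 4 - 2 * th) * L.
  by rewrite mulr_ge0 ?(ltW L0)//; have := th_le; lra.
move=> /(ler_wpM2l thc).
have -> : saddle_value F L z' u' = saddle_value F L z u' + L * ((1 - beta) ^+ 2 - 1) * dotv d d.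
  by rewrite /saddle_value /= xz' dotvZl dotvZr -/d; ring.
have -> : saddle_value F L z s = F s + L * (dotv d d - 2 * dotv d (x' - s.1)
    + dotv (x' - s.1) (x' - s.1)).
  by rewrite /saddle_value sz dotv_sqD dotvZr; ring.
move: (saddle_value F L z' s') (saddle_value F L z u') => A1 A2.
rewrite !dotv_sqD /dv !(dotvZl, dotvZr) (dotvC (x' - s.1) d).
move: (dotv a' d) (dotv d d) (dotv d (x' - s.1)) (dotv (x' - s.1) (x' - s.1)) (dotv a' a')
  (dotv w' w') (dotv m' m') (dotv m' Ga) (dotv Ga Ga) (F s) => *; lra.
Qed.

Let path_le1 : L ^+ 2 * dotp (ut - u) (ut - u) <=
  1 / (192 * 192) * (3 * dotv ta ta + 9 * (dotv b' b' + dotv v' v' + S) + 3 * D + 3 * E).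
Proof.
have hL : L ^+ 2 * h ^+ 2 = 1 / (192 * 192) by rewrite /h; field.
rewrite -hL -[leRHS]mulrA; apply: ler_wpM2l; first exact: sqr_ge0.
have hx : dotv (xt - x) (xt - x) <= h ^+ 2 * dotv (ta + ra + e0.1) (ta + ra + e0.1).
  have <- : eproj X x = x.
    by apply: eproj_id; [exact: sp_X0 H|exact: sp_Xcl H|exact: sp_Xcv H|case: uXY].
  rewrite xtE; apply: le_trans (eproj_nonexp (sp_X0 H) (sp_Xcl H) (sp_Xcv H) _ _) _.
  rewrite (_ : _ - _ = - h *: (ta + ra + e0.1)).
    by rewrite dotvZl dotvZr mulrA mulrNN.
  by apply/rowP => i; rewrite /ra /e0 /a !mxE; ring.
have hy : dotv (yt - y) (yt - y) <= h ^+ 2 * dotv (tw + rw + e0.2) (tw + rw + e0.2).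
  have <- : eproj Y y = y.
    by apply: eproj_id; [exact: sp_Y0 H|exact: sp_Ycl H|exact: sp_Ycv H|case: uXY].
  rewrite ytE; apply: le_trans (eproj_nonexp (sp_Y0 H) (sp_Ycl H) (sp_Ycv H) _ _) _.
  rewrite (_ : _ - _ = h *: (tw + rw + e0.2)).
    by rewrite dotvZl dotvZr mulrA.
  by apply/rowP => i; rewrite /rw /w /b /e0 !mxE; ring.
have sx := sq_sum3 ta ra e0.1; have sy := sq_sum3 tw rw e0.2.
have sw := sq_sum3 b' v' (- de).
have twE : tw = b' + v' - de by rewrite /de /w' opprB addrC subrK.
rewrite -twE dotvNl dotvNr opprK in sw.
have : dotv (ta + ra + e0.1) (ta + ra + e0.1) + dotv (tw + rw + e0.2) (tw + rw + e0.2) <=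
    3 * dotv ta ta + 9 * (dotv b' b' + dotv v' v' + S) + 3 * D + 3 * E.
  have := dotv_ge0 (a' - ta); have := dotp_ge0 e1; have := dotp_ge0 e2.
  rewrite /S /E /D [dotp e0 e0]/dotp; lra.
move/(ler_wpM2l (sqr_ge0 h)); rewrite /dotp /=; lra.
Qed.

(** One step of the algorithm decreases the potential by a fraction of a bound
    of the squared residual and of the squared moves of the query points, up
    to the errors of the three estimates. *)
Lemma potential_step :
  potential z' xi' nu' v' u' s'
  + beta / 16 * (2 * dotv a' a' + 8 * L ^+ 2 * dotv d d + dotv b' b')
  + beta * L ^+ 2 * (dotp (ut - u) (ut - u) + dotp (u' - ut) (u' - ut))
  <= potential z xi nu v u s + beta^-1 * E.
Proof.
have b0 := beta_gt0; have b0' := ltW b0.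
have fc := fixed_center; have cs := center_step; have pl := path_le1; have gl := Ga_le.
have ul := ut_u'.
have c1 : dotv a' a' <= 2 * dotv ta ta + 2 * S.
  have := sq_sum2 ta (a' - ta); rewrite addrC subrK.
  have := dotv_ge0 de; rewrite /S; lra.
have c2 := youngN a' dv (ltr0Sn R 3).
have Xv : dotv (L *: (x' - s.1)) (L *: (x' - s.1)) = Xs.
  by rewrite dotvZl dotvZr mulrA -expr2.
have c3 : (7 / 4 - 2 * th) * dotv (L *: (x' - s.1)) dv <=
    7 / 4 * (2 * Xs + dotv dv dv / 8).
  have := young (L *: (x' - s.1)) dv (ltr0Sn R 3); rewrite Xv => yg.
  have nX : 0 <= Xs by rewrite mulr_ge0 ?sqr_ge0 ?dotv_ge0.
  have nd := dotv_ge0 dv; have t0 := th_gt0; have t1 := th_le.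
  by apply: le_scale; lra.
have c4 : - (2 * dotv m' Ga) <= 16 * beta * dotv m' m' + beta * dotv dv dv / (16 * 128).
  have b16 : 0 < 16 * beta by rewrite mulr_gt0.
  apply: le_trans (youngN m' Ga b16) _; rewrite lerD2l ler_pdivrMl//; apply: le_trans gl _; rewrite le_eqVlt; apply/orP; left; apply/eqP.
  by field.
have c5 := sq_sum2 v' q; rewrite -/m' in c5.
have dvE : dotv dv dv = L ^+ 2 * dotv d d by rewrite dotvZl dotvZr mulrA -expr2.
rewrite -[8 * L ^+ 2 * _]mulrA -dvE -[beta * L ^+ 2 * _]mulrA.
rewrite -[dotp (u' - ut) _]/(dotv (x' - xt) (x' - xt) + dotv (y' - yt) (y' - yt)).
have -> : dotv (x' - xt) (x' - xt) + dotv (y' - yt) (y' - yt) = dotp (ut - u') (ut - u').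
  by rewrite /dotp /= (dotvBB xt) (dotvBB yt).
have e0E : dotp e0 e0 <= E.
  have := dotp_ge0 e1; have := dotp_ge0 e2; rewrite /E; lra.
have nE : 0 <= E := le_trans (dotp_ge0 _) e0E.
have nS : 0 <= S by rewrite addr_ge0 ?dotv_ge0.
have nD : 0 <= D by rewrite addr_ge0 ?dotv_ge0.
have nX : 0 <= Xs by rewrite mulr_ge0 ?sqr_ge0 ?dotv_ge0.
have nA := dotv_ge0 ta; have nB := dotv_ge0 b'; have nV := dotv_ge0 v'.
have nQ := dotv_ge0 q; have nd := dotv_ge0 dv.
have SD := S_le.
have b1 : beta <= 1 / (11 * 192 * 256).
  rewrite /beta ler_pdivrMr//; apply: le_trans th_le _; lra.
have bE : beta^-1 * E = 192 * 256 * (E / th).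
  by rewrite /beta; field; rewrite gt_eqF.
have thE1 : 11 * E <= E / th.
  rewrite ler_pdivlMr//; have := ler_wpM2r nE th_le; lra.
have thb : th = 192 * 256 * beta by rewrite /beta; field.
have E60 : 60 * E / th = 60 * (E / th) by rewrite mulrA.
rewrite E60 in fc; rewrite bE.
have := @step_arith R th beta _ _ _ _ _ _ _ _ _ _ _ _ _ _ _ _ _ _ _ _ _ _
  fc cs pl ul gl c1 c2 c3 c4 c5 e0E SD nA nB nV nQ nX nD nS nE nd b0 b1 thE1 thb.
by rewrite (mulrDr (L ^+ 2) (dotp (ut - u) (ut - u))).
Qed.

End Step.

(** * Descent along a run, for every outcome of the samples *)

(** The only negative term is the gap, which [saddle_gap] bounds by the square
    of the primal residual that the potential contains. *)
Lemma potential_ge {R : realType} {n p : nat} (X : set 'rV[R]_n) (Y : set 'rV[R]_p)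
    (F : 'rV[R]_n * 'rV[R]_p -> R) G (L mu th : R) z s x y xi nu v :
  saddle_problem X Y F G L mu -> 0 < th -> 128 * th ^+ 2 * L = mu ->
  regularized_saddle X Y G L z s -> normal_cone X x xi -> Y y ->
  L * saddle_value F L z s <= potential F G L th z xi nu v (x, y) s.
Proof.
move=> H th0 thE Hs nx Yy; have L0 := sp_L_gt0 H.
have xyXY : (X `*` Y) (x, y) by split => //; case: nx.
have gap := saddle_gap H Hs xyXY nx.
rewrite /potential /=; move: gap => /=; set a := _ + _ *: _ + xi; set w := _ - nu + v.
set m := v + _; move=> gap.
have th1 := th_le H th0 thE.
have c0 : 0 <= (3 / 4 - 2 * th) * L by rewrite mulr_ge0 ?(ltW L0)//; lra.
have {gap} := ler_wpM2l c0 gap.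
have -> : (3 / 4 - 2 * th) * L * (dotv a a / (2 * L)) = (3 / 8 - th) * dotv a a.
  by field; rewrite gt_eqF.
have := dotv_ge0 a; have := dotv_ge0 w; have := dotv_ge0 m.
have := mulr_ge0 (ltW th0) (dotv_ge0 a).
move: (dotv a a) (dotv w w) (dotv m m) => a2 w2 m2; lra.
Qed.

Section Run.
Context {R : realType} {n p : nat} {W : Type}.
Local Notation V := ('rV[R]_n * 'rV[R]_p)%type.
Context (X : set 'rV[R]_n) (Y : set 'rV[R]_p) (Gs : V -> W -> V).
Context (L h al k beta : R) (q Br b : nat) (x0 : 'rV[R]_n) (y0 : 'rV[R]_p).

Definition run (om : nat -> nat -> W) (t : nat) : state :=
  vr_spde X Y Gs L h al k beta q Br b om x0 y0 t.

Definition run_xy om t : V := (st_x (run om t), st_y (run om t)).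

Definition run_est0 om t : V := vr_estimate Gs q Br b om (3 * t)
  (run_xy om t) (st_query (run om t)) (st_est (run om t)).

Definition run_half om t : V :=
  (eproj X (st_x (run om t) - h *: ((run_est0 om t).1
     + (2 * L) *: (st_x (run om t) - st_z (run om t)) + st_xi (run om t))),
   eproj Y (st_y (run om t) + h *: ((run_est0 om t).2
     - st_n (run om t) + st_v (run om t)))).

Definition run_est1 om t : V := vr_estimate Gs q Br b om (3 * t + 1)
  (run_half om t) (run_xy om t) (run_est0 om t).

Lemma run_S om t : run om t.+1 =
  let s := run om t in
  let g1 := run_est1 om t in
  let vbar := al *: st_v s + k *: g1.2 in
  let x' := eproj X (st_x s - h *: (g1.1 + (2 * L) *: ((run_half om t).1 - st_z s))) in
  let y' := eproj Y (st_y s + h *: (g1.2 + vbar)) in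
  let nu' := (1 + k)^-1 *: (h^-1 *: (st_y s - y') + g1.2 + vbar) in
  let g2 := vr_estimate Gs q Br b om (3 * t + 2) (x', y') (run_half om t) g1 in
  {| st_x := x'; st_y := y'; st_z := st_z s + beta *: (x' - st_z s);
     st_xi := h^-1 *: (st_x s - x') - g1.1 - (2 * L) *: ((run_half om t).1 - st_z s);
     st_n := nu'; st_v := al *: st_v s + k *: (g2.2 - nu');
     st_query := (x', y'); st_est := g2 |}.
Proof. by []. Qed.

(** The three requests of every step are put in one sequence, to which the
    recursion of the estimator applies uniformly. *)
Definition query om j : V :=
  match (j %% 3)%N with
  | 0 => run_xy om (j %/ 3)
  | 1 => run_half om (j %/ 3)
  | _ => run_xy om (j %/ 3).+1
  end.

Definition estimate om j : V :=
  match (j %% 3)%N with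
  | 0 => run_est0 om (j %/ 3)
  | 1 => run_est1 om (j %/ 3)
  | _ => st_est (run om (j %/ 3).+1)
  end.

Lemma divmod3 (t r : nat) : (r < 3)%N ->
  ((3 * t + r) %/ 3)%N = t /\ ((3 * t + r) %% 3)%N = r.
Proof. by move=> r3; rewrite mulnC divnMDl// modnMDl (divn_small r3) addn0 modn_small. Qed.

Lemma query0 om t : query om (3 * t) = run_xy om t.
Proof. by have := @divmod3 t 0 isT; rewrite addn0 /query => -[-> ->]. Qed.

Lemma query1 om t : query om (3 * t + 1) = run_half om t.
Proof. by have [E1 E2] := @divmod3 t 1 isT; rewrite /query E1 E2. Qed.

Lemma query2 om t : query om (3 * t + 2) = run_xy om t.+1.
Proof. by have [E1 E2] := @divmod3 t 2 isT; rewrite /query E1 E2. Qed.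

Lemma estimate0 om t : estimate om (3 * t) = run_est0 om t.
Proof. by have := @divmod3 t 0 isT; rewrite addn0 /estimate => -[-> ->]. Qed.

Lemma estimate1 om t : estimate om (3 * t + 1) = run_est1 om t.
Proof. by have [E1 E2] := @divmod3 t 1 isT; rewrite /estimate E1 E2. Qed.

Lemma estimate2 om t : estimate om (3 * t + 2) = st_est (run om t.+1).
Proof. by have [E1 E2] := @divmod3 t 2 isT; rewrite /estimate E1 E2. Qed.

(** Request 0 is a refresh, which does not look at its predecessor; this is why
    the recursion can be written with [j.-1] for every [j]. *)
Lemma estimateE om j : estimate om j =
  vr_estimate Gs q Br b om j (query om j) (query om j.-1) (estimate om j.-1).
Proof.
rewrite (divn_eq j 3) mulnC; move: (j %/ 3)%N (ltn_pmod j (isT : 0 < 3)%N) => t.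
case: (j %% 3)%N => [|[|[|//]]] _.
- rewrite addn0 estimate0 query0 /run_est0; case: t => [|t].
    by rewrite muln0 /vr_estimate dvdn0.
  have -> : (3 * t.+1).-1 = (3 * t + 2)%N by rewrite mulnS addnC addn3 addn2.
  by rewrite estimate2 query2.
- have -> : (3 * t + 1).-1 = (3 * t)%N by rewrite addn1.
  by rewrite estimate1 query1 query0 estimate0.
- have -> : (3 * t + 2).-1 = (3 * t + 1)%N by rewrite addn2 addn1.
  by rewrite estimate2 query2 query1 estimate1.
Qed.

End Run.

(** Three requests are made per step, and the first one repeats the query point
    of the last one of the previous step, so that its move vanishes. *)
Lemma telescope_requests {R : realType} (pot rb mv er : nat -> R) (c1 c2 c3 : R) T :
  (forall t, pot t.+1 + c1 * rb t + c2 * (mv (3 * t + 1)%N + mv (3 * t + 2)%N)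
     <= pot t + c3 * (er (3 * t)%N + er (3 * t + 1)%N + er (3 * t + 2)%N)) ->
  (forall t, mv (3 * t)%N = 0) ->
  pot T + \sum_(0 <= t < T) c1 * rb t + c2 * \sum_(0 <= j < 3 * T) mv j
  <= pot 0 + c3 * \sum_(0 <= j < 3 * T) er j.
Proof.
move=> step mv0; elim: T => [|T IH]; first by rewrite !muln0 !big_geq// !mulr0 !addr0.
have E3 (f : nat -> R) : \sum_(0 <= j < 3 * T.+1) f j = \sum_(0 <= j < 3 * T) f j
    + (f (3 * T)%N + f (3 * T + 1)%N + f (3 * T + 2)%N).
  by rewrite mulnS addnC addn3 !big_nat_recr//= !addrA addn1 addn2.
rewrite !E3 big_nat_recr//= mv0; have := step T; move: IH; lra.
Qed.

Section Descent.
Context {R : realType} {n p : nat} {W : Type}.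
Local Notation V := ('rV[R]_n * 'rV[R]_p)%type.
Context (X : set 'rV[R]_n) (Y : set 'rV[R]_p) (F : V -> R) (G : V -> V).
Context (L mu th : R) (Gs : V -> W -> V) (q Br b : nat) (x0 : 'rV[R]_n) (y0 : 'rV[R]_p).
Hypothesis H : saddle_problem X Y F G L mu.
Hypotheses (th_gt0 : 0 < th) (thE : 128 * th ^+ 2 * L = mu).
Hypotheses (Xx0 : X x0) (Yy0 : Y y0).

Let h := (192 * L)^-1.
Let al := (1 + th / 192)^-1.
Let k := (1 / 2 - th) / 192 / (1 + th / 192).
Let beta := th / (192 * 256).
Local Notation rS om t := (run X Y Gs L h al k beta q Br b x0 y0 om t).
Local Notation rXY om t := (run_xy X Y Gs L h al k beta q Br b x0 y0 om t).
Local Notation rH om t := (run_half X Y Gs L h al k beta q Br b x0 y0 om t).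
Local Notation rE1 om t := (run_est1 X Y Gs L h al k beta q Br b x0 y0 om t).
Local Notation rQ om j := (query X Y Gs L h al k beta q Br b x0 y0 om j).
Local Notation rE om j := (estimate X Y Gs L h al k beta q Br b x0 y0 om j).

(** A normal vector is what the projection of the last step leaves over;
    initially it is zero. *)
Lemma run_normal om t : normal_cone X (st_x (rS om t)) (st_xi (rS om t)) /\
  normal_cone Y (st_y (rS om t)) (st_n (rS om t)).
Proof.
elim: t => [|t [nx ny]]; first by split; split => //= c _; rewrite dotv0l.
split.
  exact: (@step_normal_x _ _ _ X Y F G L mu th H (st_x (rS om t)) (st_z (rS om t))
    (rH om t).1 _ _ (st_y (rS om t)) (st_v (rS om t)) (st_y (rS om t.+1))
    (rE1 om t)).
exact: (@step_normal_y _ _ _ X Y F G L mu th H th_gt0 thE (st_x (rS om t))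
  (st_z (rS om t)) (rH om t).1 (st_x (rS om t.+1)) (st_y (rS om t))
  (st_v (rS om t)) _ _ (rE1 om t)).
Qed.

Lemma query_in om j : (X `*` Y) (rQ om j).
Proof.
have rXY t : (X `*` Y) (rXY om t).
  by have [[? _] [? _]] := run_normal om t; split.
rewrite /query; case: (j %% 3)%N => [|[|_]] //.
split; apply: eproj_in; [exact: sp_X0 H|exact: sp_Xcl H|exact: sp_Y0 H|exact: sp_Ycl H].
Qed.

(** The point at which the stationarity of the output is certified: the
    normal vectors of step [t] against the exact gradient at the new iterate,
    with the proximal center of the beginning of the step. *)
Definition residual_bound om t : R :=
  let s := rS om t in let s' := rS om t.+1 in
  let a := (G (rXY om t.+1)).1 + (2 * L) *: (st_x s' - st_z s) + st_xi s' in
  let b := (G (rXY om t.+1)).2 - st_n s' in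
  2 * dotv a a + 8 * L ^+ 2 * dotv (st_x s' - st_z s) (st_x s' - st_z s) + dotv b b.

Definition request_error om j : R :=
  dotp (rE om j - G (rQ om j)) (rE om j - G (rQ om j)).

Definition request_move om j : R :=
  dotp (rQ om j - rQ om j.-1) (rQ om j - rQ om j.-1).

(** A choice of saddle points makes the potential a function of the state. *)
Definition saddle_of z : V := xget 0 (regularized_saddle X Y G L z).

Lemma saddle_ofP z : regularized_saddle X Y G L z (saddle_of z).
Proof.
have [s Hs] := regularized_saddle_exists H z.
by rewrite /saddle_of; case: xgetP => // /(_ s).
Qed.

Definition run_potential om t : R :=
  let s := rS om t in
  potential F G L th (st_z s) (st_xi s) (st_n s) (st_v s) (rXY om t)
    (saddle_of (st_z s)).

Lemma potential_descent om t :
  run_potential om t.+1 + beta / 16 * residual_bound om t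
  + beta * L ^+ 2 * (request_move om (3 * t + 1) + request_move om (3 * t + 2))
  <= run_potential om t + beta^-1 * (request_error om (3 * t)
     + request_error om (3 * t + 1) + request_error om (3 * t + 2)).
Proof.
have [nx ny] := run_normal om t.
have := @potential_step _ _ _ X Y F G L mu th H th_gt0 thE
  (st_x (rS om t)) (st_z (rS om t)) (st_xi (rS om t)) (rH om t).1
  (st_x (rS om t.+1)) (st_xi (rS om t.+1)) (st_z (rS om t.+1))
  (st_y (rS om t)) (st_n (rS om t)) (st_v (rS om t)) (rH om t).2
  (st_y (rS om t.+1)) (st_n (rS om t.+1)) (st_v (rS om t.+1))
  (rE om (3 * t)) (rE om (3 * t + 1)) (rE om (3 * t + 2))
  (saddle_of (st_z (rS om t))) (saddle_of (st_z (rS om t.+1))) nx ny.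
rewrite estimate0 estimate1 estimate2 => /(_ erefl erefl erefl erefl erefl erefl erefl erefl).
move=> /(_ (saddle_ofP _) (saddle_ofP _)).
rewrite /request_move /request_error estimate0 estimate1 estimate2.
have -> : (3 * t + 1).-1 = (3 * t)%N by rewrite addn1.
have -> : (3 * t + 2).-1 = (3 * t + 1)%N by rewrite addn2 addn1.
rewrite query0 query1 query2 /run_potential /residual_bound /run_xy.
move: (rS om t) (rS om t.+1) (rH om t) (rE1 om t) => s1 s2 [hx hy] g1.
by move: (run_est0 _ _ _ _ _ _ _ _ _ _ _ _ _ _ _) => g0.
Qed.

Lemma saddle_value_ge (lb : R) : 
  (forall x, X x -> exists2 y, Y y & lb <= F (x, y)) ->
  forall z, lb <= saddle_value F L z (saddle_of z).
Proof.
move=> lbP z; have Hs := saddle_ofP z; have [[Xs Ys] _ _] := Hs.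
have [y Yy lby] := lbP _ Xs; apply: (le_trans lby).
apply: le_trans (saddle_max H Hs Yy) _.
have h1 : 0 <= mu / 2 * dotv (y - (saddle_of z).2) (y - (saddle_of z).2).
  by rewrite mulr_ge0 ?dotv_ge0// divr_ge0// ltW// (sp_mu_gt0 H).
have h2 : 0 <= L * dotv ((saddle_of z).1 - z) ((saddle_of z).1 - z).
  by rewrite mulr_ge0 ?dotv_ge0// ltW// (sp_L_gt0 H).
rewrite /saddle_value; lra.
Qed.

Lemma descent_sum om T : 
  run_potential om T + \sum_(0 <= t < T) beta / 16 * residual_bound om t
  + beta * L ^+ 2 * \sum_(0 <= j < 3 * T) request_move om j
  <= run_potential om 0 + beta^-1 * \sum_(0 <= j < 3 * T) request_error om j.
Proof.
apply: telescope_requests => [t|t]; first exact: potential_descent.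
rewrite /request_move (_ : _ - _ = 0) ?/dotp ?dotv0l ?addr0//.
case: t => [|t]; first by rewrite muln0 subrr.
have -> : (3 * t.+1).-1 = (3 * t + 2)%N by rewrite mulnS addnC addn3 addn2.
by rewrite query0 query2 subrr.
Qed.

(** The saddle value at any center dominates a lower bound of the primal
    function, so the potential cannot fall below [L * lb]. *)
Lemma descent_bound (lb : R) om T :
  (forall x, X x -> exists2 y, Y y & lb <= F (x, y)) ->
  \sum_(0 <= t < T) beta / 16 * residual_bound om t
  + beta * L ^+ 2 * \sum_(0 <= j < 3 * T) request_move om j
  <= run_potential om 0 - L * lb
     + beta^-1 * \sum_(0 <= j < 3 * T) request_error om j.
Proof.
move=> lbP; have := descent_sum om T.
have [nx [Yy _]] := run_normal om T.
have := potential_ge (st_n (rS om T)) (st_v (rS om T))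
  H th_gt0 thE (saddle_ofP (st_z (rS om T))) nx Yy.
have := ler_wpM2l (ltW (sp_L_gt0 H)) (saddle_value_ge lbP (st_z (rS om T))).
rewrite -/(rXY om T) -/(run_potential om T); lra.
Qed.

End Descent.

Lemma dist0_le {R : realType} {m} (C : set 'rV[R]_m) v : C v -> dist0 C <= enorm v.
Proof.
move=> Cv; apply: ge_inf; last by exists v.
by exists 0 => _ [w _ <-]; exact: enorm_ge0.
Qed.

Lemma sq_dist0_le {R : realType} {m} (C : set 'rV[R]_m) v : C v ->
  dist0 C ^+ 2 <= dotv v v.
Proof.
move=> Cv; have d0 : 0 <= dist0 C.
  by apply: lb_le_inf; [exists (enorm v), v|move=> _ [w _ <-]; exact: enorm_ge0].
by rewrite -sqr_enorm ler_pXn2r ?nnegrE ?enorm_ge0// dist0_le.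
Qed.

Section Objective.
Context {R : realType} {n p : nat} (X : set 'rV[R]_n) (Y : set 'rV[R]_p).
Local Notation V := ('rV[R]_n * 'rV[R]_p)%type.
Context {dW} {W : measurableType dW} (D : probability W R) (f : V -> W -> R).
Context (L mu : R).
Hypothesis sa : standing_assumptions D X Y f L.
Hypothesis sc : strong_concavity X Y (objective D f) L mu.
Local Notation F := (objective D f).
Local Notation G := (grad (objective D f)).
Local Notation H := (standing_saddle_problem sa sc).

(** The distances in the residual are bounded by the particular normal vectors
    [xi] and [nu]; the proximal term, absent from the residual, is split off. *)
Lemma residual_le x y z xi nu : normal_cone X x xi -> normal_cone Y y nu ->
  residual_sq X Y F x y <=
  2 * dotv ((G (x, y)).1 + (2 * L) *: (x - z) + xi)
           ((G (x, y)).1 + (2 * L) *: (x - z) + xi)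
  + 8 * L ^+ 2 * dotv (x - z) (x - z)
  + dotv ((G (x, y)).2 - nu) ((G (x, y)).2 - nu).
Proof.
move=> nx ny; rewrite /residual_sq.
have h1 : dist0 [set gradx F (x, y) + g | g in normal_cone X x] ^+ 2 <=
    dotv (gradx F (x, y) + xi) (gradx F (x, y) + xi).
  by apply: sq_dist0_le; exists xi.
have h2 : dist0 [set - grady F (x, y) + g | g in normal_cone Y y] ^+ 2 <=
    dotv (grady F (x, y) - nu) (grady F (x, y) - nu).
  by rewrite dotvBB addrC; apply: sq_dist0_le; exists nu.
apply: le_trans (lerD h1 h2) _; rewrite lerD2r /=.
have := sq_sum2 (gradx F (x, y) + (2 * L) *: (x - z) + xi) ((- (2 * L)) *: (x - z)).
have -> : gradx F (x, y) + (2 * L) *: (x - z) + xi + - (2 * L) *: (x - z) =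
  gradx F (x, y) + xi by apply/rowP => i; rewrite !mxE; ring.
move/le_trans; apply; rewrite dotvZl dotvZr; lra.
Qed.

Lemma enorm_Y_bound : has_ubound [set enorm y | y in Y].
Proof.
have cf : {within Y, continuous (fun y : 'rV[R]_p => dotv (y - 0) (y - 0))}.
  by apply: continuous_subspaceT => y; exact: continuous_sqdist.
have [y /set_mem Yy ymax] := compact_EVT_max (sa_Y_nonempty sa) (sa_Y_compact sa) cf.
exists (enorm y) => _ [y' Yy' <-]; rewrite ler_enorm.
by have := ymax y'; rewrite !subr0; apply; rewrite inE.
Qed.

Lemma enorm_le_radius y : Y y -> enorm y <= Defs.radius Y.
Proof. by move=> Yy; apply: ub_le_sup; [exact: enorm_Y_bound|exists y]. Qed.

(** Concavity and the Cauchy-Schwarz inequality over a set of diameter at most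
    twice its radius. *)
Lemma objective_gap_le x y y' : X x -> Y y -> Y y' ->
  F (x, y') - F (x, y) <= 2 * Defs.radius Y * enorm (grady F (x, y)).
Proof.
move=> Xx Yy Yy'; have := sp_strong_concave H Xx Yy Yy'.
have h1 : 0 <= mu / 2 * dotv (y' - y) (y' - y).
  by rewrite mulr_ge0 ?dotv_ge0// divr_ge0// ltW// (sp_mu_gt0 H).
have h2 := dotv_le (grady F (x, y)) (y' - y).
have h3 : enorm (y' - y) <= 2 * Defs.radius Y.
  have := ler_enormD y' (- y); rewrite enormN.
  have := enorm_le_radius Yy; have := enorm_le_radius Yy'; lra.
have := ler_wpM2l (enorm_ge0 (grady F (x, y))) h3.
rewrite /=; lra.
Qed.

Lemma primal_bound x : X x -> has_ubound [set F (x, y) | y in Y].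
Proof.
move=> Xx; have [y0 Yy0] := sa_Y_nonempty sa.
exists (F (x, y0) + 2 * Defs.radius Y * enorm (grady F (x, y0))) => _ [y Yy <-].
by have := objective_gap_le Xx Yy0 Yy; lra.
Qed.

Lemma objective_le_primal x y : X x -> Y y -> F (x, y) <= primal Y F x.
Proof. by move=> Xx Yy; apply: ub_le_sup; [exact: primal_bound|exists y]. Qed.

(** Strong concavity makes the supremum attained at the second component of a
    saddle point, but it is enough that values within [e] of it occur. *)
Lemma primal_inf_approx e : 0 < e -> forall x, X x ->
  exists2 y, Y y & primal_inf X Y F - e <= F (x, y).
Proof.
move=> e0 x Xx.
have hs : has_sup [set F (x, y) | y in Y].
  split; last exact: primal_bound.
  by have [y0 Yy0] := sa_Y_nonempty sa; exists (F (x, y0)), y0.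
have [_ [y Yy <-] lt] := sup_adherent e0 hs.
exists y => //; apply: le_trans (ltW lt); rewrite lerD2r.
apply: ge_inf; first exact: sa_bounded_below sa.
by exists x.
Qed.

(** At the start [z = x0], [xi = 0], [nu = v = 0]: the residual fields are the
    gradients, the gap is at most [objective_gap_le], and the momentum
    correction is at most [th L] times the diameter of [Y]. *)
Lemma initial_potential th x0 y0 s : 0 < th -> 128 * th ^+ 2 * L = mu ->
  X x0 -> Y y0 -> regularized_saddle X Y G L x0 s ->
  potential F G L th x0 0 0 0 (x0, y0) s - L * primal_inf X Y F
  <= L * initial_quantity X Y F L x0 y0.
Proof.
move=> th0 thE Xx Yy Hs; have [[Xs Ys] _ _] := Hs.
have L0 := sp_L_gt0 H; have th1 := th_le H th0 thE.
rewrite /potential /initial_quantity /= subrr scaler0 !addr0 subr0 add0r.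
rewrite -!sqr_enorm; set gx := enorm _ ^+ 2; set gy := enorm _ ^+ 2.
have sv : saddle_value F L x0 s <= F (x0, s.2).
  have := saddle_min H Hs Xx; rewrite [saddle_value F L x0 (_, _)]/saddle_value /= subrr dotv0l mulr0 addr0.
  have : 0 <= L / 2 * dotv (x0 - s.1) (x0 - s.1).
    by rewrite mulr_ge0 ?dotv_ge0// divr_ge0// ltW.
  lra.
have v0 : saddle_value F L x0 (x0, y0) = F (x0, y0).
  by rewrite /saddle_value /= subrr dotv0l mulr0 addr0.
have gap := objective_gap_le Xx Yy Ys; have pr := objective_le_primal Xx Ys.
have D0 := sa_radius_gt0 sa.
have ny : enorm ((th * L) *: (y0 - s.2)) ^+ 2 <= L ^+ 2 * Defs.radius Y ^+ 2 / 16.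
  rewrite sqr_enorm dotvZl dotvZr -sqr_enorm.
  have h3 : enorm (y0 - s.2) <= 2 * Defs.radius Y.
    have := ler_enormD y0 (- s.2); rewrite enormN.
    have := enorm_le_radius Yy; have := enorm_le_radius Ys; lra.
  have h4 : enorm (y0 - s.2) ^+ 2 <= (2 * Defs.radius Y) ^+ 2.
    by rewrite ler_pXn2r ?nnegrE ?enorm_ge0// mulr_ge0// ltW.
  have t2 : th ^+ 2 <= 1 / 64 by have := th0; nra.
  have h5 := ler_pM (sqr_ge0 th) (sqr_ge0 _) t2 h4.
  have := ler_wpM2l (sqr_ge0 L) h5; lra.
have gap0 : 0 <= 2 * Defs.radius Y * enorm (grady F (x0, y0)).
  by rewrite mulr_ge0 ?enorm_ge0// mulr_ge0// ltW.
have kg : (3 / 4 - 2 * th) * L * (saddle_value F L x0 s - saddle_value F L x0 (x0, y0))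
    <= L * (2 * Defs.radius Y * enorm (grady F (x0, y0))).
  rewrite -mulrA -[leRHS]mul1r; apply: le_scale; [lra|lra| |by rewrite mulr_ge0 ?(ltW L0)].
  by rewrite ler_pM2l// v0; lra.
have gx0 : 0 <= gx by exact: sqr_ge0.
have gy0 : 0 <= gy by exact: sqr_ge0.
have LD0 : 0 <= L ^+ 2 * Defs.radius Y ^+ 2 by rewrite mulr_ge0 ?sqr_ge0.
have := ler_wpM2l (ltW L0) (le_trans sv pr).
have -> : L * (primal Y F x0 - primal_inf X Y F + 2 * Defs.radius Y * enorm (grady F (x0, y0)) +
   (gx + 2 * gy) / L + (3 + 1 / 64) * L * Defs.radius Y ^+ 2) =
   L * primal Y F x0 - L * primal_inf X Y F + L * (2 * Defs.radius Y * enorm (grady F (x0, y0)))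
   + (gx + 2 * gy) + (3 + 1 / 64) * (L ^+ 2 * Defs.radius Y ^+ 2).
  by field; rewrite gt_eqF.
lra.
Qed.

End Objective.

(** * Second moments and orthogonality of centered increments *)

Section SubSigmaAlgebra.
Context {R : realType} {d} {O : measurableType d} (P : probability O R).
Variable A : set (set O).
Hypothesis HA : is_sub_sigma_algebra A.
Local Notation OA := (g_sigma_algebraType A).

Lemma measurable_sub (E : set O) : measurable (E : set OA) <-> A E.
Proof. by rewrite /measurable/= sigma_algebra_id//; case: HA. Qed.

Lemma measurable_wrtP d' (T : measurableType d') (g : O -> T) :
  measurable_wrt A g <-> measurable_fun setT (g : OA -> T).
Proof.
split=> [mg _ B mB|mg B mB]; first by rewrite setTI; apply/measurable_sub/mg.
by apply/measurable_sub; rewrite -[X in measurable X]setTI; exact: mg.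
Qed.

Lemma measurable_wrt_fun d' (T : measurableType d') (g : O -> T) :
  measurable_wrt A g -> measurable_fun setT g.
Proof. by move=> mg _ B mB; rewrite setTI; apply: HA.2; exact: mg. Qed.

Import HBNNSimple.

(** The case of simple weights: split along the values of the weight. *)
Lemma integral_nnsfun_mul (s : {nnsfun OA >-> R}) (y : O -> R) :
  (forall w, 0 <= y w) -> measurable_fun setT y ->
  (\int[P]_w (s w * y w)%:E =
   \sum_(r \in range s) r%:E * \int[P]_(w in s @^-1` [set r]) (y w)%:E)%E.
Proof.
move=> y0 my.
pose B r : set O := s @^-1` [set r].
have mB r : measurable (B r).
  by apply/HA.2/measurable_sub; exact: measurable_sfunP.
have fE w : (s w * y w)%:E = (\sum_(r \in range s) (r * (\1_(B r) w * y w))%:E)%E.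
  rewrite {1}(fimfunE s w) fsumEFin; last exact: fimfunP.
  rewrite (fsbig_finite _ _ (fimfunP s)) mulr_suml.
  rewrite (fsbig_finite _ _ (fimfunP s)).
  by congr EFin; apply: eq_bigr => r _; rewrite mulrA.
under eq_integral do rewrite fE.
have mi r : measurable_fun setT (fun w => \1_(B r) w * y w).
  by apply: measurable_funM => //; exact: measurable_indic.
have ri r w : 0 <= r * (\1_(B r) w * y w).
  have [Bw|Bw] := pselect (B r w).
    by rewrite mulr_ge0// ?mulr_ge0//; rewrite -Bw.
  by rewrite indicE memNset// mul0r mulr0.
rewrite ge0_integral_fsum//; last 2 first.
- by move=> r; apply/measurable_EFinP; exact: measurable_funM.
- by move=> r w _; rewrite lee_fin.
apply: eq_fsbigr => r /set_mem[w _ <-].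
under eq_integral do rewrite EFinM.
rewrite ge0_integralZl//; last 3 first.
- exact/measurable_EFinP.
- by move=> x _; rewrite lee_fin mulr_ge0.
- by rewrite lee_fin.
congr (_ * _)%E; rewrite [RHS]integral_mkcond; apply: eq_integral => x _.
by rewrite /patch indicE; case: ifPn => _; rewrite ?mul1r ?mul0r.
Qed.

(** Two densities with the same integral over every set of the sub-sigma-algebra
    integrate every measurable weight alike. *)
Lemma integral_mul_sub (y1 y2 g : O -> R) :
  (forall w, 0 <= y1 w) -> (forall w, 0 <= y2 w) -> (forall w, 0 <= g w) ->
  measurable_fun setT y1 -> measurable_fun setT y2 -> measurable_wrt A g ->
  (forall E, A E -> \int[P]_(w in E) (y1 w)%:E = \int[P]_(w in E) (y2 w)%:E)%E ->
  (\int[P]_w (g w * y1 w)%:E = \int[P]_w (g w * y2 w)%:E)%E.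
Proof.
move=> y10 y20 g0 my1 my2 mg E12.
have mgA : measurable_fun setT (EFin \o g : OA -> \bar R).
  by apply/measurable_EFinP/measurable_wrtP.
pose s := nnsfun_approx measurableT mgA.
have lim_s (y : O -> R) : (forall w, 0 <= y w) -> measurable_fun setT y ->
    (\int[P]_w (g w * y w)%:E = limn (fun n => \int[P]_w (s n w * y w)%:E))%E.
  move=> y0 my.
  have ms n : measurable_fun setT (s n : O -> R).
    by apply/measurable_wrt_fun/measurable_wrtP.
  rewrite -monotone_convergence//; last 3 first.
  - by move=> n; apply/measurable_EFinP/measurable_funM.
  - by move=> n w _; rewrite lee_fin mulr_ge0.
  - move=> w _ m n mn; rewrite lee_fin ler_wpM2r//.
    by have /lefP := nd_nnsfun_approx measurableT mgA mn; exact.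
  apply: eq_integral => w _; apply/esym/cvg_lim => //.
  under eq_fun do rewrite EFinM.
  rewrite EFinM; apply: cvgeZr => //.
  by apply: (@cvg_nnsfun_approx _ _ _ setT measurableT _ mgA) => // x _; rewrite lee_fin.
rewrite !lim_s//; congr (limn _); apply/funext => n.
rewrite !integral_nnsfun_mul//; apply: eq_fsbigr => r _; congr (_ * _)%E.
by apply: E12; apply/measurable_sub; exact: measurable_sfunP.
Qed.
End SubSigmaAlgebra.

Lemma max0B {R : realDomainType} (x : R) : Num.max x 0 - Num.max (- x) 0 = x.
Proof.
rewrite !maxEle; case: (leP x 0) => h1; case: (leP (- x) 0) => h2; lra.
Qed.

Lemma max0_sq {R : realDomainType} (x : R) : Num.max x 0 ^+ 2 <= x ^+ 2.
Proof.
by have [h|h] := ltP x 0; rewrite // expr0n/= sqr_ge0.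
Qed.

Section SquareIntegrable.
Context {R : realType} {d} {O : measurableType d} (P : probability O R).
Implicit Types f g y z : O -> R.

Lemma integral_realD f g : (forall w, 0 <= f w) -> (forall w, 0 <= g w) ->
  measurable_fun setT f -> measurable_fun setT g ->
  (\int[P]_w (f w + g w)%:E = \int[P]_w (f w)%:E + \int[P]_w (g w)%:E)%E.
Proof.
move=> f0 g0 mf mg; under eq_integral do rewrite EFinD.
by rewrite ge0_integralD//; try exact/measurable_EFinP; move=> w _; rewrite lee_fin.
Qed.

Lemma integral_realZ f c : 0 <= c -> (forall w, 0 <= f w) -> measurable_fun setT f ->
  (\int[P]_w (c * f w)%:E = c%:E * \int[P]_w (f w)%:E)%E.
Proof.
move=> c0 f0 mf; under eq_integral do rewrite EFinM.
by rewrite ge0_integralZl//; [exact/measurable_EFinP|move=> w _; rewrite lee_fin].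
Qed.

Lemma integral_real_le f g : (forall w, 0 <= f w) ->
  measurable_fun setT f -> measurable_fun setT g -> (forall w, f w <= g w) ->
  (\int[P]_w (f w)%:E <= \int[P]_w (g w)%:E)%E.
Proof.
move=> f0 mf mg fg; apply: ge0_le_integral => //; try exact/measurable_EFinP.
- by move=> w _; rewrite lee_fin.
- by move=> w _; rewrite lee_fin.
Qed.

(** Second moments are followed through nonnegative integrals in the extended
    reals, since no random variable is known to be integrable in advance. *)
Definition sqint f := measurable_fun setT f /\ (\int[P]_w (f w ^+ 2)%:E < +oo)%E.

Lemma sqint_dominated f g c : measurable_fun setT f -> sqint g ->
  (forall w, f w ^+ 2 <= c + g w ^+ 2) -> sqint f.
Proof.
move=> mf [mg ig] fg; split => //.
have msq (h : O -> R) : measurable_fun setT h -> measurable_fun setT (fun w : O => h w ^+ 2 : R).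
  by move=> mh; exact: measurable_funX.
apply: (@le_lt_trans _ _ (\int[P]_w (`|c| + g w ^+ 2)%:E)%E).
  apply: integral_real_le; [by move=> w; exact: sqr_ge0|exact: msq| |].
    by apply: measurable_funD => //; exact: msq.
  by move=> w; rewrite (le_trans (fg w))// lerD2r ler_norm.
rewrite integral_realD//; [|by move=> w; exact: sqr_ge0|exact: msq].
apply: lte_add_pinfty => //; rewrite integral_cst//.
by rewrite [X in (_ * X)%E](probability_setT P) mule1 ltry.
Qed.

Lemma sqintZ c f : sqint f -> sqint (fun w => c * f w).
Proof.
move=> [mf jf]; split; first exact: measurable_funM.
under eq_integral do rewrite exprMn.
rewrite integral_realZ; [|exact: sqr_ge0|by move=> w; exact: sqr_ge0|exact: measurable_funX].
by apply: lte_mul_pinfty => //; rewrite lee_fin sqr_ge0.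
Qed.

Lemma sqintD f g : sqint f -> sqint g -> sqint (fun w => f w + g w).
Proof.
move=> [mf jf] [mg ig]; split; first exact: measurable_funD.
have msq (h : O -> R) : measurable_fun setT h -> measurable_fun setT (fun w : O => h w ^+ 2 : R).
  by move=> mh; exact: measurable_funX.
apply: (@le_lt_trans _ _ (\int[P]_w (2 * f w ^+ 2 + 2 * g w ^+ 2)%:E)%E).
  apply: integral_real_le; [by move=> w; exact: sqr_ge0|exact/msq/measurable_funD| |].
    by apply: measurable_funD; apply: measurable_funM => //; exact: msq.
  move=> w; have := sqr_ge0 (f w - g w).
  by rewrite sqrrB sqrrD; lra.
have s0 (h : O -> R) w : 0 <= h w ^+ 2 by exact: sqr_ge0.
rewrite integral_realD; [|by move=> w; rewrite mulr_ge0|by move=> w; rewrite mulr_ge0|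
  by apply: measurable_funM => //; exact: msq|by apply: measurable_funM => //; exact: msq].
rewrite !integral_realZ//; [|exact: msq|exact: msq].
by apply: lte_add_pinfty; exact: lte_mul_pinfty.
Qed.

Lemma sqintN f : sqint f -> sqint (fun w => - f w).
Proof. by move=> /(sqintZ (-1)); under eq_fun do rewrite mulN1r. Qed.

Lemma sqintB f g : sqint f -> sqint g -> sqint (fun w => f w - g w).
Proof. by move=> jf ig; apply: sqintD => //; exact: sqintN. Qed.

Lemma sqint_cst c : sqint (fun=> c).
Proof.
split => //; rewrite integral_cst//.
by rewrite [X in (_ * X)%E](probability_setT P) mule1 ltry.
Qed.

(** By [f g <= f^2 + g^2]; with [f = 1] it gives the integrability of [g] over a
    set of finite measure. *)
Lemma sqint_integral f g E : measurable E -> sqint f -> sqint g ->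
  (forall w, 0 <= f w) -> (forall w, 0 <= g w) ->
  (\int[P]_(w in E) (f w * g w)%:E < +oo)%E.
Proof.
move=> mE [mf jf] [mg ig] f0 g0.
apply: (@le_lt_trans _ _ (\int[P]_w (f w ^+ 2 + g w ^+ 2)%:E)%E).
  apply: (@le_trans _ _ (\int[P]_w (f w * g w)%:E)%E).
    apply: ge0_subset_integral => //.
      exact/measurable_EFinP/measurable_funM.
    by move=> w _; rewrite lee_fin mulr_ge0.
  apply: ge0_le_integral => //.
  - by move=> w _; rewrite lee_fin mulr_ge0.
  - exact/measurable_EFinP/measurable_funM.
  - by apply/measurable_EFinP/measurable_funD; exact: measurable_funX.
  - move=> w _; rewrite lee_fin; have := sqr_ge0 (f w - g w).
    have := sqr_ge0 (f w); have := sqr_ge0 (g w); rewrite sqrrB; lra.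
rewrite integral_realD; [|by move=> w; exact: sqr_ge0|by move=> w; exact: sqr_ge0|
  exact: measurable_funX|exact: measurable_funX].
exact: lte_add_pinfty.
Qed.

Lemma sqint_pos f : sqint f -> sqint f^\+.
Proof.
move=> sf; apply: (@sqint_dominated _ f 0) => //.
  by apply: measurable_funrpos; case: sf.
by move=> w; rewrite add0r; exact: max0_sq.
Qed.

Lemma sqint_neg f : sqint f -> sqint f^\-.
Proof. by move=> /sqintN/sqint_pos; rewrite funrposN. Qed.

End SquareIntegrable.

Section Orthogonality.
Context {R : realType} {d} {O : measurableType d} (P : probability O R).
Variable A : set (set O).
Hypothesis HA : is_sub_sigma_algebra A.
Implicit Types s y z e : O -> R.

(** The conditional expectation of [e] vanishes, stated with positive and
    negative parts so that it only involves nonnegative integrals. *)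
Definition centered e :=
  forall E, A E -> (\int[P]_(w in E) (e^\+ w)%:E = \int[P]_(w in E) (e^\- w)%:E)%E.

Lemma integral_lty1 y E : measurable E -> sqint P y -> (forall w, 0 <= y w) ->
  (\int[P]_(w in E) (y w)%:E < +oo)%E.
Proof.
move=> mE sy y0; have := sqint_integral mE (sqint_cst P 1) sy (fun=> ler01) y0.
by under eq_integral do rewrite mul1r.
Qed.

(** The identity [e^+ + y^- + Cp = e^- + y^+ + Cn] holds almost surely and has
    only nonnegative terms; integrated over a known event, the terms in [y] and
    its conditional expectations cancel, as they are finite. *)
Lemma cond_exp_centered y z : is_cond_exp P A y z -> sqint P y -> sqint P z ->
  centered (fun w => y w - z w).
Proof.
move=> [mz [cp [cn [[mcp cp0 icp] [mcn cn0 icn] zE]]]] sy sz E AE.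
have mE := HA.2 _ AE.
set e := fun w => y w - z w.
have se : sqint P e by exact: sqintB.
have mcp' := measurable_wrt_fun HA mcp; have mcn' := measurable_wrt_fun HA mcn.
have ge0 (f : O -> R) w : E w -> (0 <= (f^\+ w)%:E)%E.
  by rewrite lee_fin funrpos_ge0.
have mf (f : O -> R) : sqint P f -> measurable_fun E (fun w => (f^\+ w)%:E).
  by move=> [mf _]; apply/measurable_EFinP/measurable_funTS/measurable_funrpos.
have mn (f : O -> R) : sqint P f -> measurable_fun E (fun w => (f^\- w)%:E).
  by move=> [mf' _]; apply/measurable_EFinP/measurable_funTS/measurable_funrneg.
have ge0n (f : O -> R) w : E w -> (0 <= (f^\- w)%:E)%E.
  by rewrite lee_fin funrneg_ge0.
have Esum : (\int[P]_(w in E) ((e^\+ w)%:E + ((y^\- w)%:E + cp w)) =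
  \int[P]_(w in E) ((e^\- w)%:E + ((y^\+ w)%:E + cn w)))%E.
  apply: ge0_ae_eq_integral => //.
  - by apply: emeasurable_funD; [exact: mf|apply: emeasurable_funD;
      [exact: mn|exact: measurable_funTS]].
  - by apply: emeasurable_funD; [exact: mn|apply: emeasurable_funD;
      [exact: mf|exact: measurable_funTS]].
  - by move=> w Ew; rewrite adde_ge0 ?ge0// adde_ge0 ?ge0n.
  - by move=> w Ew; rewrite adde_ge0 ?ge0n// adde_ge0 ?ge0.
  - apply: filterS zE => w zw _; have := cp0 w; have := cn0 w.
    move: zw; case: (cp w) => [c| |]//; case: (cn w) => [c'| |]//= -[zw] _ _.
    rewrite -!EFinD; congr EFin.
    have := max0B (e w); have := max0B (y w); rewrite /funrpos/funrneg /e/=; lra.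
have fy : (\int[P]_(w in E) (y^\+ w)%:E < +oo)%E.
  by apply: integral_lty1 => //; exact: sqint_pos.
have fyn : (\int[P]_(w in E) (y^\- w)%:E < +oo)%E.
  by apply: integral_lty1 => //; exact: sqint_neg.
have split1 (f g h : O -> \bar R) : measurable_fun E f -> measurable_fun E g ->
    measurable_fun E h -> (forall w, E w -> 0 <= f w)%E ->
    (forall w, E w -> 0 <= g w)%E -> (forall w, E w -> 0 <= h w)%E ->
    (\int[P]_(w in E) (f w + (g w + h w)) = \int[P]_(w in E) f w +
      (\int[P]_(w in E) g w + \int[P]_(w in E) h w))%E.
  move=> m1 m2 m3 f0 g0 h0; rewrite ge0_integralD//; last 2 first.
  - by move=> w Ew; rewrite adde_ge0 ?g0 ?h0.
  - exact: emeasurable_funD.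
  by congr (_ + _)%E; exact: ge0_integralD.
move: Esum; rewrite !split1//; try first [exact: mf | exact: mn | exact: measurable_funTS
  | exact: ge0 | exact: ge0n].
have -> : (\int[P]_(w in E) cp w = \int[P]_(w in E) (y^\+ w)%:E)%E by exact: icp.
have -> : (\int[P]_(w in E) cn w = \int[P]_(w in E) (y^\- w)%:E)%E by exact: icn.
rewrite [in RHS](addeC (\int[P]_(w in E) (y^\+ w)%:E)%E).
have fn : ((\int[P]_(w in E) (y^\- w)%:E + \int[P]_(w in E) (y^\+ w)%:E) \is a fin_num)%E.
  rewrite fin_numD ge0_fin_numE ?fyn ?ge0_fin_numE ?fy//; apply: integral_ge0 => w Ew.
    exact: ge0.
  exact: ge0n.
move=> /(congr1 (fun t => t - (\int[P]_(w in E) (y^\- w)%:E + \int[P]_(w in E) (y^\+ w)%:E)))%E.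
by rewrite !addeK.
Qed.

(** A centered increment is orthogonal to everything known before it. *)
Lemma pythagoras s e (c : R) : 0 <= c -> measurable_wrt A s -> sqint P s -> sqint P e ->
  centered e ->
  (\int[P]_w ((s w + c * e w) ^+ 2)%:E =
   \int[P]_w (s w ^+ 2)%:E + (c ^+ 2)%:E * \int[P]_w (e w ^+ 2)%:E)%E.
Proof.
move=> c0 ms ss se ce.
have ms' := measurable_wrt_fun HA ms; have me := se.1.
have m2 (f g : O -> R) : measurable_fun setT f -> measurable_fun setT g ->
    measurable_fun setT (fun w => f w * g w) by exact: measurable_funM.
have mp (f : O -> R) : measurable_fun setT f -> measurable_fun setT f^\+.
  exact: measurable_funrpos.
have mn (f : O -> R) : measurable_fun setT f -> measurable_fun setT f^\-.
  exact: measurable_funrneg.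
have msp : measurable_wrt A s^\+.
  by apply/measurable_wrtP => //; apply/measurable_funrpos/measurable_wrtP.
have msn : measurable_wrt A s^\-.
  by apply/measurable_wrtP => //; apply/measurable_funrneg/measurable_wrtP.
have Epp := integral_mul_sub HA (funrpos_ge0 e) (funrneg_ge0 e) (funrpos_ge0 s)
  (mp _ me) (mn _ me) msp ce.
have Enn := integral_mul_sub HA (funrpos_ge0 e) (funrneg_ge0 e) (funrneg_ge0 s)
  (mp _ me) (mn _ me) msn ce.
(* The cross term [s e] is the difference of these two nonnegative functions,
   whose integrals agree as [s] is known and [e] is centered. *)
pose cross1 w := s^\+ w * e^\- w + s^\- w * e^\+ w.
pose cross2 w := s^\+ w * e^\+ w + s^\- w * e^\- w.
have pp (f g : O -> R) w : 0 <= f^\+ w * g^\+ w by rewrite mulr_ge0.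
have pn (f g : O -> R) w : 0 <= f^\+ w * g^\- w by rewrite mulr_ge0.
have np (f g : O -> R) w : 0 <= f^\- w * g^\+ w by rewrite mulr_ge0.
have nn (f g : O -> R) w : 0 <= f^\- w * g^\- w by rewrite mulr_ge0.
have c10 w : 0 <= cross1 w by rewrite addr_ge0.
have c20 w : 0 <= cross2 w by rewrite addr_ge0.
have mc1 : measurable_fun setT cross1 by apply: measurable_funD; apply: m2; auto.
have mc2 : measurable_fun setT cross2 by apply: measurable_funD; apply: m2; auto.
have E12 : (\int[P]_w (cross1 w)%:E = \int[P]_w (cross2 w)%:E)%E.
  by rewrite !integral_realD//; auto; rewrite Epp -Enn.
have fin1 : (\int[P]_w (cross1 w)%:E < +oo)%E.
  rewrite integral_realD//; auto.
  apply: lte_add_pinfty; apply: sqint_integral => //;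
  do ?[exact: sqint_pos|exact: sqint_neg].
have sq0 (f : O -> R) w : 0 <= f w ^+ 2 by exact: sqr_ge0.
have msq (f : O -> R) : measurable_fun setT f -> measurable_fun setT (fun w => f w ^+ 2).
  by move=> mf; exact: measurable_funX.
have : (\int[P]_w ((s w + c * e w) ^+ 2 + (2 * c) * cross1 w)%:E =
  \int[P]_w ((s w ^+ 2 + c ^+ 2 * e w ^+ 2) + (2 * c) * cross2 w)%:E)%E.
  apply: eq_integral => w _; congr EFin.
  have := max0B (e w); have := max0B (s w).
  rewrite /cross1 /cross2 /funrpos /funrneg /=.
  move: (Num.max (s w) 0) (Num.max (- s w) 0) (Num.max (e w) 0) (Num.max (- e w) 0).
  by move=> sp sn ep en <- <-; ring.
have c20' : 0 <= 2 * c by rewrite mulr_ge0.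
rewrite integral_realD; [|exact: sq0|by move=> w; rewrite mulr_ge0|
  by apply/msq/measurable_funD => //; exact: measurable_funM|exact: measurable_funM].
have c2e w : 0 <= c ^+ 2 * e w ^+ 2 by apply: mulr_ge0; exact: sqr_ge0.
rewrite integral_realD; [|by move=> w; apply: addr_ge0; [exact: sq0|exact: c2e]|
  by move=> w; rewrite mulr_ge0| |exact: measurable_funM]; last first.
  by apply: measurable_funD; [exact: msq|apply: measurable_funM => //; exact: msq].
rewrite integral_realD; [|exact: sq0|exact: c2e|exact: msq|
  by apply: measurable_funM => //; exact: msq].
rewrite (integral_realZ P (sqr_ge0 c)); [|exact: sq0|exact: msq].
rewrite !(integral_realZ P c20')// E12.
set I := (_ * \int[P]_w (cross2 w)%:E)%E.
have finI : (I \is a fin_num)%E.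
  rewrite fin_numM// ge0_fin_numE -?E12//.
  by apply: integral_ge0 => w _; rewrite lee_fin.
by move=> /(congr1 (fun t => t - I)%E); rewrite !addeK.
Qed.

End Orthogonality.

(** * Freshness of the samples *)

Section Independence.
Context {R : realType} {d} {O : measurableType d} (P : probability O R).

(** The sets independent of [C] form a Dynkin class, so independence extends
    from a pi-system to the sigma-algebra it generates. *)
Lemma indep_generated (G : set (set O)) (C : set O) :
  setI_closed G -> G `<=` measurable -> measurable C ->
  (forall E, G E -> P (E `&` C) = (P E * P C)%E) ->
  forall E, <<s G >> E -> P (E `&` C) = (P E * P C)%E.
Proof.
move=> GI Gm mC GC.
pose K := [set E : set O | measurable E /\ P (E `&` C) = (P E * P C)%E].
suff : <<s G >> `<=` K by move=> GK E /GK[].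
rewrite -setI_closed_g_dynkin_g_sigma_algebra//; apply: smallest_sub; last first.
  by move=> E GE; split; [exact: Gm|exact: GC].
split.
- split; first exact: measurableT.
  by rewrite setTI [X in (X * _)%E](probability_setT P) mul1e.
- move=> E [mE EC]; split; first exact: measurableC.
  have hD : P (C `\` E) = (P C - P (C `&` E))%E.
    by rewrite measureD// ltey_eq fin_num_measure.
  have hC : P (~` E) = (1 - P E)%E by rewrite probability_setC.
  rewrite (setIC (~` E)) -setDE hD hC (setIC C E) EC.
  have : (P E \is a fin_num)%E by rewrite fin_num_measure.
  have : (P C \is a fin_num)%E by rewrite fin_num_measure.
  move=> /fineK <- /fineK <-; rewrite -!EFinM -!EFinB; congr EFin; ring.
- move=> F tF FK.
  have mF i : measurable (F i) by have [] := FK i.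
  split; first exact: bigcupT_measurable.
  rewrite setI_bigcupl measure_bigcup//; last 2 first.
  - by move=> i _; exact: measurableI.
  - exact: trivIset_setIr.
  rewrite measure_bigcup//.
  have : (P C \is a fin_num)%E by rewrite fin_num_measure.
  move=> /fineK PC; rewrite muleC -PC -nneseriesZl//.
  by apply: eq_eseriesr => i _; apply: etrans (FK i).2 _; rewrite muleC PC.
Qed.

End Independence.

Section Filtration.
Context {R : realType} {dW} {W : measurableType dW} (D : probability W R).
Context {d} {O : measurableType d} (P : probability O R).
Context (T q Br b : nat) (omega : nat -> nat -> O -> W).
Hypothesis FB : fresh_batches D P T q Br b omega.
Local Notation size := (batch_size q Br b).
Local Notation past := (past_samples q Br b omega).

(** What is known just before sample [i] of request [j] is drawn. *)
Definition before (j i : nat) : set (set O) :=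
  <<s past j `|` [set E | exists i' B, [/\ (i' < i)%N, measurable B & E = omega j i' @^-1` B]] >>.

Lemma past_sub j : (j <= 3 * T)%N -> is_sub_sigma_algebra (past j).
Proof.
move=> jT; split; first exact: smallest_sigma_algebra.
apply: smallest_sub; first exact: sigma_algebra_measurable.
move=> _ [j' [i [B [jj ib mB ->]]]]; rewrite -[X in measurable X]setTI.
by apply: (fb_measurable FB) => //; exact: leq_trans jT.
Qed.

Lemma before_sub j i : (j < 3 * T)%N -> (i <= size j)%N -> is_sub_sigma_algebra (before j i).
Proof.
move=> jT ib; split; first exact: smallest_sigma_algebra.
apply: smallest_sub; first exact: sigma_algebra_measurable.
move=> E [pE|[i' [B [ii mB ->]]]]; first exact: (past_sub (ltnW jT)).2.
by rewrite -[X in measurable X]setTI; apply: (fb_measurable FB) => //; exact: leq_trans ib.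
Qed.

Lemma past_before j i : past j `<=` before j i.
Proof. by move=> E pE; apply: sub_sigma_algebra; left. Qed.

Lemma before_mono j i i' : (i <= i')%N -> before j i `<=` before j i'.
Proof.
move=> ii; apply: smallest_sub; first exact: smallest_sigma_algebra.
move=> E [pE|[k [B [ki mB ->]]]]; first exact: past_before.
by apply: sub_sigma_algebra; right; exists k, B; split => //; exact: leq_trans ii.
Qed.

Lemma before_past j i : (i <= size j)%N -> before j i `<=` past j.+1.
Proof.
move=> ib; apply: smallest_sub; first exact: smallest_sigma_algebra.
move=> E [pE|[k [B [ki mB ->]]]].
  move: E pE; apply: smallest_sub; first exact: smallest_sigma_algebra.
  move=> _ [j' [i' [B [jj ib' mB ->]]]]; apply: sub_sigma_algebra.
  by exists j', i', B; split => //; exact: ltnW.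
by apply: sub_sigma_algebra; exists j, k, B; split => //; exact: leq_trans ib.
Qed.

Lemma sample_before j i B : measurable B -> before j i.+1 (omega j i @^-1` B).
Proof. by move=> mB; apply: sub_sigma_algebra; right; exists i, B. Qed.

(** The events known before the sample are generated by boxes: a past event and
    one condition for each earlier sample of the batch.  For boxes independence is
    the product rule, used once with and once without a condition on sample
    [i]. *)
Lemma fresh j i : (j < 3 * T)%N -> (i < size j)%N ->
  fresh_sample D P (before j i) (omega j i).
Proof.
move=> jT ib; split; first exact: (fb_measurable FB).
  by move=> B mB; exact: (fb_law FB).
move=> E B EA mB.
pose box (E0 : set O) (Bs : nat -> set W) :=
  E0 `&` \big[setI/setT]_(i' < size j) (omega j i' @^-1` Bs i').
pose G := [set E | exists E0 Bs, [/\ past j E0, forall i', measurable (Bs i'),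
  (forall i', (i <= i')%N -> Bs i' = setT) & E = box E0 Bs]].
have mom i' (C : set W) : (i' < size j)%N -> measurable C -> measurable (omega j i' @^-1` C).
  move=> h mC; rewrite -[X in measurable X]setTI.
  exact: (fb_measurable FB).
have [sp pm] := past_sub (ltnW jT).
have G_sub : G `<=` measurable.
  move=> _ [E0 [Bs [pE0 mBs _ ->]]]; apply: measurableI; first exact: pm.
  by apply: big_ind => //; [exact: measurableI|move=> i' _; exact: mom].
have GI : setI_closed G.
  move=> _ _ [E0 [Bs [pE0 mBs Bs1 ->]]] [E1 [Cs [pE1 mCs Cs1 ->]]].
  exists (E0 `&` E1), (fun i' => Bs i' `&` Cs i'); split.
  - exact: (@measurableI _ (g_sigma_algebraType _) E0 E1 pE0 pE1).
  - by move=> i'; exact: measurableI.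
  - by move=> i' ii; rewrite Bs1// Cs1// setTI.
  - rewrite /box setIACA -big_split/=; congr (_ `&` _).
have GE : before j i `<=` <<s G >>.
  apply: smallest_sub; first exact: smallest_sigma_algebra.
  move=> F [pF|[k [C [ki mC ->]]]]; apply: sub_sigma_algebra.
    exists F, (fun=> setT); split => //.
    by rewrite /box big1 ?setIT// => i' _; rewrite preimage_setT.
  exists setT, (fun i' => if i' == k then C else setT); split => //.
  - exact: (@measurableT _ (g_sigma_algebraType _)).
  - by move=> i'; case: ifP.
  - by move=> i' ii; case: eqP => // ik; move: ki; rewrite -ik ltnNge ii.
  - have kb := ltn_trans ki ib.
    rewrite /box setTI (bigD1 (Ordinal kb))//= eqxx big1 ?setIT// => i' ik.
    by rewrite ifN ?preimage_setT//; apply: contra ik => /eqP ik; apply/eqP/val_inj.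
apply: (indep_generated GI G_sub) => //; last exact: GE.
  exact: mom.
move=> _ [E0 [Bs [pE0 mBs Bs1 ->]]].
pose Bs' i' := if i' == i then B else Bs i'.
have mBs' i' : measurable (Bs' i') by rewrite /Bs'; case: ifP.
have Bi : Bs' i = B by rewrite /Bs' eqxx.
have Bo (k : 'I_(size j)) : k != Ordinal ib -> Bs' k = Bs k.
  by move=> ki; rewrite /Bs' ifN//; apply: contra ki => /eqP ki; apply/eqP/val_inj.
have h1 := fb_indep FB jT pE0 mBs; have h2 := fb_indep FB jT pE0 mBs'.
have -> : box E0 Bs `&` omega j i @^-1` B = box E0 Bs'.
  rewrite /box -setIA; congr (_ `&` _).
  rewrite (bigD1 (Ordinal ib))//= [in RHS](bigD1 (Ordinal ib))//=.
  rewrite Bi Bs1// preimage_setT setTI setIC; congr (_ `&` _).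
  by apply: eq_bigr => k ki; rewrite Bo.
rewrite /box; apply: etrans h2 _.
apply: etrans (esym (congr1 (fun t => t * P (omega j i @^-1` B))%E h1)).
rewrite -muleA; congr (_ * _)%E.
rewrite (bigD1 (Ordinal ib))//= [in RHS](bigD1 (Ordinal ib))//=.
rewrite Bi Bs1// preimage_setT [X in (X * _ * _)%E](probability_setT P) mul1e muleC.
by congr (_ * _)%E; apply: eq_bigr => k ki; rewrite Bo.
Qed.

End Filtration.

(** * Random vectors *)

Section VectorMeasurability.
Context {R : realType} {d} {S : measurableType d}.

(** Open sets of row vectors are countable unions of boxes with rational
    center and radius, so measurable coordinates suffice. *)
Lemma measurable_row {m} (f : S -> 'rV[R]_m) :
  (forall k, measurable_fun setT (fun w => f w 0 k)) ->
  measurable_fun setT (f : S -> borel 'rV[R]_m).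
Proof.
move=> mf; apply: (@measurability _ _ S (borel 'rV[R]_m) setT f (@open 'rV[R]_m)) => //.
move=> _ [U oU <-]; rewrite setTI.
pose box (i : 'rV[rat]_m * rat) : set 'rV[R]_m :=
  [set x | forall k, `]ratr (i.1 0 k) - ratr i.2, ratr (i.1 0 k) + ratr i.2[%classic (x 0 k)].
pose B (i : 'rV[rat]_m * rat) : set S := [set w | box i `<=` U /\ box i (f w)].
have mB i : measurable (B i).
  have [iU|iU] := pselect (box i `<=` U); last first.
    by rewrite (_ : B i = set0)//; apply/seteqP; split => // w [].
  rewrite (_ : B i = \bigcap_(k in [set: 'I_m]) ((fun w => f w 0 k) @^-1`
    `]ratr (i.1 0 k) - ratr i.2, ratr (i.1 0 k) + ratr i.2[%classic)).
    apply: fin_bigcap_measurable; first exact: finite_finset.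
    move=> k _; have := mf k measurableT _
      (measurable_itv `]ratr (i.1 0 k) - ratr i.2, ratr (i.1 0 k) + ratr i.2[).
    by rewrite setTI.
  apply/seteqP; split => [w [_ wi] k _|w wi]; first exact: wi.
  by split => // k; exact: wi.
have -> : f @^-1` U = \bigcup_i B i.
  apply/seteqP; split => [w Uw|w [i _ [iU wi]]]; last exact: iU.
  have : nbhs (f w) U by exact: open_nbhs_nbhs.
  move=> /nbhs_ballP[e /= e0 eU].
  have /rat_in_itvoo[r] : 0 < e / 2 by rewrite divr_gt0.
  rewrite in_itv/= => /andP[r0 re].
  have /choice[c cP] : forall k, exists c : rat,
      (ratr c \in `]f w 0 k - ratr r, f w 0 k + ratr r[)%R.
    by move=> k; apply: rat_in_itvoo; rewrite ltrBlDr -addrA ltrDl addr_gt0.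
  exists (\row_k c k, r) => //; split => [x xb|k]; last first.
    by rewrite /= mxE; have := cP k; rewrite !in_itv/=; lra.
  apply: eU; split => // i k; rewrite (ord1 i).
  have := xb k; have := cP k; rewrite /= mxE !in_itv/= => /andP[h1 h2] /andP[h3 h4].
  by rewrite /ball/= ltr_norml; apply/andP; split; lra.
by apply: countable_bigcupT_measurable.
Qed.

Lemma continuous_measurable_row {m} d' (T : measurableType d') (g : 'rV[R]_m -> T) G :
  @measurable _ T = <<s G >> -> (forall U, G U -> open (g @^-1` U)) ->
  measurable_fun setT (g : borel 'rV[R]_m -> T).
Proof.
move=> mT go; apply: (@measurability _ _ (borel 'rV[R]_m) T setT g G) => // _ [U GU <-]; rewrite setTI.
by apply: sub_sigma_algebra; exact: go.
Qed.

Lemma measurable_coord {m} k :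
  measurable_fun setT ((fun x : 'rV[R]_m => x 0 k) : borel 'rV[R]_m -> R).
Proof.
apply: (continuous_measurable_row (RGenOpens.measurableE R)) => _ [x [y ->]].
apply: open_comp; last exact: interval_open.
by move=> z _; exact: coord_continuous.
Qed.

(** The Borel structure of row vectors is generated by the open sets. *)
Lemma continuous_measurable {m m'} (g : 'rV[R]_m -> 'rV[R]_m') : continuous g ->
  measurable_fun setT (g : borel 'rV[R]_m -> borel 'rV[R]_m').
Proof.
move=> cg; apply: (@continuous_measurable_row _ _ (borel 'rV[R]_m') g (@open 'rV[R]_m')) => // U oU.
by apply: open_comp => // z _; exact: cg.
Qed.

End VectorMeasurability.

Lemma continuous_eproj {R : realType} {m} (C : set 'rV[R]_m) :
  C !=set0 -> closed C -> convex_set C -> continuous (eproj C).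
Proof.
move=> C0 Ccl Ccv x U /nbhs_ballP[e /= e0 eU].
have nx : nbhs x [set y | dotv (y - x) (y - x) < e ^+ 2].
  apply: (@continuous_sqdist _ _ x x [set t | t < e ^+ 2]).
  apply: open_nbhs_nbhs; split; first exact: open_lt.
  by rewrite /= subrr dotv0l exprn_gt0.
apply: filterS nx => y /= xy; apply: eU; split => // i k; rewrite (ord1 i).
rewrite /ball/= -ltr_sqr ?nnegrE// ?(ltW e0)// real_normK ?num_real//.
apply: le_lt_trans xy; rewrite dotvBB; apply: le_trans (eproj_nonexp C0 Ccl Ccv x y).
by have := coord_sq_le (eproj C x - eproj C y) k; rewrite !mxE.
Qed.

Section RandomVectors.
Context {R : realType} {d} {O : measurableType d} (P : probability O R).
Implicit Types A : set (set O).

Section Known.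
Variable A : set (set O).
Hypothesis HA : is_sub_sigma_algebra A.

(** Stated by coordinates, so that the scalar results on orthogonality apply;
    [measurable_row] recovers measurability for the Borel sets of row vectors. *)
Definition random_row {m} (f : O -> 'rV[R]_m) :=
  forall k, measurable_wrt A (fun w => f w 0 k) /\ sqint P (fun w => f w 0 k).

Lemma random_rowD {m} (f g : O -> 'rV[R]_m) :
  random_row f -> random_row g -> random_row (fun w => f w + g w).
Proof.
move=> rf rg k; have [mf sf] := rf k; have [mg sg] := rg k.
under eq_fun do rewrite mxE; split; last exact: sqintD.
by apply/measurable_wrtP => //; apply: measurable_funD; apply/measurable_wrtP.
Qed.

Lemma random_rowZ {m} c (f : O -> 'rV[R]_m) :
  random_row f -> random_row (fun w => c *: f w).
Proof.
move=> rf k; have [mf sf] := rf k.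
under eq_fun do rewrite mxE; split; last exact: sqintZ.
by apply/measurable_wrtP => //; apply: measurable_funM => //; apply/measurable_wrtP.
Qed.

Lemma random_rowB {m} (f g : O -> 'rV[R]_m) :
  random_row f -> random_row g -> random_row (fun w => f w - g w).
Proof.
move=> rf rg; apply: random_rowD => //.
by have := random_rowZ (-1) rg; under eq_fun do rewrite scaleN1r.
Qed.

Lemma random_row_cst {m} (c : 'rV[R]_m) : random_row (fun=> c).
Proof.
move=> k; split; last exact: sqint_cst.
by apply/measurable_wrtP => //; exact: measurable_cst.
Qed.

Lemma measurable_dotv {m} (f g : O -> 'rV[R]_m) :
  (forall k, measurable_wrt A (fun w => f w 0 k)) ->
  (forall k, measurable_wrt A (fun w => g w 0 k)) ->
  measurable_wrt A (fun w => dotv (f w) (g w)).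
Proof.
move=> mf mg; apply/measurable_wrtP => //; apply: measurable_sum => k.
by apply: measurable_funM; apply/measurable_wrtP.
Qed.

Lemma integral_dotv {m} (f : O -> 'rV[R]_m) : random_row f ->
  (\int[P]_w (dotv (f w) (f w))%:E = \sum_k \int[P]_w ((f w 0 k) ^+ 2)%:E)%E.
Proof.
move=> rf; under eq_integral do rewrite /dotv -sumEFin.
rewrite ge0_integral_sum//.
- move=> k; apply/measurable_EFinP/measurable_funM; exact: (rf k).2.1.
- by move=> k w _; rewrite lee_fin -expr2 sqr_ge0.
Qed.

Lemma integral_dotv_lty {m} (f : O -> 'rV[R]_m) : random_row f ->
  (\int[P]_w (dotv (f w) (f w))%:E < +oo)%E.
Proof.
by move=> rf; rewrite integral_dotv//; apply: lte_sum_pinfty => k _; case: (rf k) => _ [].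
Qed.

(** Domination of the Euclidean norm suffices, as it bounds every coordinate. *)
Lemma random_row_dominated {m} (f : O -> 'rV[R]_m) (e : O -> R) :
  (forall k, measurable_wrt A (fun w => f w 0 k)) -> sqint P e ->
  (forall w, dotv (f w) (f w) <= e w ^+ 2) -> random_row f.
Proof.
move=> mf se fe k; split => //; apply: (sqint_dominated _ se (c := 0)).
  exact: measurable_wrt_fun (mf k).
by move=> w; rewrite add0r; apply: le_trans (fe w); exact: coord_sq_le.
Qed.

End Known.
End RandomVectors.

Section RandomPairs.
Context {R : realType} {d} {O : measurableType d} (P : probability O R) {n p : nat}.
Local Notation V := ('rV[R]_n * 'rV[R]_p)%type.
Local Notation BV := (borel 'rV[R]_n * borel 'rV[R]_p)%type.
Implicit Types (A : set (set O)) (u v : O -> V).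

Definition random_pair A u :=
  random_row P A (fun w => (u w).1) /\ random_row P A (fun w => (u w).2).

Definition mean_sq u : \bar R := (\int[P]_w (dotp (u w) (u w))%:E)%E.

Lemma random_row_mono A A' {m} (f : O -> 'rV[R]_m) : A `<=` A' ->
  random_row P A f -> random_row P A' f.
Proof. by move=> AA rf k; have [mf sf] := rf k; split => // B /mf/AA. Qed.

Lemma random_pair_mono A A' u : A `<=` A' -> random_pair A u -> random_pair A' u.
Proof. by move=> AA [h1 h2]; split; exact: random_row_mono AA _. Qed.

Lemma mean_sq_ge0 u : (0 <= mean_sq u)%E.
Proof. by apply: integral_ge0 => w _; rewrite lee_fin dotp_ge0. Qed.

Section Known.
Variable A : set (set O).
Hypothesis HA : is_sub_sigma_algebra A.

Lemma random_pairD u v : random_pair A u -> random_pair A v ->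
  random_pair A (fun w => u w + v w).
Proof. by move=> [u1 u2] [v1 v2]; split; exact: random_rowD. Qed.

Lemma random_pairB u v : random_pair A u -> random_pair A v ->
  random_pair A (fun w => u w - v w).
Proof. by move=> [u1 u2] [v1 v2]; split; exact: random_rowB. Qed.

Lemma random_pairZ c u : random_pair A u -> random_pair A (fun w => c *: u w).
Proof. by move=> [u1 u2]; split; exact: random_rowZ. Qed.

Lemma random_pair_cst (c : V) : random_pair A (fun=> c).
Proof. by split; exact: random_row_cst. Qed.

Lemma random_pair_sum N (F : nat -> O -> V) :
  (forall i, (i < N)%N -> random_pair A (F i)) ->
  random_pair A (fun w => \sum_(i < N) F i w).
Proof.
elim: N => [|N IH] rF.
  by under eq_fun do rewrite big_ord0; exact: random_pair_cst.
under eq_fun do rewrite big_ord_recr/=.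
by apply: random_pairD; [apply: IH => i iN; apply: rF; exact: ltnW|exact: rF].
Qed.

Lemma measurable_dotp u : (forall k, measurable_wrt A (fun w => (u w).1 0 k)) ->
  (forall k, measurable_wrt A (fun w => (u w).2 0 k)) ->
  measurable_wrt A (fun w => dotp (u w) (u w)).
Proof.
move=> u1 u2; apply/measurable_wrtP => //.
by apply: measurable_funD; apply/measurable_wrtP => //; apply: measurable_dotv.
Qed.

Lemma random_pair_dotp u : random_pair A u -> measurable_wrt A (fun w => dotp (u w) (u w)).
Proof. by move=> [u1 u2]; apply: measurable_dotp => k; [case: (u1 k)|case: (u2 k)]. Qed.

Lemma measurable_dotp_fun u : random_pair A u ->
  measurable_fun setT (fun w => dotp (u w) (u w)).
Proof. by move=> ru; apply: (measurable_wrt_fun HA); exact: random_pair_dotp. Qed.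

Lemma mean_sqE u : random_pair A u ->
  (mean_sq u = \sum_k \int[P]_w (((u w).1 0 k) ^+ 2)%:E
             + \sum_k \int[P]_w (((u w).2 0 k) ^+ 2)%:E)%E.
Proof.
move=> [u1 u2]; rewrite /mean_sq /dotp.
rewrite integral_realD; first by rewrite (integral_dotv u1) (integral_dotv u2).
- by move=> w; exact: dotv_ge0.
- by move=> w; exact: dotv_ge0.
- by apply: (measurable_wrt_fun HA); apply: measurable_dotv => // k; case: (u1 k).
- by apply: (measurable_wrt_fun HA); apply: measurable_dotv => // k; case: (u2 k).
Qed.

Lemma mean_sq_lty u : random_pair A u -> (mean_sq u < +oo)%E.
Proof.
move=> [u1 u2]; rewrite (mean_sqE (conj u1 u2)).
apply: lte_add_pinfty; apply: lte_sum_pinfty => k _.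
  by case: (u1 k) => _ [].
by case: (u2 k) => _ [].
Qed.

Lemma measurable_sqrt (g : O -> R) : measurable_fun setT g ->
  measurable_fun setT (fun w => Num.sqrt (g w)).
Proof.
apply: measurableT_comp.
by apply: continuous_measurable_fun; exact: sqrt_continuous.
Qed.

Lemma sqint_enormp u : random_pair A u -> sqint P (fun w => enormp (u w)).
Proof.
move=> ru; split.
  under eq_fun do rewrite enormpE.
  by apply: measurable_sqrt; exact: measurable_dotp_fun.
under eq_integral do rewrite sqr_enormp.
exact: mean_sq_lty.
Qed.

Lemma random_pair_dominated u (e : O -> R) :
  (forall k, measurable_wrt A (fun w => (u w).1 0 k)) ->
  (forall k, measurable_wrt A (fun w => (u w).2 0 k)) -> sqint P e ->
  (forall w, dotp (u w) (u w) <= e w ^+ 2) -> random_pair A u.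
Proof.
move=> m1 m2 se ue; split; apply: (random_row_dominated HA _ se) => // w;
  apply: le_trans (ue w); rewrite /dotp ?lerDl ?lerDr; exact: dotv_ge0.
Qed.

(** Queries must be measurable for the Borel sets of the two factors, which is
    a matter of coordinates by [measurable_row]. *)
Lemma random_pair_admissible X Y u : random_pair A u ->
  (forall w, (X `*` Y) (u w)) -> admissible_query X Y A u.
Proof.
move=> [u1 u2] uXY; split => //; apply/measurable_wrtP => //.
apply: (measurable_fun_pairP _).2; split.
  by apply: measurable_row => k; apply/measurable_wrtP => //; case: (u1 k).
by apply: measurable_row => k; apply/measurable_wrtP => //; case: (u2 k).
Qed.

End Known.

Definition centered_pair A (e : O -> V) :=
  (forall k, centered P A (fun w => (e w).1 0 k)) /\
  (forall k, centered P A (fun w => (e w).2 0 k)).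

(** The scalar [pythagoras], summed over the coordinates. *)
Lemma mean_sq_pythagoras A A' (s e : O -> V) (c : R) :
  is_sub_sigma_algebra A -> is_sub_sigma_algebra A' -> A `<=` A' -> 0 <= c ->
  random_pair A s -> random_pair A' e -> centered_pair A e ->
  (mean_sq (fun w => s w + c *: e w)%R = mean_sq s + (c ^+ 2)%:E * mean_sq e)%E.
Proof.
move=> HA HA' AA c0 rs re [ce1 ce2].
have rs' := random_pair_mono AA rs.
have rse := random_pairD HA' rs' (random_pairZ HA' c re).
rewrite (mean_sqE HA' rse) (mean_sqE HA' rs') (mean_sqE HA' re).
have sq_ge0 (g : O -> R) : (0 <= \int[P]_w (g w ^+ 2)%:E)%E.
  by apply: integral_ge0 => w _; rewrite lee_fin sqr_ge0.
have row_eq (m : nat) (f g : O -> 'rV[R]_m) : random_row P A f -> random_row P A' g ->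
    (forall k, centered P A (fun w => g w 0 k)) ->
    (\sum_k \int[P]_w ((f w + c *: g w)%R 0%R k ^+ 2)%:E =
     \sum_k \int[P]_w (f w 0%R k ^+ 2)%:E
     + (c ^+ 2)%:E * \sum_k \int[P]_w (g w 0%R k ^+ 2)%:E)%E.
  move=> rf rg cg; rewrite ge0_sume_distrr// -big_split/=; apply: eq_bigr => k _.
  have [mf sf] := rf k; have [_ sg] := rg k.
  rewrite -(pythagoras HA c0 mf sf sg (cg k)).
  by apply: eq_integral => w _; rewrite !mxE.
rewrite (row_eq _ _ _ rs.1 re.1 ce1) (row_eq _ _ _ rs.2 re.2 ce2) addeACA.
congr (_ + _)%E; rewrite ge0_muleDr//; exact: sume_ge0.
Qed.
End RandomPairs.

Section CenteredSums.
Context {R : realType} {d} {O : measurableType d} (P : probability O R).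
Variable A : set (set O).
Hypothesis HA : is_sub_sigma_algebra A.

(** The positive and negative parts of [e1 - e2] rearrange into those of [e1] and
    [e2], and all the integrals are finite. *)
Lemma centeredB (e1 e2 : O -> R) : sqint P e1 -> sqint P e2 ->
  centered P A e1 -> centered P A e2 -> centered P A (fun w => e1 w - e2 w).
Proof.
move=> s1 s2 c1 c2 E AE; have mE := HA.2 _ AE.
set e := fun w => e1 w - e2 w.
have se : sqint P e by exact: sqintB.
have mp (g : O -> R) : sqint P g -> measurable_fun E (fun w => (g^\+ w)%:E).
  by move=> [mg _]; apply/measurable_EFinP/measurable_funTS/measurable_funrpos.
have mn (g : O -> R) : sqint P g -> measurable_fun E (fun w => (g^\- w)%:E).
  by move=> [mg _]; apply/measurable_EFinP/measurable_funTS/measurable_funrneg.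
have p0 (g : O -> R) w : E w -> (0 <= (g^\+ w)%:E)%E by rewrite lee_fin funrpos_ge0.
have n0 (g : O -> R) w : E w -> (0 <= (g^\- w)%:E)%E by rewrite lee_fin funrneg_ge0.
have Esum : (\int[P]_(w in E) ((e^\+ w)%:E + ((e1^\- w)%:E + (e2^\+ w)%:E)) =
  \int[P]_(w in E) ((e^\- w)%:E + ((e1^\+ w)%:E + (e2^\- w)%:E)))%E.
  apply: eq_integral => w _; rewrite -!EFinD; congr EFin.
  have := max0B (e w); have := max0B (e1 w); have := max0B (e2 w).
  rewrite /funrpos/funrneg /e/=; lra.
have split1 (g1 g2 g3 : O -> \bar R) : measurable_fun E g1 -> measurable_fun E g2 ->
    measurable_fun E g3 -> (forall w, E w -> 0 <= g1 w)%E ->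
    (forall w, E w -> 0 <= g2 w)%E -> (forall w, E w -> 0 <= g3 w)%E ->
    (\int[P]_(w in E) (g1 w + (g2 w + g3 w)) = \int[P]_(w in E) g1 w +
      (\int[P]_(w in E) g2 w + \int[P]_(w in E) g3 w))%E.
  move=> m1 m2 m3 h1 h2 h3; rewrite ge0_integralD//; last 2 first.
  - by move=> w Ew; rewrite adde_ge0 ?h2 ?h3.
  - exact: emeasurable_funD.
  by congr (_ + _)%E; exact: ge0_integralD.
move: Esum; rewrite !split1//; try first [exact: mp|exact: mn|exact: p0|exact: n0].
rewrite (c1 _ AE) (c2 _ AE).
have fin : (\int[P]_(w in E) (e1^\- w)%:E + \int[P]_(w in E) (e2^\- w)%:E \is a fin_num)%E.
  rewrite fin_numD !ge0_fin_numE; try (apply: integral_ge0 => w Ew; exact: n0).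
  by rewrite !integral_lty1//; exact: sqint_neg.
move=> /(congr1 (fun t => t - (\int[P]_(w in E) (e1^\- w)%:E
  + \int[P]_(w in E) (e2^\- w)%:E)))%E.
by rewrite !addeK.
Qed.

End CenteredSums.

Section Batch.
Context {R : realType} {d} {O : measurableType d} (P : probability O R) {n p : nat}.
Local Notation V := ('rV[R]_n * 'rV[R]_p)%type.

(** The errors of the samples of one batch form a martingale difference
    sequence, so their variances add up. *)
Lemma batch_mean_sq (Fil : nat -> set (set O)) N (s : O -> V) (e : nat -> O -> V)
    (c : R) (v : \bar R) : 0 <= c -> (0 <= v)%E ->
  (forall i, (i <= N)%N -> is_sub_sigma_algebra (Fil i)) ->
  (forall i j, (i <= j)%N -> Fil i `<=` Fil j) ->
  random_pair P (Fil 0%N) s ->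
  (forall i, (i < N)%N -> [/\ random_pair P (Fil i.+1) (e i),
     centered_pair P (Fil i) (e i) & (mean_sq P (e i) <= v)%E]) ->
  (mean_sq P (fun w => s w + c *: \sum_(i < N) e i w)%R
   <= mean_sq P s + (c ^+ 2 * N%:R)%:E * v)%E.
Proof.
move=> c0 v0 HF mF rs; elim: N HF => [|N IH] HF He.
  by rewrite mulr0 mul0e adde0; under eq_fun do rewrite big_ord0 scaler0 addr0.
have [reN ceN veN] := He N (ltnSn N).
have HN := HF N (leqnSn N); have HS := HF N.+1 (leqnn _).
pose s' w := s w + c *: \sum_(i < N) e i w.
have rs' : random_pair P (Fil N) s'.
  apply: random_pairD => //; first exact: random_pair_mono (mF _ _ (leq0n N)) _.
  apply: random_pairZ => //; apply: random_pair_sum => // i iN.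
  by have [r _ _] := He i (ltnW iN); exact: random_pair_mono (mF _ _ iN) r.
have -> : (fun w => s w + c *: \sum_(i < N.+1) e i w) = (fun w => s' w + c *: e N w).
  by apply/funext => w; rewrite big_ord_recr/= scalerDr addrA.
rewrite (mean_sq_pythagoras HN HS (mF _ _ (leqnSn N)) c0 rs' reN ceN).
have -> : (c ^+ 2 * N.+1%:R)%:E = ((c ^+ 2 * N%:R)%:E + (c ^+ 2)%:E)%E.
  by rewrite -EFinD -natr1 mulrDr mulr1.
have c20 : 0 <= c ^+ 2 by exact: sqr_ge0.
have cN0 : 0 <= c ^+ 2 * N%:R by exact: mulr_ge0.
rewrite ge0_muleDl ?lee_fin//.
rewrite addeA; apply: leeD; last by apply: lee_wpmul2l; rewrite ?lee_fin.
apply: IH => [i iN|i iN]; first by apply: HF; exact: leqW.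
by apply: He; exact: ltnW.
Qed.

End Batch.

Lemma coordB1 {R : realType} {n p} (u v : 'rV[R]_n * 'rV[R]_p) k :
  (u - v).1 0 k = u.1 0 k - v.1 0 k.
Proof. by case: u v => [a b] [c e]; rewrite !mxE. Qed.

Lemma coordB2 {R : realType} {n p} (u v : 'rV[R]_n * 'rV[R]_p) k :
  (u - v).2 0 k = u.2 0 k - v.2 0 k.
Proof. by case: u v => [a b] [c e]; rewrite !mxE. Qed.

Section SampledGradients.
Context {R : realType} {n p : nat} {dW} {W : measurableType dW} (D : probability W R).
Context {d} {O : measurableType d} (P : probability O R).
Local Notation V := ('rV[R]_n * 'rV[R]_p)%type.
Local Notation BV := (borel 'rV[R]_n * borel 'rV[R]_p)%type.
Context (X : set 'rV[R]_n) (Y : set 'rV[R]_p) (f : V -> W -> R) (L mu sigma ell : R).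
Hypothesis H : saddle_problem X Y (objective D f) (grad (objective D f)) L mu.
Hypothesis SO : stochastic_oracle D P X Y f sigma.
Hypothesis PO : paired_oracle D P X Y f L ell.
Local Notation G := (grad (objective D f)).

Variables (A A' : set (set O)) (omega : O -> W).
Hypotheses (HA : is_sub_sigma_algebra A) (HA' : is_sub_sigma_algebra A') (AA : A `<=` A').
Hypotheses (fresh : fresh_sample D P A omega) (momega : measurable_wrt A' omega).

Lemma cond_exp_ge0_le_integral (y : O -> R) (z : O -> R) :
  (forall w, 0 <= z w) -> measurable_fun setT z -> cond_exp_ge0_le P A y z ->
  (\int[P]_w (y w)%:E <= \int[P]_w (z w)%:E)%E.
Proof.
move=> z0 mz [C [mC C0 iC] Cz].
have AT : A setT by apply/(measurable_sub HA); exact: measurableT.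
rewrite -(iC _ AT); apply: ae_ge0_le_integral => //.
- exact: (measurable_wrt_fun HA).
- by move=> w _; rewrite lee_fin.
- exact/measurable_EFinP.
- by apply: filterS Cz => w h _.
Qed.

(** The gradient at a random query is known because the oracle says that it is a
    conditional expectation; its second moment is finite because the gradient is
    Lipschitz. *)
Lemma random_gradient u : random_pair P A u -> (forall w, (X `*` Y) (u w)) ->
  random_pair P A (fun w => G (u w)).
Proof.
move=> ru uXY; have au := random_pair_admissible HA ru uXY.
have [x0 Xx0] := sp_X0 H; have [y0 Yy0] := sp_Y0 H.
pose u0 : V := (x0, y0).
have rd := random_pairB HA ru (random_pair_cst P HA u0).
have se : sqint P (fun w => L * enormp (u w - u0)).
  by apply: sqintZ; exact: (sqint_enormp HA rd).
have m1 k : measurable_wrt A (fun w => (G (u w)).1 0 k).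
  by have [] := so_unbiased_x SO HA au fresh k.
have m2 k : measurable_wrt A (fun w => (G (u w)).2 0 k).
  by have [] := so_unbiased_y SO HA au fresh k.
have cst c : measurable_wrt A (fun=> c : R).
  by apply/measurable_wrtP => //; exact: measurable_cst.
have mB (g : O -> R) c : measurable_wrt A g -> measurable_wrt A (fun w => g w - c).
  by move=> mg; apply/measurable_wrtP => //; apply: measurable_funB => //; apply/measurable_wrtP.
have rGd : random_pair P A (fun w => G (u w) - G u0).
  have d1 k : measurable_wrt A (fun w => (G (u w) - G u0).1 0 k).
    by under eq_fun do rewrite coordB1; exact: mB.
  have d2 k : measurable_wrt A (fun w => (G (u w) - G u0).2 0 k).
    by under eq_fun do rewrite coordB2; exact: mB.
  apply: (random_pair_dominated HA d1 d2 se) => w.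
  by rewrite exprMn sqr_enormp; apply: (sp_lip H).
have := random_pairD HA rGd (random_pair_cst P HA (G u0)).
by under eq_fun do rewrite subrK.
Qed.

Lemma measurable_closed_row {m} (C : set 'rV[R]_m) : closed C ->
  measurable (C : set (borel 'rV[R]_m)).
Proof.
move=> Ccl; rewrite -[X in measurable X]setCK; apply: measurableC.
by apply: sub_sigma_algebra; exact: closed_openC.
Qed.

(** Integrate the conditional variance over the whole space. *)
Lemma sample_variance u : random_pair P A u -> (forall w, (X `*` Y) (u w)) ->
  (mean_sq P (fun w => sgrad f (u w) (omega w) - G (u w))%R <= (sigma ^+ 2)%:E)%E.
Proof.
move=> ru uXY; have au := random_pair_admissible HA ru uXY.
have := cond_exp_ge0_le_integral (fun=> sqr_ge0 sigma) (@measurable_cst _ _ _ _ setT _)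
  (so_variance SO HA au fresh).
rewrite integral_cst// [X in (_ * X)%E](probability_setT P) mule1.
by under eq_integral do rewrite sqr_enormp.
Qed.

(** The sampled gradient has a finite second moment, as it deviates from the
    gradient by the variance only. *)
Lemma random_sample u : random_pair P A u -> (forall w, (X `*` Y) (u w)) ->
  random_pair P A' (fun w => sgrad f (u w) (omega w)).
Proof.
move=> ru uXY; have au := random_pair_admissible HA ru uXY.
have rG := random_pair_mono AA (random_gradient ru uXY).
pose OA := g_sigma_algebraType A'.
have mu' : measurable_fun setT (u : OA -> BV).
  by apply/measurable_wrtP => // B mB; apply: AA; exact: au.1.
have mo : measurable_fun setT (omega : OA -> W) by exact/measurable_wrtP.
have mXY : measurable ((X `*` Y) `*` setT : set (BV * W)).
  apply: measurableX => //; apply: measurableX; apply: measurable_closed_row.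
    exact: sp_Xcl H.
  exact: sp_Ycl H.
have ms : measurable_fun setT ((fun w => sgrad f (u w) (omega w)) : OA -> BV).
  apply: (@measurable_comp _ _ _ OA (BV * W)%type BV _ _ setT
    (fun w => (u w, omega w)) mXY _ (so_measurable SO)).
    by move=> _ [w _ <-]; split => //; exact: uXY.
  exact: measurable_fun_pair.
have m1 k : measurable_wrt A' (fun w => (sgrad f (u w) (omega w)).1 0 k).
  apply/measurable_wrtP => //; apply: (measurableT_comp (measurable_coord k)).
  exact: (measurableT_comp measurable_fst ms).
have m2 k : measurable_wrt A' (fun w => (sgrad f (u w) (omega w)).2 0 k).
  apply/measurable_wrtP => //; apply: (measurableT_comp (measurable_coord k)).
  exact: (measurableT_comp measurable_snd ms).
have mB (g1 g2 : O -> R) : measurable_wrt A' g1 -> measurable_wrt A' g2 ->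
    measurable_wrt A' (fun w => g1 w - g2 w).
  by move=> mg mg'; apply/measurable_wrtP => //; apply: measurable_funB => //; apply/measurable_wrtP.
pose e w := sgrad f (u w) (omega w) - G (u w).
have e1 k : measurable_wrt A' (fun w => (e w).1 0 k).
  by under eq_fun do rewrite coordB1; apply: mB => //; case: (rG.1 k).
have e2 k : measurable_wrt A' (fun w => (e w).2 0 k).
  by under eq_fun do rewrite coordB2; apply: mB => //; case: (rG.2 k).
have se : sqint P (fun w => enormp (e w)).
  split.
    under eq_fun do rewrite enormpE; apply: measurable_sqrt.
    by apply: (measurable_wrt_fun HA'); exact: measurable_dotp.
  under eq_integral do rewrite sqr_enormp.
  exact: le_lt_trans (sample_variance ru uXY) (ltry _).
have re : random_pair P A' e.
  by apply: (random_pair_dominated HA' e1 e2 se) => w; rewrite sqr_enormp.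
have := random_pairD HA' re rG.
by rewrite /e; under eq_fun do rewrite subrK.
Qed.

Lemma sample_centered u : random_pair P A u -> (forall w, (X `*` Y) (u w)) ->
  centered_pair P A (fun w => sgrad f (u w) (omega w) - G (u w)).
Proof.
move=> ru uXY; have au := random_pair_admissible HA ru uXY.
have rG := random_gradient ru uXY; have rs := random_sample ru uXY.
split=> k; under eq_fun do rewrite ?coordB1 ?coordB2; apply: cond_exp_centered => //.
- exact: (so_unbiased_x SO HA au fresh).
- by case: (rs.1 k).
- by case: (rG.1 k).
- exact: (so_unbiased_y SO HA au fresh).
- by case: (rs.2 k).
- by case: (rG.2 k).
Qed.

Lemma paired_sample u v : random_pair P A u -> (forall w, (X `*` Y) (u w)) ->
  random_pair P A v -> (forall w, (X `*` Y) (v w)) ->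
  (mean_sq P (fun w => sgrad f (u w) (omega w) - sgrad f (v w) (omega w))%R
   <= (ell ^+ 2)%:E * mean_sq P (fun w => u w - v w)%R)%E.
Proof.
move=> ru uXY rv vXY; have rd := random_pairB HA ru rv.
have h := PO.2 _ _ _ _ HA (random_pair_admissible HA ru uXY)
  (random_pair_admissible HA rv vXY) fresh.
have md : measurable_fun setT (fun w => ell ^+ 2 * enormp (u w - v w) ^+ 2).
  under eq_fun do rewrite sqr_enormp.
  by apply: measurable_funM => //; exact: (measurable_dotp_fun HA rd).
have ge0 (w : O) : 0 <= ell ^+ 2 * enormp (u w - v w) ^+ 2.
  by apply: mulr_ge0; exact: sqr_ge0.
have := cond_exp_ge0_le_integral ge0 md h.
under eq_integral do rewrite sqr_enormp.
under [X in (_ <= X)%E]eq_integral do rewrite sqr_enormp.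
rewrite integral_realZ; [exact|exact: sqr_ge0|by move=> w; exact: dotp_ge0|].
exact: (measurable_dotp_fun HA rd).
Qed.

(** The gradient difference decomposes orthogonally into its conditional mean
    and the centered increment, so the latter has the smaller second moment. *)
Lemma paired_increment u v : random_pair P A u -> (forall w, (X `*` Y) (u w)) ->
  random_pair P A v -> (forall w, (X `*` Y) (v w)) ->
  let e w := (sgrad f (u w) (omega w) - G (u w)) - (sgrad f (v w) (omega w) - G (v w)) in
  [/\ random_pair P A' e, centered_pair P A e &
      (mean_sq P e <= (ell ^+ 2)%:E * mean_sq P (fun w => u w - v w)%R)%E].
Proof.
move=> ru uXY rv vXY e.
have rG := random_pairB HA (random_gradient ru uXY) (random_gradient rv vXY).
have rs := random_pairB HA' (random_sample ru uXY) (random_sample rv vXY).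
have ru' := random_pairB HA' (random_sample ru uXY) (random_pair_mono AA (random_gradient ru uXY)).
have rv' := random_pairB HA' (random_sample rv vXY) (random_pair_mono AA (random_gradient rv vXY)).
have re : random_pair P A' e by exact: random_pairB.
have ce : centered_pair P A e.
  have [cu1 cu2] := sample_centered ru uXY; have [cv1 cv2] := sample_centered rv vXY.
  split=> k; under eq_fun do rewrite ?(coordB1 (_ - _)) ?(coordB2 (_ - _)).
    exact: (centeredB HA (ru'.1 k).2 (rv'.1 k).2 (cu1 k) (cv1 k)).
  exact: (centeredB HA (ru'.2 k).2 (rv'.2 k).2 (cu2 k) (cv2 k)).
split => //; apply: le_trans (paired_sample ru uXY rv vXY).
have := mean_sq_pythagoras HA HA' AA ler01 rG re ce.
rewrite expr1n mul1e => h.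
have -> : mean_sq P (fun w => sgrad f (u w) (omega w) - sgrad f (v w) (omega w)) =
    mean_sq P (fun w => (G (u w) - G (v w)) + 1 *: e w).
  congr mean_sq; apply/funext => w; rewrite scale1r /e.
  rewrite (opprD (sgrad f (v w) (omega w))) opprK [X in _ = _ + X]addrACA (addrC (- G (u w))) -(opprB (G (u w))) addrCA.
  by rewrite subrr addr0.
by rewrite h leeDr// mean_sq_ge0.
Qed.

End SampledGradients.

(** * Random runs and the error of the estimates *)

Section ProjectedRow.
Context {R : realType} {d} {O : measurableType d} (P : probability O R).
Variable A : set (set O).
Hypothesis HA : is_sub_sigma_algebra A.

(** Projections are nonexpansive, hence continuous and of at most linear
    growth. *)
Lemma random_row_eproj {m} (C : set 'rV[R]_m) (f : O -> 'rV[R]_m) :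
  C !=set0 -> closed C -> convex_set C -> random_row P A f ->
  random_row P A (fun w => eproj C (f w)).
Proof.
move=> C0 Ccl Ccv rf.
have mrow : measurable_fun setT (f : g_sigma_algebraType A -> borel 'rV[R]_m).
  by apply: measurable_row => k; apply/measurable_wrtP => //; case: (rf k).
have mproj := measurableT_comp (continuous_measurable (continuous_eproj C0 Ccl Ccv)) mrow.
have mf k : measurable_wrt A (fun w => (eproj C (f w) - eproj C 0) 0 k).
  apply/measurable_wrtP => //; under eq_fun do rewrite mxE.
  apply: measurable_funD => //.
  exact: (measurableT_comp (measurable_coord k) mproj).
have se : sqint P (fun w => enorm (f w)).
  split.
    apply: measurable_sqrt; apply: (measurable_wrt_fun HA).
    by apply: measurable_dotv => // k; case: (rf k).
  under eq_integral do rewrite sqr_enorm.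
  exact: (integral_dotv_lty rf).
have rd : random_row P A (fun w => eproj C (f w) - eproj C 0).
  apply: (random_row_dominated HA mf se) => w.
  by rewrite sqr_enorm -[in leRHS](subr0 (f w)); exact: eproj_nonexp.
have := random_rowD HA rd (random_row_cst P HA (eproj C 0)).
by under eq_fun do rewrite subrK.
Qed.

End ProjectedRow.

(** Centering each sample of a batch amounts to subtracting the mean once per
    sample. *)
Lemma sum_centered_diff {V : zmodType} N (a b : 'I_N -> V) (c e : V) :
  \sum_(i < N) ((a i - c) - (b i - e)) = \sum_(i < N) (a i - b i) - (c - e) *+ N.
Proof.
have -> : (c - e) *+ N = \sum_(i < N) (c - e) by rewrite sumr_const card_ord.
rewrite -sumrB; apply: eq_bigr => i _.
by rewrite (opprB c) (opprD (b i)) opprK addrACA (addrC (- c)).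
Qed.

Section RandomRun.
Context {R : realType} {n p : nat} {dW} {W : measurableType dW} (D : probability W R).
Context {d} {O : measurableType d} (P : probability O R).
Local Notation V := ('rV[R]_n * 'rV[R]_p)%type.
Context (X : set 'rV[R]_n) (Y : set 'rV[R]_p) (f : V -> W -> R) (L mu sigma ell : R).
Hypothesis H : saddle_problem X Y (objective D f) (grad (objective D f)) L mu.
Hypothesis SO : stochastic_oracle D P X Y f sigma.
Hypothesis PO : paired_oracle D P X Y f L ell.
Local Notation G := (grad (objective D f)).
Context (h al k beta : R) (T q Br b : nat) (x0 : 'rV[R]_n) (y0 : 'rV[R]_p).
Context (omega : nat -> nat -> O -> W).
Hypothesis FB : fresh_batches D P T q Br b omega.
Hypotheses (Br0 : (0 < Br)%N) (b0 : (0 < b)%N).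
Local Notation size := (batch_size q Br b).
Local Notation past := (past_samples q Br b omega).
Local Notation before := (before q Br b omega).
Local Notation om w := (fun j i => omega j i w).
Local Notation rS w t := (run X Y (sgrad f) L h al k beta q Br b x0 y0 (om w) t).
Local Notation rXY w t := (run_xy X Y (sgrad f) L h al k beta q Br b x0 y0 (om w) t).
Local Notation rH w t := (run_half X Y (sgrad f) L h al k beta q Br b x0 y0 (om w) t).
Local Notation rE0 w t := (run_est0 X Y (sgrad f) L h al k beta q Br b x0 y0 (om w) t).
Local Notation rE1 w t := (run_est1 X Y (sgrad f) L h al k beta q Br b x0 y0 (om w) t).
Local Notation rQ w j := (query X Y (sgrad f) L h al k beta q Br b x0 y0 (om w) j).
Local Notation rE w j := (estimate X Y (sgrad f) L h al k beta q Br b x0 y0 (om w) j).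
Hypothesis Qin : forall o j,
  (X `*` Y) (query X Y (sgrad f) L h al k beta q Br b x0 y0 o j).

Lemma size_gt0 j : (0 < size j)%N.
Proof. by rewrite /batch_size; case: ifP. Qed.

Lemma sample_known j i : measurable_wrt (before j i.+1) (omega j i).
Proof. by move=> B mB; exact: sample_before. Qed.

Lemma past_random_gradient j u : (j < 3 * T)%N -> random_pair P (past j) u ->
  (forall w, (X `*` Y) (u w)) -> random_pair P (before j 0) (fun w => G (u w)).
Proof.
move=> jT ru uXY.
exact: (random_gradient H SO (before_sub FB jT (leq0n _)) (fresh FB jT (size_gt0 j))
  (random_pair_mono (@past_before _ _ _ _ _ _ _ _ j 0) ru) uXY).
Qed.

Lemma past_random_sample j i u : (j < 3 * T)%N -> (i < size j)%N ->
  random_pair P (past j) u -> (forall w, (X `*` Y) (u w)) ->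
  random_pair P (before j i.+1) (fun w => sgrad f (u w) (omega j i w)).
Proof.
move=> jT ij ru uXY.
exact: (random_sample H SO (before_sub FB jT (ltnW ij)) (before_sub FB jT ij)
  (before_mono (leqnSn i)) (fresh FB jT ij) (@sample_known j i)
  (random_pair_mono (@past_before _ _ _ _ _ _ _ _ j i) ru) uXY).
Qed.

Lemma random_estimate j u u' g : (j < 3 * T)%N -> random_pair P (past j) u ->
  random_pair P (past j) u' -> random_pair P (past j) g ->
  (forall w, (X `*` Y) (u w)) -> (forall w, (X `*` Y) (u' w)) ->
  random_pair P (past j.+1)
    (fun w => vr_estimate (sgrad f) q Br b (om w) j (u w) (u' w) (g w)).
Proof.
move=> jT ru ru' rg uXY uXY'; have HA := past_sub FB jT.
have rs i (v : O -> V) : (i < size j)%N -> random_pair P (past j) v -> (forall w, (X `*` Y) (v w)) ->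
    random_pair P (past j.+1) (fun w => sgrad f (v w) (omega j i w)).
  by move=> ij rv vXY; apply: random_pair_mono (before_past ij) _; exact: past_random_sample.
have pp : past j `<=` past j.+1.
  by move=> E pE; apply: (before_past (leq0n (size j))); exact: past_before.
rewrite /vr_estimate; move: rs; rewrite /batch_size; case: ifP => _ rs.
  apply: (random_pairZ HA).
  apply: (random_pair_sum HA (F := fun i w => sgrad f (u w) (omega j i w))) => i ij.
  exact: rs.
apply: (random_pairD HA); first exact: random_pair_mono pp rg.
apply: (random_pairZ HA); apply: (random_pair_sum HA
  (F := fun i w => sgrad f (u w) (omega j i w) - sgrad f (u' w) (omega j i w))) => i ij.
by apply: (random_pairB HA); exact: rs.
Qed.

(** The previous query is left out: it coincides with the current iterate
    ([st_query_xy]). *)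
Definition random_state A (s : O -> @state R n p) :=
  [/\ random_pair P A (fun w => (st_x (s w), st_y (s w))),
      random_row P A (fun w => st_z (s w)), random_row P A (fun w => st_xi (s w)),
      random_row P A (fun w => st_n (s w)) & random_row P A (fun w => st_v (s w))] /\
  random_pair P A (fun w => st_est (s w)).

Lemma past_mono i j : (i <= j)%N -> past i `<=` past j.
Proof.
move=> ij; apply: smallest_sub; first exact: smallest_sigma_algebra.
move=> _ [j' [i' [B [jj ib mB ->]]]]; apply: sub_sigma_algebra.
by exists j', i', B; split => //; exact: leq_trans ij.
Qed.

Lemma st_query_xy w t : st_query (rS w t) = rXY w t.
Proof. by case: t. Qed.

(** The three requests of a step are made one after the other: each query point
    is a function of the earlier estimates, hence known when its own samples are
    drawn. *)
Lemma random_step0 t : (t < T)%N -> random_state (past (3 * t)) (fun w => rS w t) ->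
  random_pair P (past (3 * t).+1) (fun w => rE0 w t) /\
  random_pair P (past (3 * t).+1) (fun w => rH w t).
Proof.
move=> tT [[rxy rz rxi rn rv] re].
have jT : (3 * t < 3 * T)%N by rewrite ltn_pmul2l.
have HA := past_sub FB jT.
have up m (g : O -> 'rV[R]_m) : random_row P (past (3 * t)) g -> random_row P (past (3 * t).+1) g.
  by apply: random_row_mono; exact: past_mono.
have r0 : random_pair P (past (3 * t).+1) (fun w => rE0 w t).
  rewrite /run_est0; apply: random_estimate => //.
  - by under eq_fun do rewrite st_query_xy.
  - by move=> w; rewrite -query0; exact: Qin.
  - by move=> w; rewrite st_query_xy -query0; exact: Qin.
have [rx ry] := rxy; have [r01 r02] := r0.
split => //; split.
  apply: random_row_eproj; [exact: HA|exact: sp_X0 H|exact: sp_Xcl H|exact: sp_Xcv H|].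
  apply: (random_rowB HA); first exact: up.
  apply: (random_rowZ HA); apply: (random_rowD HA); last exact: up.
  apply: (random_rowD HA) => //; apply: (random_rowZ HA).
  by apply: (random_rowB HA); exact: up.
apply: random_row_eproj; [exact: HA|exact: sp_Y0 H|exact: sp_Ycl H|exact: sp_Ycv H|].
apply: (random_rowD HA); first exact: up.
apply: (random_rowZ HA); apply: (random_rowD HA); last exact: up.
by apply: (random_rowB HA) => //; exact: up.
Qed.

Lemma random_step1 t : (t < T)%N -> random_state (past (3 * t)) (fun w => rS w t) ->
  random_pair P (past (3 * t).+2) (fun w => rE1 w t) /\
  random_pair P (past (3 * t).+2) (fun w => rXY w t.+1).
Proof.
move=> tT rs; have [r0 rh] := random_step0 tT rs.
have [[rxy rz rxi rn rv] re] := rs.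
have jT : ((3 * t).+1 < 3 * T)%N.
  by apply: (@leq_trans (3 * t.+1)); rewrite ?leq_mul2l// mulnS addnC addn3.
have HA := past_sub FB jT.
have up m (g : O -> 'rV[R]_m) : random_row P (past (3 * t)) g -> random_row P (past (3 * t).+2) g.
  by apply: random_row_mono; apply: past_mono; exact: leqW (leqnSn _).
have rh' := random_pair_mono (@past_mono _ _ (leqnSn (3 * t).+1)) rh.
have r1 : random_pair P (past (3 * t).+2) (fun w => rE1 w t).
  rewrite /run_est1 addn1; apply: random_estimate => //.
  - by apply: random_pair_mono rxy; apply: past_mono.
  - by move=> w; rewrite -query1; exact: Qin.
  - by move=> w; rewrite -query0; exact: Qin.
have [rx ry] := rxy; have [r11 r12] := r1; have [rh1 rh2] := rh'.
split; first exact: r1.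
have -> : (fun w => rXY w t.+1) = (fun w =>
    (eproj X (st_x (rS w t) - h *: ((rE1 w t).1 + (2 * L) *: ((rH w t).1 - st_z (rS w t)))),
     eproj Y (st_y (rS w t) + h *: ((rE1 w t).2 + (al *: st_v (rS w t) + k *: (rE1 w t).2))))).
  by apply/funext => w; rewrite /run_xy run_S.
split.
  apply: random_row_eproj; [exact: HA|exact: sp_X0 H|exact: sp_Xcl H|exact: sp_Xcv H|].
  apply: (random_rowB HA); first exact: up.
  apply: (random_rowZ HA); apply: (random_rowD HA) => //; apply: (random_rowZ HA).
  by apply: (random_rowB HA) => //; exact: up.
apply: random_row_eproj; [exact: HA|exact: sp_Y0 H|exact: sp_Ycl H|exact: sp_Ycv H|].
apply: (random_rowD HA); first exact: up.
apply: (random_rowZ HA); apply: (random_rowD HA) => //; apply: (random_rowD HA).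
  by apply: (random_rowZ HA); exact: up.
exact: (random_rowZ HA).
Qed.

Lemma random_step t : (t < T)%N -> random_state (past (3 * t)) (fun w => rS w t) ->
  random_state (past (3 * t.+1)) (fun w => rS w t.+1).
Proof.
move=> tT rs; have [r1 rxy'] := random_step1 tT rs; have [r0 rh] := random_step0 tT rs.
have [[rxy rz rxi rn rv] re] := rs.
have jT : ((3 * t).+2 < 3 * T)%N.
  by apply: (@leq_trans (3 * t.+1)); rewrite ?leq_mul2l// mulnS addnC addn3.
have -> : (3 * t.+1 = (3 * t).+3)%N by rewrite mulnS addnC addn3.
have HA := past_sub FB jT.
have up m (g : O -> 'rV[R]_m) : random_row P (past (3 * t)) g -> random_row P (past (3 * t).+3) g.
  by apply: random_row_mono; apply: past_mono; exact: leqW (leqW (leqnSn _)).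
have up1 u : random_pair P (past (3 * t).+2) u -> random_pair P (past (3 * t).+3) u.
  by apply: random_pair_mono; exact: past_mono.
have r2 : random_pair P (past (3 * t).+3) (fun w => st_est (rS w t.+1)).
  have -> : (fun w => st_est (rS w t.+1)) = (fun w => vr_estimate (sgrad f) q Br b
      (om w) (3 * t).+2 (rXY w t.+1) (rH w t) (rE1 w t)).
    by apply/funext => w; rewrite -addn2.
  apply: (random_estimate jT rxy' (random_pair_mono (@past_mono _ _ (leqnSn _)) rh) r1).
  - by move=> w; rewrite -query0; exact: Qin.
  - by move=> w; rewrite -query1; exact: Qin.
have rxy1 := up1 _ _ _ rxy'; have rh1 : random_pair P (past (3 * t).+3) (fun w => rH w t).
  by apply: random_pair_mono rh; apply: past_mono; exact: leqW (leqnSn _).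
have rE1' := up1 _ _ _ r1.
have rn' : random_row P (past (3 * t).+3) (fun w => st_n (rS w t.+1)).
  have -> : (fun w => st_n (rS w t.+1)) = (fun w => (1 + k)^-1 *:
      (h^-1 *: (st_y (rS w t) - st_y (rS w t.+1)) + (rE1 w t).2
       + (al *: st_v (rS w t) + k *: (rE1 w t).2))).
    by apply/funext => w; rewrite run_S.
  apply: (random_rowZ HA); apply: (random_rowD HA).
    apply: (random_rowD HA); last by case: rE1'.
    apply: (random_rowZ HA); apply: (random_rowB HA); last by case: rxy1.
    by apply: up; case: rxy.
  apply: (random_rowD HA); apply: (random_rowZ HA); first exact: up.
  by case: rE1'.
split; last exact: r2.
split; [exact: rxy1| | |exact: rn'|].
- have -> : (fun w => st_z (rS w t.+1)) =
      (fun w => st_z (rS w t) + beta *: (st_x (rS w t.+1) - st_z (rS w t))).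
    by apply/funext => w; rewrite run_S.
  apply: (random_rowD HA); first exact: up.
  apply: (random_rowZ HA); apply: (random_rowB HA); last exact: up.
  by case: rxy1.
- have -> : (fun w => st_xi (rS w t.+1)) =
      (fun w => h^-1 *: (st_x (rS w t) - st_x (rS w t.+1)) - (rE1 w t).1
                - (2 * L) *: ((rH w t).1 - st_z (rS w t))).
    by apply/funext => w; rewrite run_S.
  apply: (random_rowB HA).
    apply: (random_rowB HA); last by case: rE1'.
    apply: (random_rowZ HA); apply: (random_rowB HA); last by case: rxy1.
    by apply: up; case: rxy.
  apply: (random_rowZ HA); apply: (random_rowB HA); last exact: up.
  by case: rh1.
- have -> : (fun w => st_v (rS w t.+1)) =
      (fun w => al *: st_v (rS w t) + k *: ((st_est (rS w t.+1)).2 - st_n (rS w t.+1))).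
    by apply/funext => w; rewrite run_S.
  apply: (random_rowD HA); first by apply: (random_rowZ HA); exact: up.
  apply: (random_rowZ HA); apply: (random_rowB HA); last exact: rn'.
  by case: r2.
Qed.

Lemma random_run t : (t <= T)%N -> random_state (past (3 * t)) (fun w => rS w t).
Proof.
elim: t => [_|t IH tT]; last by apply: random_step => //; apply: IH; exact: ltnW.
have HA := past_sub FB (leq0n (3 * T)).
rewrite muln0 /run/=; split; last exact: (random_pair_cst P HA 0).
split; try exact: random_row_cst.
exact: (random_pair_cst P HA (x0, y0)).
Qed.

Lemma random_query j : (j < 3 * T)%N -> random_pair P (past j) (fun w => rQ w j).
Proof.
rewrite (divn_eq j 3) mulnC; move: (j %/ 3)%N (ltn_pmod j (isT : 0 < 3)%N) => t.
case: (j %% 3)%N => [|[|[|//]]] _ jT; have tT : (t < T)%N.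
all: try by rewrite -(ltn_pmul2l (isT : 0 < 3)%N); apply: leq_ltn_trans jT; exact: leq_addr.
all: have rs := random_run (ltnW tT).
- rewrite addn0; under eq_fun do rewrite query0.
  by case: rs => -[].
- under eq_fun do rewrite query1; rewrite addn1.
  by case: (random_step0 tT rs).
- under eq_fun do rewrite query2; rewrite addn2.
  by case: (random_step1 tT rs).
Qed.

Lemma random_request j : (j < 3 * T)%N -> random_pair P (past j.+1) (fun w => rE w j).
Proof.
rewrite (divn_eq j 3) mulnC; move: (j %/ 3)%N (ltn_pmod j (isT : 0 < 3)%N) => t.
case: (j %% 3)%N => [|[|[|//]]] _ jT; have tT : (t < T)%N.
all: try by rewrite -(ltn_pmul2l (isT : 0 < 3)%N); apply: leq_ltn_trans jT; exact: leq_addr.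
all: have rs := random_run (ltnW tT).
- rewrite addn0; under eq_fun do rewrite estimate0.
  by case: (random_step0 tT rs).
- under eq_fun do rewrite estimate1; rewrite addn1.
  by case: (random_step1 tT rs).
- under eq_fun do rewrite estimate2; rewrite addn2.
  have [_] := random_run tT; have -> // : (3 * t.+1 = (3 * t).+3)%N by rewrite mulnS addnC addn3.
Qed.

Definition run_error j w : V := rE w j - G (rQ w j).
Definition run_move j w : V := rQ w j - rQ w j.-1.

Lemma before_random_gradient j : (j < 3 * T)%N ->
  random_pair P (before j 0) (fun w => G (rQ w j)).
Proof.
by move=> jT; apply: (past_random_gradient jT (random_query jT)) => w; exact: Qin.
Qed.

Lemma random_error j : (j < 3 * T)%N -> random_pair P (past j.+1) (run_error j).
Proof.
move=> jT; apply: (random_pairB (past_sub FB jT)); first exact: random_request.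
exact: random_pair_mono (before_past (leq0n (size j))) (before_random_gradient jT).
Qed.

Lemma random_prev_query j : (j < 3 * T)%N -> random_pair P (past j) (fun w => rQ w j.-1).
Proof.
move=> jT; have jT' : (j.-1 < 3 * T)%N by exact: leq_ltn_trans (leq_pred j) jT.
exact: random_pair_mono (@past_mono _ _ (leq_pred j)) (random_query jT').
Qed.

Lemma random_move j : (j < 3 * T)%N -> random_pair P (past j) (run_move j).
Proof.
move=> jT; apply: (random_pairB (past_sub FB (ltnW jT))); first exact: random_query.
exact: random_prev_query.
Qed.

(** The errors of the [Br] samples are centered one after the other, so the
    variance of their average is [sigma^2 / Br]. *)
Lemma refresh_error j : (j < 3 * T)%N -> (q %| j)%N ->
  (mean_sq P (run_error j) <= (sigma ^+ 2 / Br%:R)%:E)%E.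
Proof.
move=> jT qj; have sB : size j = Br by rewrite /batch_size qj.
have Br0' : (0 : R) < Br%:R by rewrite ltr0n.
pose e i w : V := sgrad f (rQ w j) (omega j i w) - G (rQ w j).
have -> : run_error j = (fun w => 0 + Br%:R^-1 *: \sum_(i < Br) e i w).
  apply/funext => w; rewrite /run_error estimateE /vr_estimate qj add0r sumrB scalerBr.
  congr (_ - _); rewrite big_const_ord iter_addr_0 -(scaler_nat Br (G (rQ w j))) scalerA.
  by rewrite mulVf ?gt_eqF// scale1r.
have rq := random_query jT; have qin w : (X `*` Y) (rQ w j) by exact: Qin.
have HF i : (i <= Br)%N -> is_sub_sigma_algebra (before j i).
  by move=> iB; apply: (before_sub FB jT); rewrite sB.
apply: le_trans (_ : (mean_sq P (fun=> 0%R : V) + (Br%:R^-1 ^+ 2 * Br%:R)%:E * (sigma ^+ 2)%:E <= _)%E).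
  have Bi0 : 0 <= Br%:R^-1 :> R by rewrite invr_ge0 ler0n.
  have s0 : (0 <= (sigma ^+ 2)%:E)%E by rewrite lee_fin sqr_ge0.
  apply: (batch_mean_sq Bi0 s0 HF (fun i i' ii => before_mono ii)
    (random_pair_cst P (HF 0%N isT) 0)) => i iB.
  have iS : (i < size j)%N by rewrite sB.
  have rqi := random_pair_mono (@past_before _ _ _ _ _ _ _ omega j i) rq.
  have rG := random_pair_mono (before_mono (leq0n i.+1)) (before_random_gradient jT).
  split.
  - exact: (random_pairB (HF _ iB) (past_random_sample jT iS rq qin) rG).
  - exact: (sample_centered H SO (HF i (ltnW iB)) (HF i.+1 iB) (before_mono (leqnSn i))
      (fresh FB jT iS) (@sample_known j i) rqi qin).
  - exact: (sample_variance SO (HF i (ltnW iB)) (fresh FB jT iS) rqi qin).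
have -> : mean_sq P (fun=> 0%R : V) = 0%E.
  by rewrite /mean_sq /dotp/= !dotv0l addr0 integral0.
rewrite add0e -EFinM lee_fin le_eqVlt; apply/orP; left; apply/eqP.
by field; rewrite gt_eqF.
Qed.

(** The error of a recursive estimate is the previous error plus an average of
    centered increments; the previous error is known before the batch. *)
Lemma update_error j : (j < 3 * T)%N -> ~~ (q %| j)%N ->
  (mean_sq P (run_error j) <= mean_sq P (run_error j.-1)
    + (ell ^+ 2 / b%:R)%:E * mean_sq P (run_move j))%E.
Proof.
move=> jT qj; have sb : size j = b by rewrite /batch_size (negbTE qj).
have j0 : (0 < j)%N by case: (j) qj => //; rewrite dvdn0.
have jT' : (j.-1 < 3 * T)%N by exact: leq_ltn_trans (leq_pred j) jT.
have b0' : (0 : R) < b%:R by rewrite ltr0n.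
pose e i w : V := (sgrad f (rQ w j) (omega j i w) - G (rQ w j))
  - (sgrad f (rQ w j.-1) (omega j i w) - G (rQ w j.-1)).
have -> : run_error j = (fun w => run_error j.-1 w + b%:R^-1 *: \sum_(i < b) e i w).
  apply/funext => w; rewrite /run_error estimateE /vr_estimate (negbTE qj).
  move: (estimate _ _ _ _ _ _ _ _ _ _ _ _ _ _ j.-1) => g.
  rewrite /e sum_centered_diff.
  rewrite scalerBr -(scaler_nat b (G (rQ w j) - _)) scalerA mulVf ?gt_eqF// scale1r opprB.
  by rewrite [in RHS]addrCA subrKA [in RHS]addrCA addrA.
have rq := random_query jT; have qin w : (X `*` Y) (rQ w j) by exact: Qin.
have rp := random_prev_query jT; have pin w : (X `*` Y) (rQ w j.-1) by exact: Qin.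
have HF i : (i <= b)%N -> is_sub_sigma_algebra (before j i).
  by move=> iB; apply: (before_sub FB jT); rewrite sb.
have -> : (ell ^+ 2 / b%:R)%:E = ((b%:R^-1 ^+ 2 * b%:R)%:E * (ell ^+ 2)%:E)%E.
  by rewrite -EFinM; congr EFin; field; rewrite gt_eqF.
have bi0 : 0 <= b%:R^-1 :> R by rewrite invr_ge0 ler0n.
have v0 : (0 <= (ell ^+ 2)%:E * mean_sq P (run_move j))%E.
  by rewrite mule_ge0 ?mean_sq_ge0// lee_fin sqr_ge0.
have rer : random_pair P (before j 0) (run_error j.-1).
  have := random_error jT'; rewrite prednK// => r.
  exact: random_pair_mono (@past_before _ _ _ _ _ _ _ omega j 0) r.
rewrite -muleA.
apply: (batch_mean_sq bi0 v0 HF (fun i i' ii => before_mono ii) rer) => i iB.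
have iS : (i < size j)%N by rewrite sb.
have rqi := random_pair_mono (@past_before _ _ _ _ _ _ _ omega j i) rq.
have rpi := random_pair_mono (@past_before _ _ _ _ _ _ _ omega j i) rp.
exact: (paired_increment H SO PO (HF i (ltnW iB)) (HF i.+1 iB) (before_mono (leqnSn i))
  (fresh FB jT iS) (@sample_known j i) rqi qin rpi pin).
Qed.

End RandomRun.

(** Between two refreshes the error accumulates at most [q] successive moves,
    so every move is counted at most [q] times. *)
Lemma spider_sum {R : realDomainType} (er mv : nat -> R) (a c : R) (q N : nat) :
  0 <= c -> (0 < q)%N -> (forall j, 0 <= mv j) ->
  (forall j, (j < N)%N -> (q %| j)%N -> er j <= a) ->
  (forall j, (j < N)%N -> ~~ (q %| j)%N -> er j <= er j.-1 + c * mv j) ->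
  \sum_(0 <= j < N) er j <= N%:R * a + c * q%:R * \sum_(0 <= j < N) mv j.
Proof.
move=> c0 q0 mv0 Hr Hu.
have main j : (j < N)%N -> er j <= a + c * \sum_(0 <= r < j %% q) mv (j - r)%N.
  elim: j => [|j IH] jN; first by rewrite mod0n big_geq// mulr0 addr0; exact: Hr.
  have [qj|qj] := boolP (q %| j.+1)%N.
    by apply: le_trans (Hr _ jN qj) _; rewrite lerDl mulr_ge0// sumr_ge0.
  have mS : (j.+1 %% q = (j %% q).+1)%N.
    rewrite modnS (negbTE qj)//.
  apply: le_trans (Hu _ jN qj) _; rewrite mS big_nat_recl//= subn0.
  under eq_bigr do rewrite subSS.
  have := IH (ltnW jN); move: (\sum_(0 <= r < j %% q) _) => S h; lra.
have shift r : \sum_(0 <= j < N) (if (r <= j)%N then mv (j - r)%N else 0) <=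
    \sum_(0 <= j < N) mv j.
  have [rN|rN] := leqP N r.
    rewrite big1_seq ?sumr_ge0// => j /andP[_]; rewrite mem_index_iota => /andP[_ jN].
    by rewrite leqNgt (leq_trans jN rN).
  rewrite (@big_cat_nat _ _ _ r)//=; last exact: ltnW.
  rewrite big1_seq ?add0r; last first.
    by move=> j /andP[_]; rewrite mem_index_iota => /andP[_ jr]; rewrite leqNgt jr.
  have -> : \sum_(r <= j < N) (if (r <= j)%N then mv (j - r)%N else 0) =
      \sum_(r <= j < N) mv (j - r)%N by apply: eq_big_nat => j /andP[-> _].
  rewrite -{1}(add0n r) big_addn.
  rewrite [leRHS](@big_cat_nat _ _ _ (N - r))//= ?leq_subr//.
  under eq_bigr do rewrite addnK.
  by rewrite lerDl sumr_ge0.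
have bound j : (j < N)%N -> er j <=
    a + c * \sum_(0 <= r < q) (if (r <= j)%N then mv (j - r)%N else 0).
  move=> jN; apply: le_trans (main j jN) _; rewrite lerD2l ler_wpM2l//.
  rewrite [leRHS](@big_cat_nat _ _ _ (j %% q))//=; last exact: ltnW (ltn_pmod _ _).
  have -> : \sum_(0 <= r < j %% q) mv (j - r)%N = \sum_(0 <= r < j %% q)
      (if (r <= j)%N then mv (j - r)%N else 0).
    apply: eq_big_nat => r /andP[_ rj].
    by rewrite (leq_trans (ltnW rj) (leq_mod _ _)).
  by rewrite lerDl sumr_ge0// => r _; case: ifP.
apply: le_trans (_ : \sum_(0 <= j < N)
   (a + c * \sum_(0 <= r < q) (if (r <= j)%N then mv (j - r)%N else 0)) <= _).
  by apply: ler_sum_nat => j /andP[_ jN]; exact: bound.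
rewrite big_split/= sumr_const_nat subn0 -(mulr_natl a N) lerD2l -mulr_sumr -mulrA.
rewrite ler_wpM2l// exchange_big/=.
apply: le_trans (_ : \sum_(0 <= r < q) \sum_(0 <= j < N) mv j <= _).
  by apply: ler_sum => r _; exact: shift.
by rewrite sumr_const_nat subn0 mulr_natl.
Qed.

(** * Expected residual of the output *)

(** Integrals of nonnegative functions are suprema over simple functions below,
    so they are monotone without any measurability. *)
Lemma ge0_integral_mono {R : realType} {d} {O : measurableType d}
    (P : probability O R) (f g : O -> \bar R) :
  (forall w, 0 <= f w)%E -> (forall w, f w <= g w)%E ->
  (\int[P]_w f w <= \int[P]_w g w)%E.
Proof.
move=> f0 fg; have g0 w : (0 <= g w)%E by exact: le_trans (fg w).
rewrite !ge0_integralTE//; apply: le_ereal_sup => _ [h hf <-].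
by exists h => // w; exact: le_trans (hf w) (fg w).
Qed.

Section FiniteSums.
Context {R : realType} {d} {O : measurableType d} (P : probability O R).

Lemma integral_real_sum (f : nat -> O -> R) N :
  (forall j w, 0 <= f j w) -> (forall j, (j < N)%N -> measurable_fun setT (f j)) ->
  measurable_fun setT (fun w => \sum_(0 <= j < N) f j w) /\
  (\int[P]_w (\sum_(0 <= j < N) f j w)%:E = \sum_(0 <= j < N) \int[P]_w (f j w)%:E)%E.
Proof.
move=> f0; elim: N => [|N IH] mf.
  under eq_fun do rewrite big_geq//; rewrite big_geq//; split => //.
  by under eq_integral do rewrite big_geq//; rewrite integral0.
have [mS iS] := IH (fun j jN => mf j (ltnW jN)).
have mN := mf N (ltnSn N).
under eq_fun do rewrite big_nat_recr//=.
split; first exact: measurable_funD.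
under eq_integral do rewrite big_nat_recr//=.
rewrite big_nat_recr//= -iS integral_realD// => w; exact: sumr_ge0.
Qed.

Definition mean_of (f : O -> R) : R := fine (\int[P]_w (f w)%:E)%E.

Definition nonneg_integrable (f : O -> R) :=
  [/\ forall w, 0 <= f w, measurable_fun setT f & (\int[P]_w (f w)%:E < +oo)%E].

Lemma nonneg_integrableD f g : nonneg_integrable f -> nonneg_integrable g ->
  nonneg_integrable (fun w => f w + g w).
Proof.
move=> [f0 mf jf] [g0 mg jg]; split; [by move=> w; exact: addr_ge0|exact: measurable_funD|].
by rewrite integral_realD//; exact: lte_add_pinfty.
Qed.

Lemma nonneg_integrableZ c f : 0 <= c -> nonneg_integrable f ->
  nonneg_integrable (fun w => c * f w).
Proof.
move=> c0 [f0 mf jf]; split; [by move=> w; exact: mulr_ge0|exact: measurable_funM|].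
by rewrite integral_realZ//; exact: lte_mul_pinfty.
Qed.

Lemma mean_ofE f : nonneg_integrable f -> (\int[P]_w (f w)%:E = (mean_of f)%:E)%E.
Proof.
move=> [f0 _ fi]; rewrite fineK// ge0_fin_numE//.
by apply: integral_ge0 => w _; rewrite lee_fin.
Qed.

Lemma mean_of_le_cst f c : nonneg_integrable f -> (\int[P]_w (f w)%:E <= c%:E)%E ->
  mean_of f <= c.
Proof. by move=> hf; rewrite mean_ofE// lee_fin. Qed.

Lemma mean_of_le_add f g m c : nonneg_integrable f -> nonneg_integrable g ->
  nonneg_integrable m ->
  (\int[P]_w (f w)%:E <= \int[P]_w (g w)%:E + c%:E * \int[P]_w (m w)%:E)%E ->
  mean_of f <= mean_of g + c * mean_of m.
Proof. by move=> hf hg hm; rewrite !mean_ofE// -EFinM -EFinD lee_fin. Qed.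

Lemma mean_of_ge0 f : (forall w, 0 <= f w) -> 0 <= mean_of f.
Proof. by move=> f0; apply: fine_ge0; apply: integral_ge0 => w _; rewrite lee_fin. Qed.

Lemma integral_sum_mean (f : nat -> O -> R) N :
  (forall j w, 0 <= f j w) -> (forall j, (j < N)%N -> nonneg_integrable (f j)) ->
  (\int[P]_w (\sum_(0 <= j < N) f j w)%:E = (\sum_(0 <= j < N) mean_of (f j))%:E)%E.
Proof.
move=> f0 fi; rewrite (integral_real_sum f0 (fun j jN => let: And3 _ m _ := fi j jN in m)).2.
rewrite -sumEFin; apply: eq_big_nat => j /andP[_ jN]; exact: mean_ofE (fi j jN).
Qed.

Lemma mean_sum_le (rb mv er : nat -> O -> R) (c0 c1 c2 c3 : R) T N :
  0 <= c0 -> 0 <= c1 -> 0 <= c2 -> 0 <= c3 ->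
  (forall j w, 0 <= rb j w) -> (forall j w, 0 <= mv j w) -> (forall j w, 0 <= er j w) ->
  (forall t, (t < T)%N -> nonneg_integrable (rb t)) ->
  (forall j, (j < N)%N -> nonneg_integrable (mv j)) ->
  (forall j, (j < N)%N -> nonneg_integrable (er j)) ->
  (forall w, c1 * (\sum_(0 <= t < T) rb t w) + c2 * (\sum_(0 <= j < N) mv j w)
     <= c0 + c3 * \sum_(0 <= j < N) er j w) ->
  c1 * (\sum_(0 <= t < T) mean_of (rb t)) + c2 * (\sum_(0 <= j < N) mean_of (mv j))
     <= c0 + c3 * \sum_(0 <= j < N) mean_of (er j).
Proof.
move=> c00 c10 c20 c30 rb0 mv0 er0 irb imv ier path.
have mS (f : nat -> O -> R) M : (forall j w, 0 <= f j w) ->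
    (forall j, (j < M)%N -> nonneg_integrable (f j)) ->
    measurable_fun setT (fun w => \sum_(0 <= j < M) f j w).
  by move=> f0 fi; apply: (integral_real_sum f0 (fun j jN => let: And3 _ m _ := fi j jN in m)).1.
have S0 (f : nat -> O -> R) M w : (forall j w, 0 <= f j w) -> 0 <= \sum_(0 <= j < M) f j w.
  by move=> f0; apply: sumr_ge0.
have m1 := mS _ _ rb0 irb; have m2 := mS _ _ mv0 imv; have m3 := mS _ _ er0 ier.
have s1 w := S0 rb T w rb0; have s2 w := S0 mv N w mv0; have s3 w := S0 er N w er0.
have cs (c : R) (f : O -> R) w : 0 <= c -> (forall w, 0 <= f w) -> 0 <= c * f w.
  by move=> h1 h2; exact: mulr_ge0.
have mc (c : R) (f : O -> R) : measurable_fun setT f -> measurable_fun setT (fun w => c * f w).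
  by move=> mf; exact: measurable_funM.
have : (\int[P]_w (c1 * (\sum_(0 <= t < T) rb t w) + c2 * (\sum_(0 <= j < N) mv j w))%:E
    <= \int[P]_w (c0 + c3 * \sum_(0 <= j < N) er j w)%:E)%E.
  apply: integral_real_le => //.
  - by move=> w; apply: addr_ge0; exact: mulr_ge0.
  - by apply: measurable_funD; exact: mc.
  - by apply: measurable_funD => //; exact: mc.
rewrite (integral_realD P (fun w => cs c1 _ w c10 s1) (fun w => cs c2 _ w c20 s2) (mc c1 _ m1) (mc c2 _ m2)).
rewrite (integral_realZ P c10 s1 m1) (integral_realZ P c20 s2 m2).
rewrite (integral_realD P (fun=> c00) (fun w => cs c3 _ w c30 s3) (@measurable_cst _ _ _ _ _ _) (mc c3 _ m3)).
rewrite (integral_realZ P c30 s3 m3) integral_cst//.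
rewrite [X in (c0%:E * X)%E](probability_setT P) mule1.
by rewrite !integral_sum_mean// -!EFinM -!EFinD lee_fin.
Qed.

End FiniteSums.

Lemma le_sum_select {R : numDomainType} (g : nat -> R) T (j : 'I_T) :
  (forall t, 0 <= g t) -> g j <= \sum_(0 <= t < T) g t * (nat_of_ord j == t)%:R.
Proof.
move=> g0; rewrite big_mkord (bigD1 j)//= eqxx mulr1 lerDl.
by apply: sumr_ge0 => i _; rewrite mulr_ge0.
Qed.

Section ExpectedResidual.
Context {R : realType} {n p : nat} {dW} {W : measurableType dW} (D : probability W R).
Context {d} {O : measurableType d} (P : probability O R).
Local Notation V := ('rV[R]_n * 'rV[R]_p)%type.
Context (X : set 'rV[R]_n) (Y : set 'rV[R]_p) (f : V -> W -> R) (L mu sigma ell th : R).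
Hypothesis sa : standing_assumptions D X Y f L.
Hypothesis sc : strong_concavity X Y (objective D f) L mu.
Hypothesis SO : stochastic_oracle D P X Y f sigma.
Hypothesis PO : paired_oracle D P X Y f L ell.
Hypotheses (th_gt0 : 0 < th) (thE : 128 * th ^+ 2 * L = mu).
Local Notation F := (objective D f).
Local Notation G := (grad (objective D f)).
Local Notation H := (standing_saddle_problem sa sc).
Context (T q Br b : nat) (x0 : 'rV[R]_n) (y0 : 'rV[R]_p).
Hypotheses (Xx0 : X x0) (Yy0 : Y y0).
Context (omega : nat -> nat -> O -> W).
Hypothesis FB : fresh_batches D P T q Br b omega.
Hypotheses (q0 : (0 < q)%N) (Br0 : (0 < Br)%N) (b0 : (0 < b)%N).
Local Notation past := (past_samples q Br b omega).
Local Notation om w := (fun j i => omega j i w).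
Local Notation beta := (th / (192 * 256)).
Local Notation rb t w := (residual_bound X Y G L th (sgrad f) q Br b x0 y0 (om w) t).
Local Notation mv j w := (request_move X Y L th (sgrad f) q Br b x0 y0 (om w) j).
Local Notation er j w := (request_error X Y G L th (sgrad f) q Br b x0 y0 (om w) j).
Let Qin o j := query_in (sgrad f) q Br b H th_gt0 thE Xx0 Yy0 o j.

Lemma initial_quantity_ge0 : 0 <= initial_quantity X Y F L x0 y0.
Proof.
have D0 := sa_radius_gt0 sa; have L0 := sa_L_gt0 sa.
have h : primal_inf X Y F <= primal Y F x0.
  by apply: ge_inf; [exact: sa_bounded_below sa|exists x0].
rewrite /initial_quantity; apply: addr_ge0; last first.
  by rewrite mulr_ge0 ?sqr_ge0// mulr_ge0 ?(ltW L0)// addr_ge0.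
apply: addr_ge0; last first.
  by rewrite divr_ge0 ?(ltW L0)// addr_ge0 ?sqr_ge0// mulr_ge0 ?sqr_ge0.
by rewrite addr_ge0 ?subr_ge0// mulr_ge0 ?enorm_ge0// mulr_ge0// ltW.
Qed.

(** [primal_inf] is only approached by values of [F]; the error is arbitrarily
    small. *)
Lemma path_bound w :
  beta / 16 * (\sum_(0 <= t < T) rb t w) + beta * L ^+ 2 * (\sum_(0 <= j < 3 * T) mv j w)
  <= L * initial_quantity X Y F L x0 y0 + beta^-1 * \sum_(0 <= j < 3 * T) er j w.
Proof.
have L0 := sa_L_gt0 sa.
apply/ler_addgt0Pr => e e0.
have e'0 : 0 < e / L by rewrite divr_gt0.
have := descent_bound (sgrad f) q Br b H th_gt0 thE Xx0 Yy0 (om w) T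
  (primal_inf_approx sa sc e'0).
have := initial_potential sa sc th_gt0 thE Xx0 Yy0 (saddle_ofP H x0).
rewrite -mulr_sumr.
have -> : L * (primal_inf X Y F - e / L) = L * primal_inf X Y F - e.
  by field; rewrite gt_eqF.
move: (initial_quantity _ _ _ _ _ _) (\sum_(0 <= t < T) _) (\sum_(0 <= j < 3 * T) mv j w)
  (\sum_(0 <= j < 3 * T) er j w) => B S1 S2 S3.
rewrite /run_potential /run_xy /=.
move: (potential _ _ _ _ _ _ _ _ _ _) => pot; lra.
Qed.

Lemma rb_ge0 t w : 0 <= rb t w.
Proof.
rewrite /residual_bound; apply: addr_ge0; last exact: dotv_ge0.
apply: addr_ge0; first by rewrite mulr_ge0 ?dotv_ge0.
by rewrite mulr_ge0 ?dotv_ge0// mulr_ge0 ?sqr_ge0.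
Qed.

Lemma mv_ge0 j w : 0 <= mv j w.
Proof. exact: dotp_ge0. Qed.

Lemma er_ge0 j w : 0 <= er j w.
Proof. exact: dotp_ge0. Qed.

Lemma rb_known t : (t < T)%N ->
  measurable_wrt (past (3 * T)) (fun w => rb t w) /\ nonneg_integrable P (fun w => rb t w).
Proof.
move=> tT; have HA := past_sub FB (leqnn (3 * T)).
have up j m (g : O -> 'rV[R]_m) : (j <= 3 * T)%N -> random_row P (past j) g ->
    random_row P (past (3 * T)) g.
  by move=> jT; apply: random_row_mono; exact: past_mono.
have [[_ rz _ _ _] _] := random_run H SO FB Qin (ltnW tT).
have [[[rx _] _ rxi rn _] _] := random_run H SO FB Qin tT.
have tT' : (3 * t <= 3 * T)%N by rewrite leq_mul2l ltnW.
have tT1 : (3 * t.+1 <= 3 * T)%N by rewrite leq_mul2l.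
have jT : (3 * t + 2 < 3 * T)%N.
  by apply: leq_trans tT1; rewrite mulnS addnC ltn_add2r.
have rG : random_pair P (past (3 * T)) (fun w => G (run_xy X Y (sgrad f) L (192 * L)^-1
    (1 + th / 192)^-1 ((1 / 2 - th) / 192 / (1 + th / 192)) beta q Br b x0 y0 (om w) t.+1)).
  have := before_random_gradient H SO FB Br0 b0 Qin jT.
  under eq_fun do rewrite query2.
  apply: random_pair_mono => E bE; apply: (past_mono jT).
  exact: (before_past (leq0n _) bE).
have {}rx := up _ _ _ tT1 rx; have {}rxi := up _ _ _ tT1 rxi.
have {}rn := up _ _ _ tT1 rn; have {}rz := up _ _ _ tT' rz.
have rd := random_rowB HA rx rz.
have ra := random_rowD HA (random_rowD HA rG.1 (random_rowZ HA (2 * L) rd)) rxi.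
have rb' := random_rowB HA rG.2 rn.
have mrow m (g : O -> 'rV[R]_m) : random_row P (past (3 * T)) g ->
    measurable_wrt (past (3 * T)) (fun w => dotv (g w) (g w)).
  by move=> rg; apply: measurable_dotv => // k; case: (rg k).
have irow m (g : O -> 'rV[R]_m) : random_row P (past (3 * T)) g ->
    nonneg_integrable P (fun w => dotv (g w) (g w)).
  move=> rg; split; [by move=> w; exact: dotv_ge0| |exact: (integral_dotv_lty rg)].
  exact: (measurable_wrt_fun HA (mrow _ _ rg)).
split.
  apply/(measurable_wrtP HA); apply: measurable_funD; last first.
    exact: (measurable_wrtP HA _).1 (mrow _ _ rb').
  apply: measurable_funD; apply: measurable_funM => //.
    exact: (measurable_wrtP HA _).1 (mrow _ _ ra).
  exact: (measurable_wrtP HA _).1 (mrow _ _ rd).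
apply: (nonneg_integrableD (nonneg_integrableD (nonneg_integrableZ _ (irow _ _ ra))
  (nonneg_integrableZ _ (irow _ _ rd))) (irow _ _ rb')) => //.
by rewrite mulr_ge0 ?sqr_ge0.
Qed.

Lemma rb_integrable t : (t < T)%N -> nonneg_integrable P (fun w => rb t w).
Proof. by case/rb_known. Qed.

Lemma mv_integrable j : (j < 3 * T)%N -> nonneg_integrable P (fun w => mv j w).
Proof.
move=> jT; have rm := random_move H SO FB Qin jT.
have HA := past_sub FB (ltnW jT).
by split; [move=> w; exact: mv_ge0|exact: (measurable_dotp_fun HA rm)|exact: (mean_sq_lty HA rm)].
Qed.

Lemma er_integrable j : (j < 3 * T)%N -> nonneg_integrable P (fun w => er j w).
Proof.
move=> jT; have rm := random_error H SO FB Br0 b0 Qin jT.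
have HA := past_sub FB jT.
by split; [move=> w; exact: er_ge0|exact: (measurable_dotp_fun HA rm)|exact: (mean_sq_lty HA rm)].
Qed.

Lemma mean_er_sum :
  \sum_(0 <= j < 3 * T) mean_of P (fun w => er j w) <=
  (3 * T)%:R * (sigma ^+ 2 / Br%:R)
  + ell ^+ 2 / b%:R * q%:R * \sum_(0 <= j < 3 * T) mean_of P (fun w => mv j w).
Proof.
apply: spider_sum => //.
- by rewrite divr_ge0 ?sqr_ge0.
- by move=> j; apply: mean_of_ge0 => w; exact: mv_ge0.
- move=> j jT qj.
  exact: (mean_of_le_cst (er_integrable jT) (refresh_error H SO FB Br0 b0 Qin jT qj)).
- move=> j jT qj; have jT' : (j.-1 < 3 * T)%N by exact: leq_ltn_trans (leq_pred j) jT.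
  exact: (mean_of_le_add (er_integrable jT) (er_integrable jT') (mv_integrable jT)
    (update_error H SO PO FB Br0 b0 Qin jT qj)).
Qed.

(** When the batches are large enough, the error caused by the moves of the
    query points is absorbed by the decrease that the same moves provide. *)
Lemma mean_rb_sum : ell ^+ 2 * q%:R <= beta ^+ 2 * L ^+ 2 * b%:R ->
  beta / 16 * (\sum_(0 <= t < T) mean_of P (fun w => rb t w)) <=
  L * initial_quantity X Y F L x0 y0 + beta^-1 * ((3 * T)%:R * (sigma ^+ 2 / Br%:R)).
Proof.
move=> qb; have be0 : 0 < beta.
  by apply: divr_gt0; [exact: th_gt0|apply: mulr_gt0; rewrite ltr0n].
have L0 := sa_L_gt0 sa.
have be16 : 0 <= beta / 16 by apply: divr_ge0; [exact: ltW|rewrite ler0n].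
have beL : 0 <= beta * L ^+ 2 by apply: mulr_ge0; [exact: ltW|exact: sqr_ge0].
have bei : 0 <= beta^-1 by rewrite invr_ge0; exact: ltW.
have := mean_sum_le (P := P) (mulr_ge0 (ltW L0) initial_quantity_ge0) be16 beL bei
  rb_ge0 mv_ge0 er_ge0 rb_integrable mv_integrable er_integrable path_bound.
have := ler_wpM2l bei mean_er_sum.
move: (\sum_(0 <= t < T) _) => S1.
have S0 : 0 <= \sum_(0 <= j < 3 * T) mean_of P (fun w => mv j w).
  by apply: sumr_ge0 => j _; apply: mean_of_ge0 => w; exact: mv_ge0.
move: (\sum_(0 <= j < 3 * T) mean_of P (fun w => mv j w)) S0 => S2 S20.
move: (\sum_(0 <= j < 3 * T) _) => S3.
move: (initial_quantity _ _ _ _ _ _) ((3 * T)%:R * _) => B v.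
have : beta^-1 * (ell ^+ 2 / b%:R * q%:R * S2) <= beta * L ^+ 2 * S2.
  rewrite mulrA ler_wpM2r// ler_pdivrMl// mulrAC ler_pdivrMr ?ltr0n//.
  by apply: le_trans qb _; rewrite le_eqVlt; apply/orP; left; apply/eqP; ring.
lra.
Qed.
Variable J : O -> 'I_T.
Hypothesis UI : uniform_index P q Br b omega J.

Let hit t w : R := (nat_of_ord (J w) == t)%:R.

Lemma hit_indic t (tT : (t < T)%N) : hit t = \1_(J @^-1` [set Ordinal tT]).

Proof.
apply/funext => w; rewrite /hit indicE; congr (_%:R); congr nat_of_bool.
apply/eqP/idP => [Jt|]; first by rewrite inE; exact/val_inj.
by rewrite inE => ->.
Qed.

Lemma measurable_hit t : (t < T)%N -> measurable_fun setT (hit t).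
Proof.
by move=> tT; rewrite hit_indic; apply: measurable_indic; exact: ui_measurable UI _.
Qed.

(** The index being independent of the run, it selects each step with the
    same weight. *)
Lemma mean_hit t : (t < T)%N ->
  (\int[P]_w (rb t w * hit t w)%:E = (T%:R^-1 * mean_of P (fun w => rb t w))%:E)%E.
Proof.
move=> tT; have HA := past_sub FB (leqnn (3 * T)).
have [mrb irb] := rb_known tT; have Ti : 0 <= T%:R^-1 :> R by rewrite invr_ge0.
have hit0 w : 0 <= hit t w by rewrite /hit.
have hitE E : past (3 * T) E ->
    (\int[P]_(w in E) (hit t w)%:E = \int[P]_(w in E) (T%:R^-1)%:E)%E.
  move=> AE; have mE := HA.2 _ AE.
  have mJ := ui_measurable UI (Ordinal tT).
  have -> : (\int[P]_(w in E) (hit t w)%:E)%E = P (E `&` J @^-1` [set Ordinal tT]).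
    by rewrite setIC -integral_indic//; apply: eq_integral => w _; rewrite hit_indic.
  by rewrite (ui_indep UI _ AE) (ui_law UI) integral_cst// muleC.
rewrite (integral_mul_sub HA hit0 (fun=> Ti) (rb_ge0 t) (measurable_hit tT)
  (@measurable_cst _ _ _ _ _ _) mrb hitE).
under eq_integral do rewrite mulrC.
have [r0 mr _] := irb.
by rewrite (integral_realZ P Ti r0 mr) (mean_ofE irb) EFinM.
Qed.

(** The residual at the output is at most the bound of the step [J]; it may fail
    to be measurable, which [ge0_integral_mono] tolerates. *)
Lemma output_residual (h al k be : R) (out : O -> @state R n p) :
  h = (192 * L)^-1 -> al = (1 + th / 192)^-1 ->
  k = (1 / 2 - th) / 192 / (1 + th / 192) -> be = beta ->
  (forall w, out w = vr_spde X Y (sgrad f) L h al k be q Br b (om w) x0 y0 (J w).+1) ->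
  ('E_P[fun w => residual_sq X Y F (st_x (out w)) (st_y (out w))]
   <= (T%:R^-1 * \sum_(0 <= t < T) mean_of P (fun w => rb t w))%:E)%E.
Proof.
move=> -> -> -> -> outE; rewrite unlock.
have hit0 t w : 0 <= rb t w * hit t w by rewrite mulr_ge0 ?rb_ge0// /hit.
apply: (@le_trans _ _ (\int[P]_w (\sum_(0 <= t < T) rb t w * hit t w)%:E)%E).
  apply: ge0_integral_mono => w; first by rewrite lee_fin addr_ge0// sqr_ge0.
  rewrite lee_fin outE.
  have [nx ny] := run_normal (sgrad f) q Br b H th_gt0 thE Xx0 Yy0 (om w) (J w).+1.
  have := residual_le D f L (st_z (run X Y (sgrad f) L (192 * L)^-1 (1 + th / 192)^-1
    ((1 / 2 - th) / 192 / (1 + th / 192)) beta q Br b x0 y0 (om w) (J w))) nx ny.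
  move/le_trans; apply.
  exact: (le_sum_select (g := fun t => rb t w) (J w) (fun t => rb_ge0 t w)).
have mr t : (t < T)%N -> measurable_fun setT (fun w => rb t w * hit t w).
  move=> tT; have [_ [_ mr _]] := rb_known tT.
  by apply: measurable_funM => //; exact: measurable_hit.
rewrite (integral_real_sum P hit0 mr).2 mulr_sumr -sumEFin le_eqVlt.
by apply/orP; left; apply/eqP/eq_big_nat => t /andP[_ tT]; exact: mean_hit.
Qed.

End ExpectedResidual.

(** * Step sizes, batch sizes and oracle calls *)

Section StepSizes.
Context {R : realType}.
Implicit Types L mu ell sigma eps : R.

(** The step-size analysis is in terms of the dimensionless [th = s / (16 L)]. *)
Definition th_sc L mu : R := s_sc L mu / (16 * L).

Lemma th_sc_gt0 L mu : 0 < L -> 0 < mu -> 0 < th_sc L mu.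
Proof. by move=> L0 m0; rewrite divr_gt0 ?mulr_gt0// sqrtr_gt0 !mulr_gt0. Qed.

Lemma sqr_s_sc L mu : 0 < L -> 0 < mu -> s_sc L mu ^+ 2 = 2 * L * mu.
Proof. by move=> L0 m0; rewrite sqr_sqrtr// ltW// !mulr_gt0. Qed.

Lemma th_scE L mu : 0 < L -> 0 < mu -> 128 * th_sc L mu ^+ 2 * L = mu.
Proof.
move=> L0 m0; rewrite /th_sc expr_div_n sqr_s_sc//; field.
by rewrite gt_eqF.
Qed.

Lemma h_scE L : h_sc L = (192 * L)^-1.
Proof. by rewrite /h_sc div1r. Qed.

Lemma alpha_scE L mu : 0 < L -> alpha_sc L mu = (1 + th_sc L mu / 192)^-1.
Proof.
move=> L0; rewrite /alpha_sc /h_sc /th_sc; congr (_^-1); congr (1 + _).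
by field; rewrite gt_eqF.
Qed.

Lemma k_scE L mu : 0 < L -> 0 < mu ->
  k_sc L mu = (1 / 2 - th_sc L mu) / 192 / (1 + th_sc L mu / 192).
Proof.
move=> L0 m0; have s0 : 0 < s_sc L mu by rewrite sqrtr_gt0 !mulr_gt0.
rewrite /k_sc /h_sc /th_sc; move: (s_sc L mu) s0 => s s0.
have d1 : 16 * L * 192 + s != 0.
  apply: lt0r_neq0; apply: addr_gt0; last exact: s0.
  by apply: mulr_gt0; [apply: mulr_gt0; [rewrite ltr0n|exact: L0]|rewrite ltr0n].
by field; rewrite d1 gt_eqF.
Qed.

Lemma beta_scE L mu : 0 < L -> beta_sc L mu = th_sc L mu / (192 * 256).
Proof.
move=> L0; rewrite /beta_sc /h_sc /th_sc.
have -> : 4096 = 16 * 256 :> R by ring.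
have : (192 : R) != 0 by rewrite pnatr_eq0.
have : (256 : R) != 0 by rewrite pnatr_eq0.
have : (16 : R) != 0 by rewrite pnatr_eq0.
have : L != 0 by rewrite gt_eqF.
move: (s_sc L mu) (192 : R) (256 : R) (16 : R) => s a b c c0 b0 a0 L1.
by field; rewrite a0 b0 c0 L1.
Qed.

Lemma beta_sc_gt0 L mu : 0 < L -> 0 < mu -> 0 < beta_sc L mu.
Proof.
move=> L0 m0; rewrite (beta_scE mu L0); apply: divr_gt0; first exact: th_sc_gt0.
by apply: mulr_gt0; rewrite ltr0n.
Qed.

(** [beta^2 = mu / (kbeta L)], i.e. [beta] is proportional to the inverse
    square root of the condition number. *)
Definition kbeta : R := 128 * (192 * 256) ^+ 2.

Lemma kbeta_gt0 : 0 < kbeta.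
Proof.
apply: mulr_gt0; first by rewrite ltr0n.
by apply: exprn_gt0; apply: mulr_gt0; rewrite ltr0n.
Qed.

Lemma kbeta_ge1 : 1 <= kbeta.
Proof. by rewrite /kbeta; lra. Qed.

Lemma sqr_beta_sc L mu : 0 < L -> 0 < mu -> beta_sc L mu ^+ 2 * kbeta * (L / mu) = 1.
Proof.
move=> L0 m0; rewrite (beta_scE mu L0) /kbeta; have := th_scE L0 m0.
have : (192 * 256 : R) != 0 by apply: mulf_neq0; rewrite pnatr_eq0.
move: (th_sc L mu) (192 * 256 : R) => t c c0 tE.
have -> : (t / c) ^+ 2 * (128 * c ^+ 2) * (L / mu) = 128 * t ^+ 2 * L / mu.
  by field; rewrite c0 gt_eqF.
by rewrite tE divff// gt_eqF.
Qed.

Lemma absz_ceil_ge (x : R) : x <= `|Num.ceil x|%N%:R.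
Proof. by rewrite natr_absz (le_trans (ceil_ge x))// ler_int ler_norm. Qed.

Lemma absz_ceil_le (x : R) : 0 <= x -> `|Num.ceil x|%N%:R <= x + 1.
Proof.
move=> x0; have c0 : 0 <= Num.ceil x by rewrite ceil_ge0 (lt_le_trans _ x0)// ltrN10.
by rewrite natr_absz ger0_norm// -lerBlDr -[1]/(1%:~R) -intrB ltW// ceilB1_lt.
Qed.

Lemma absz_floor_itv (x : R) : 0 <= x ->
  `|Num.floor x|%N%:R <= x < `|Num.floor x|%N%:R + 1.
Proof.
move=> x0; have c0 : 0 <= Num.floor x by rewrite floor_ge0.
by rewrite natr_absz ger0_norm// -[1]/(1%:~R) -intrD floor_itv.
Qed.

Lemma natr_maxn1 k : (maxn 1 k)%:R = Num.max 1 k%:R :> R.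
Proof. by rewrite natr_max. Qed.

End StepSizes.

Lemma count_multiples q N : (0 < q)%N -> (\sum_(j < N.+1) (q %| j))%N = (N %/ q).+1.
Proof.
move=> q0; elim: N => [|N IH]; first by rewrite big_ord_recl big_ord0 dvdn0 div0n.
by rewrite big_ord_recr/= IH divnS// addSn addnC.
Qed.

Section Accuracy.
Context {R : realType}.

(** The initial potential contributes [16 LB / (be T)] to the average, at most
    [eps^2 / 16] by the choice of [T], and the noise [48 v / (be^2 Br)], far less
    than [eps^2] by the choice of [Br]. *)
Lemma accuracy_arith (S be eps LB T Br v : R) : 0 < be -> 0 < T -> 0 < Br ->
  256 * LB <= T * be * eps ^+ 2 ->
  1536 * C_star * v <= Br * be ^+ 2 * eps ^+ 2 ->
  be / 16 * S <= LB + be^-1 * (3 * T * (v / Br)) ->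
  T^-1 * S <= eps ^+ 2.
Proof.
move=> be0 T0 Br0 hT hBr hS; rewrite ler_pdivrMl//.
have h1 : be^-1 * (3 * T * (v / Br)) * (1536 * C_star) <= 3 * (T * be * eps ^+ 2).
  have -> : be^-1 * (3 * T * (v / Br)) * (1536 * C_star) =
    3 * T * (be^-1 * (Br^-1 * (1536 * C_star * v))) by ring.
  have -> : 3 * (T * be * eps ^+ 2) = 3 * T * (be^-1 * (Br^-1 * (Br * be ^+ 2 * eps ^+ 2))).
    by field; rewrite !gt_eqF.
  apply: ler_wpM2l; first by rewrite mulr_ge0// ltW.
  apply: ler_wpM2l; first by rewrite invr_ge0 ltW.
  by apply: ler_wpM2l => //; rewrite invr_ge0 ltW.
have e0 : 0 <= T * be * eps ^+ 2 by rewrite mulr_ge0 ?sqr_ge0// mulr_ge0 ?ltW.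
rewrite -(ler_pM2l be0) (_ : be * (T * eps ^+ 2) = T * be * eps ^+ 2); last by ring.
move: h1 e0 hS hT; rewrite /C_star.
have -> : be / 16 * S = be * S / 16 by ring.
move: (be^-1 * _) (T * be * _) (be * S) => x y z; lra.
Qed.

End Accuracy.

Section SfoCount.
Context {R : realType}.

Lemma sfo_total_le q Br b c T : (0 < q)%N -> sfo_costs q Br b c ->
  (sfo_total T c)%:R <= Br%:R * (1 + (3 * T)%:R / q%:R) + (3 * T)%:R * (2 * b%:R) :> R.
Proof.
move=> q0 hc; have q0' : (0 : R) < q%:R by rewrite ltr0n.
have h1 : (sfo_total T c <= Br * (\sum_(j < 3 * T) (q %| j)) + 3 * T * (2 * b))%N.
  rewrite /sfo_total big_distrr/=.
  apply: leq_trans (_ : \sum_(j < 3 * T) (Br * (q %| j) + 2 * b) <= _)%N.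
    apply: leq_sum => j _; have := hc j; case: ifP => _ h; first by rewrite h muln1 leq_addr.
    by rewrite muln0.
  by rewrite big_split/= sum_nat_const card_ord.
have h2 : (q * (\sum_(j < 3 * T) (q %| j)) <= q + 3 * T)%N.
  case: (3 * T)%N => [|N]; first by rewrite big_ord0 muln0.
  by rewrite count_multiples// mulnS leq_add2l mulnC (leq_trans (leq_trunc_div _ _)).
move: h1 h2; move: (\sum_(j < 3 * T) (q %| j))%N => M; move: (3 * T)%N => N h1 h2.
have h2' : M%:R <= 1 + N%:R / q%:R :> R.
  rewrite -(ler_pM2l q0') mulrDr mulr1 mulrCA divff ?gt_eqF// mulr1.
  by rewrite -natrM -natrD ler_nat.
apply: le_trans (_ : (Br * M + N * (2 * b))%:R <= _); first by rewrite ler_nat.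
by rewrite natrD !natrM lerD2r ler_wpM2l.
Qed.

(** If [q = 1], every request is a refresh. *)
Lemma sfo_total_refresh Br b c T : sfo_costs 1 Br b c -> sfo_total T c = (3 * T * Br)%N.
Proof.
move=> hc; rewrite /sfo_total (eq_bigr (fun=> Br)) => [|j _]; last first.
  by have := hc j; rewrite dvd1n.
by rewrite sum_nat_const card_ord.
Qed.

(** The batch sizes and the refresh period balance the two kinds of cost: both
    are of the order of [sqrt (A Br)] per request. *)
Lemma sfo_total_bound (A : R) q Br b c T : 1 <= A -> (1 <= Br)%N -> (1 <= q)%N ->
  sfo_costs q Br b c ->
  ((1 < q)%N -> A * q%:R <= Num.sqrt (A * Br%:R)) ->
  Num.sqrt (A * Br%:R) <= 2 * A * q%:R -> b%:R <= A * q%:R + 1 ->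
  (sfo_total T c)%:R <= Br%:R + 18 * T%:R * Num.min Br%:R (Num.sqrt (A * Br%:R)).
Proof.
move=> A1 Br1 q1 hc hq1 hq2 hb.
have A0 : 0 < A by lra.
have B1 : 1 <= Br%:R :> R by rewrite ler1n.
have AB0 : 0 <= A * Br%:R by rewrite mulr_ge0// ltW.
have T0 : 0 <= T%:R :> R by [].
have := sqr_sqrtr AB0; have := sqrtr_ge0 (A * Br%:R).
move: (Num.sqrt (A * Br%:R)) hq1 hq2 => S hq1 hq2 S0 SS.
have [q1'|q2] := leqP q 1.
  have qE : q = 1%N by apply/eqP; rewrite eqn_leq q1' q1.
  rewrite qE in hc hq2; rewrite (sfo_total_refresh T hc) !natrM.
  have BS : Br%:R <= 2 * S.
    by rewrite -(ler_pM2l A0) -SS; nra.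
  have hm : Br%:R / 2 <= Num.min Br%:R S by rewrite le_min; apply/andP; split; lra.
  have := ler_wpM2l T0 hm; move: (Num.min _ _) => m h; nra.
have q0 : (0 < q)%N by exact: ltnW.
have qr : 2 <= q%:R :> R by rewrite ler_nat.
have {}hq1 := hq1 q2.
have BS : 2 * S <= Br%:R.
  by rewrite -(ler_pM2l A0) -SS; nra.
have S1 : 1 <= S by nra.
have -> : Num.min Br%:R S = S by apply: min_r; lra.
apply: le_trans (sfo_total_le T q0 hc) _; rewrite natrM mulrDr mulr1 -addrA lerD2l.
have h1 : Br%:R / q%:R <= 2 * S.
  rewrite ler_pdivrMr; last lra.
  by rewrite -(ler_pM2l A0) -SS; nra.
have h1T := ler_wpM2l T0 h1.
have hbT : T%:R * b%:R <= T%:R * (2 * S) by apply: ler_wpM2l => //; lra.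
have -> : Br%:R * (3 * T%:R / q%:R) = 3 * (T%:R * (Br%:R / q%:R)) :> R by ring.
lra.
Qed.

End SfoCount.

Section Sizes.
Context {R : realType}.
Variables (L mu ell sigma eps Bbar : R).
Hypotheses (L0 : 0 < L) (mu0 : 0 < mu) (muL : mu <= L) (ellL : L <= ell) (eps0 : 0 < eps).
Local Notation be := (beta_sc L mu).
Local Notation A := (A_vrsc L mu ell).
Local Notation Br := (Br_sc L mu sigma eps).
Local Notation T := (T_sc L mu Bbar eps).
Local Notation q := (q_sc L mu ell sigma eps).
Local Notation b := (b_sc L mu ell sigma eps).
Local Notation kappa := (L / mu).

Let be0 : 0 < be. Proof. exact: beta_sc_gt0. Qed.

Lemma kappa_ge1 : 1 <= kappa.
Proof. by rewrite ler_pdivlMr// mul1r. Qed.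

Lemma inv_sqr_beta : be ^- 2 = kbeta * kappa.
Proof.
have h := sqr_beta_sc L0 mu0; have b2 : be ^+ 2 != 0 by rewrite expf_neq0// gt_eqF.
by apply: (mulfI b2); rewrite [LHS]mulfV// -h -mulrA.
Qed.

Lemma A_vrscE : A = 16 * C_star * (ell / L) ^+ 2 * (kbeta * kappa).
Proof. by rewrite /A_vrsc inv_sqr_beta. Qed.

Lemma A_vrsc_ge : 2 * (ell / L) ^+ 2 <= A.
Proof.
rewrite A_vrscE mulrAC ler_wpM2r ?sqr_ge0//.
have := mulr_ege1 (@kbeta_ge1 R) kappa_ge1.
by rewrite /C_star; move: (kbeta * kappa) => a a1; lra.
Qed.

Lemma A_vrsc_ge2 : 2 <= A.
Proof.
apply: le_trans A_vrsc_ge; rewrite -[leLHS]mulr1 ler_pM2l//.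
by rewrite exprn_ege1// ler_pdivlMr// mul1r.
Qed.

Let A1 : 1 <= A.
Proof. by apply: le_trans A_vrsc_ge2; rewrite ler1n. Qed.

Let A0 : 0 < A. Proof. exact: lt_le_trans A1. Qed.

Lemma T_sc_gt0 : (0 < T)%N.
Proof. by rewrite /T_sc leq_max. Qed.

Lemma Br_sc_gt0 : (0 < Br)%N.
Proof. by rewrite /Br_sc leq_max. Qed.

Lemma q_sc_gt0 : (0 < q)%N.
Proof. by rewrite /q_sc leq_max. Qed.

Lemma T_sc_ge : 256 * (L * Bbar) <= T%:R * be * eps ^+ 2.
Proof.
have h : 256 * L * Bbar / (be * eps ^+ 2) <= T%:R.
  by rewrite /T_sc natr_maxn1 le_max absz_ceil_ge orbT.
have d0 : 0 < be * eps ^+ 2 by apply: mulr_gt0; [exact: be0|exact: exprn_gt0].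
by move: h; rewrite (ler_pdivrMr _ _ d0) [_ * (be * _)]mulrA -[_ * L * _]mulrA.
Qed.

Lemma Br_sc_ge : 1536 * C_star * sigma ^+ 2 <= Br%:R * be ^+ 2 * eps ^+ 2.
Proof.
have h : 1536 * C_star * sigma ^+ 2 / (be ^+ 2 * eps ^+ 2) <= Br%:R.
  by rewrite /Br_sc natr_maxn1 le_max absz_ceil_ge orbT.
have d0 : 0 < be ^+ 2 * eps ^+ 2 by apply: mulr_gt0; exact: exprn_gt0.
by move: h; rewrite (ler_pdivrMr _ _ d0) [leRHS]mulrA.
Qed.

Lemma sqrt_ratio : Num.sqrt (A * Br%:R) = A * Num.sqrt (Br%:R / A).
Proof.
rewrite -{2}(gtr0_norm A0) -sqrtr_sqr -sqrtrM ?sqr_ge0//; congr Num.sqrt.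
by field; rewrite gt_eqF.
Qed.

Lemma q_sc_le : q%:R <= Num.max 1 (Num.sqrt (Br%:R / A)).
Proof.
rewrite /q_sc natr_maxn1; have /andP[h _] := absz_floor_itv (sqrtr_ge0 (Br%:R / A)).
by rewrite ge_max !le_max lexx h orbT.
Qed.

(** Rounding down to an integer at least one loses at most a factor two. *)
Lemma q_sc_sqrt_le : Num.sqrt (Br%:R / A) <= 2 * q%:R.
Proof.
have /andP[_ h] := absz_floor_itv (sqrtr_ge0 (Br%:R / A)).
have h1 : `|Num.floor (Num.sqrt (Br%:R / A))|%N%:R <= q%:R :> R.
  by rewrite ler_nat /q_sc leq_max leqnn orbT.
have h2 : 1 <= q%:R :> R by rewrite ler1n q_sc_gt0.
lra.
Qed.

Lemma q_sc_balanced : (1 < q)%N -> A * q%:R <= Num.sqrt (A * Br%:R).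
Proof.
move=> q1; rewrite sqrt_ratio ler_pM2l//.
by have := q_sc_le; rewrite le_max lern1 leqNgt q1.
Qed.

Lemma b_sc_ge : A * q%:R <= b%:R.
Proof. exact: absz_ceil_ge. Qed.

Lemma b_sc_le : b%:R <= A * q%:R + 1.
Proof. by apply: absz_ceil_le; rewrite mulr_ge0 ?(ltW A0). Qed.

Lemma b_sc_gt0 : (0 < b)%N.
Proof.
rewrite -(ltr_nat R); apply: lt_le_trans b_sc_ge.
by rewrite mulr_gt0// ltr0n q_sc_gt0.
Qed.

(** The factor [16 C_star] in [A] leaves ample room. *)
Lemma batch_condition : ell ^+ 2 * q%:R <= be ^+ 2 * L ^+ 2 * b%:R.
Proof.
have h : be ^+ 2 * L ^+ 2 * (A * q%:R) <= be ^+ 2 * L ^+ 2 * b%:R.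
  by apply: ler_wpM2l b_sc_ge; apply: mulr_ge0; exact: sqr_ge0.
apply: le_trans h.
have -> : be ^+ 2 * L ^+ 2 * (A * q%:R) = 16 * C_star * (ell ^+ 2 * q%:R).
  by rewrite /A_vrsc; field; rewrite !gt_eqF.
have : 0 <= ell ^+ 2 * q%:R by rewrite mulr_ge0 ?sqr_ge0.
by rewrite /C_star; move: (_ * _) => z; lra.
Qed.

Lemma sfo_complexity c : sfo_costs q Br b c ->
  (sfo_total T c)%:R <= Br%:R + 18 * T%:R * Num.min Br%:R (Num.sqrt (A * Br%:R)).
Proof.
move=> hc; apply: (sfo_total_bound T A1 Br_sc_gt0 q_sc_gt0 hc).
- exact: q_sc_balanced.
- rewrite sqrt_ratio (_ : 2 * A * q%:R = A * (2 * q%:R)); last by ring.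
  by rewrite ler_pM2l// q_sc_sqrt_le.
- exact: b_sc_le.
Qed.

Lemma sizes_noiseless : sigma = 0 -> Br = 1%N /\ q = 1%N.
Proof.
move=> s0; have Br1 : Br = 1%N.
  by rewrite /Br_sc s0 expr0n/= mulr0 mul0r ceil0 absz0.
split => //; rewrite /q_sc Br1; have -> : Num.floor (Num.sqrt (1 / A)) = 0.
  apply: floor_def; rewrite sqrtr_ge0/= add0r -[ltRHS]sqrtr1 ltr_sqrt//.
  rewrite ltr_pdivrMr// mul1r; apply: lt_le_trans A_vrsc_ge2.
  by rewrite ltr1n.
by rewrite absz0.
Qed.

Lemma sfo_noiseless c : sigma = 0 -> sfo_costs q Br b c -> (sfo_total T c <= 3 * T)%N.
Proof.
by move=> s0; have [-> ->] := sizes_noiseless s0; move=> /(sfo_total_refresh T)->; rewrite muln1.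
Qed.

End Sizes.

Section Accuracy.
Context {R : realType} {n p : nat} {dW} {W : measurableType dW} (D : probability W R).
Context {d} {O : measurableType d} (P : probability O R).
Local Notation V := ('rV[R]_n * 'rV[R]_p)%type.
Context (X : set 'rV[R]_n) (Y : set 'rV[R]_p) (f : V -> W -> R).
Context (L mu sigma ell eps Bbar : R) (x0 : 'rV[R]_n) (y0 : 'rV[R]_p).

Local Notation T := (T_sc L mu Bbar eps).
Local Notation Br := (Br_sc L mu sigma eps).
Local Notation q := (q_sc L mu ell sigma eps).
Local Notation b := (b_sc L mu ell sigma eps).

Lemma expected_residual_sq (J : O -> 'I_T) omega (out : O -> @state R n p) :
  0 < eps -> standing_assumptions D X Y f L ->
  strong_concavity X Y (objective D f) L mu ->
  stochastic_oracle D P X Y f sigma -> paired_oracle D P X Y f L ell ->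
  X x0 -> Y y0 -> initial_quantity X Y (objective D f) L x0 y0 <= Bbar ->
  fresh_batches D P T q Br b omega -> uniform_index P q Br b omega J ->
  (forall w, out w = vr_spde X Y (sgrad f) L (h_sc L) (alpha_sc L mu) (k_sc L mu)
    (beta_sc L mu) q Br b (fun j i => omega j i w) x0 y0 (J w).+1) ->
  ('E_P[fun w => residual_sq X Y (objective D f) (st_x (out w)) (st_y (out w))]
   <= (eps ^+ 2)%:E)%E.
Proof.
move=> e0 sa sc SO PO Xx Yy hB FB UI outE.
have L0 := sa_L_gt0 sa; have [m0 mL _] := sc; have lL := PO.1.
have th0 := th_sc_gt0 L0 m0; have thE := th_scE L0 m0.
have be0 := beta_sc_gt0 L0 m0.
have q0 : (0 < q)%N  by exact: q_sc_gt0.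
have Br0 : (0 < Br)%N  by exact: Br_sc_gt0.
have b0 : (0 < b)%N  by exact: b_sc_gt0.
have T0 : (0 < T)%N by exact: T_sc_gt0.
have := output_residual sa sc SO th0 thE Xx Yy FB Br0 b0 UI (h_scE L) (alpha_scE mu L0)
  (k_scE L0 m0) (beta_scE mu L0) outE.
move/le_trans; apply; rewrite lee_fin.
have hb : ell ^+ 2 * q%:R <= beta_sc L mu ^+ 2 * L ^+ 2 * b%:R by exact: batch_condition.
rewrite (beta_scE mu L0) in hb.
have := mean_rb_sum sa sc SO PO th0 thE Xx Yy FB q0 Br0 b0 hb.
rewrite -(beta_scE mu L0) => hS.
have T0' : (0 : R) < T%:R by rewrite ltr0n.
have Br0' : (0 : R) < Br%:R by rewrite ltr0n.
have hT : 256 * (L * Bbar) <= T%:R * beta_sc L mu * eps ^+ 2 by exact: T_sc_ge.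
have hBr : 1536 * C_star * sigma ^+ 2 <= Br%:R * beta_sc L mu ^+ 2 * eps ^+ 2.
  exact: Br_sc_ge.
apply: (accuracy_arith be0 T0' Br0' hT hBr).
apply: le_trans hS _; rewrite natrM lerD2r.
by rewrite ler_pM2l.
Qed.

End Accuracy.

(** * Asymptotic rates and the main result *)

Lemma le_mul_sqrt {R : rcfType} (x K c : R) : 1 <= K -> 0 <= c ->
  x ^+ 2 <= K * c -> x <= K * Num.sqrt c.
Proof.
move=> K1 c0 xK; have K0 : 0 <= K by exact: le_trans K1.
rewrite (le_trans (ler_norm _))// -sqrtr_sqr -{1}(ger0_norm K0) -sqrtr_sqr -sqrtrM ?sqr_ge0//.
by rewrite ler_wsqrtr// (le_trans xK)// ler_wpM2r// expr2 ler_peMr.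
Qed.

Lemma sqrt_le_sq {R : rcfType} (x y : R) : 0 <= y -> x <= y ^+ 2 -> Num.sqrt x <= y.
Proof. by move=> y0 xy; rewrite -[leRHS]ger0_norm// -sqrtr_sqr ler_wsqrtr. Qed.

Section Asymptotics.
Context {R : realType}.

Section Rates.
Variables (L mu sigma chi eps Bbar : R).
Hypotheses (L0 : 0 < L) (mu0 : 0 < mu) (muL : mu <= L) (chi1 : 1 <= chi).
Hypotheses (eps0 : 0 < eps) (eps1 : eps <= 1) (chieps : chi * eps <= 1).
Hypotheses (Bbar0 : 0 < Bbar) (sigma0 : 0 < sigma).
Local Notation kappa := (L / mu).
Local Notation be := (beta_sc L mu).
Local Notation A := (A_vrsc L mu (chi * L)).
Local Notation Br := (Br_sc L mu sigma eps).
Local Notation T := (T_sc L mu Bbar eps).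
Local Notation q := (q_sc L mu (chi * L) sigma eps).
Local Notation b := (b_sc L mu (chi * L) sigma eps).

(** Like the other constants of the rates, independent of [eps], of the condition
    number and of [chi]; the summand [1] accounts for rounding up. *)
Definition rate_T (L Bbar : R) : R := 256 * L * Bbar * kbeta + 1.
Definition rate_Br (sigma : R) : R := 1536 * C_star * sigma ^+ 2 * kbeta + 1.
Definition rate_q (sigma : R) : R := 96 * sigma ^+ 2 + 1.
Definition rate_b (sigma : R) : R := 32 * C_star * kbeta * rate_q sigma.

Let k1 : 1 <= kappa. Proof. exact: kappa_ge1. Qed.
Let ellL : L <= chi * L. Proof. by rewrite ler_peMl// ltW. Qed.
Let chi0 : 0 < chi. Proof. exact: lt_le_trans chi1. Qed.
Let be0 : 0 < be. Proof. exact: beta_sc_gt0. Qed.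

Lemma inv_beta_le : be^-1 <= kbeta * Num.sqrt kappa.
Proof.
apply: le_mul_sqrt; [exact: kbeta_ge1|exact: le_trans k1|].
by rewrite exprVn (inv_sqr_beta L0 mu0).
Qed.

Let ieps1 : 1 <= eps^-1. Proof. by rewrite invf_ge1. Qed.
Let ieps2 : 1 <= eps ^- 2. Proof. by rewrite -exprVn exprn_ege1. Qed.

Lemma T_rate : T%:R <= rate_T L Bbar * (Num.sqrt kappa * eps ^- 2).
Proof.
have sk : 1 <= Num.sqrt kappa by rewrite -[leLHS]sqrtr1 ler_wsqrtr.
have x0 : 0 <= 256 * L * Bbar.
  by apply: mulr_ge0; [apply: mulr_ge0; [rewrite ler0n|exact: ltW]|exact: ltW].
have xE : 256 * L * Bbar / (be * eps ^+ 2) = 256 * L * Bbar * (be^-1 * eps ^- 2).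
  by rewrite invfM.
have y0 : 0 <= 256 * L * Bbar / (be * eps ^+ 2).
  by rewrite xE; apply: mulr_ge0 => //; rewrite mulr_ge0 ?invr_ge0 ?sqr_ge0 ?ltW.
have h : T%:R <= 256 * L * Bbar / (be * eps ^+ 2) + 1.
  by rewrite /T_sc natr_maxn1 ge_max lerDr y0 absz_ceil_le.
apply: le_trans h _; rewrite /rate_T [leRHS]mulrDl [X in _ <= _ + X]mul1r xE; apply: lerD; last exact: mulr_ege1.
rewrite -[leRHS]mulrA; apply: ler_wpM2l => //.
rewrite mulrA; apply: ler_wpM2r inv_beta_le.
by rewrite invr_ge0 sqr_ge0.
Qed.

Lemma Br_rate : Br%:R <= rate_Br sigma * (kappa * eps ^- 2).
Proof.
have x0 : 0 <= 1536 * C_star * sigma ^+ 2.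
  by apply: mulr_ge0; [rewrite /C_star; lra|exact: sqr_ge0].
have xE : 1536 * C_star * sigma ^+ 2 / (be ^+ 2 * eps ^+ 2) =
    1536 * C_star * sigma ^+ 2 * kbeta * (kappa * eps ^- 2).
  by rewrite invfM inv_sqr_beta// -!mulrA.
have y0 : 0 <= 1536 * C_star * sigma ^+ 2 / (be ^+ 2 * eps ^+ 2).
  by apply: mulr_ge0 => //; rewrite invr_ge0; apply: mulr_ge0; exact: sqr_ge0.
have h : Br%:R <= 1536 * C_star * sigma ^+ 2 / (be ^+ 2 * eps ^+ 2) + 1.
  by rewrite /Br_sc natr_maxn1 ge_max lerDr y0 absz_ceil_le.
apply: le_trans h _; rewrite /rate_Br [leRHS]mulrDl [X in _ <= _ + X]mul1r xE lerD2l.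
exact: mulr_ege1.
Qed.

Lemma A_chiE : A = 16 * C_star * chi ^+ 2 * (kbeta * kappa).
Proof. by rewrite A_vrscE// mulfK// gt_eqF. Qed.

Let A0 : 0 < A.
Proof. by apply: lt_le_trans (A_vrsc_ge2 L0 mu0 muL ellL); rewrite ltr0n. Qed.

Let chieps0 : 0 < chi * eps. Proof. exact: mulr_gt0. Qed.

(** The ratio that sets the refresh period does not depend on the condition
    number. *)
Lemma ratio_ge : 96 * sigma ^+ 2 * (chi * eps) ^- 2 <= Br%:R / A.
Proof.
have C0 : 0 < C_star :> R by rewrite /C_star ltr0n.
have c20 : 0 < chi ^+ 2 by exact: exprn_gt0.
have -> : Br%:R / A = (Br%:R * be ^+ 2 * eps ^+ 2) / (16 * C_star * (chi * eps) ^+ 2).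
  have b20 : be ^+ 2 != 0 by apply: lt0r_neq0; exact: exprn_gt0.
  rewrite /A_vrsc mulfK ?lt0r_neq0//.
  by move: (be ^+ 2) b20 => z z0; field; rewrite z0 !lt0r_neq0.
have -> : 96 * sigma ^+ 2 * (chi * eps) ^- 2 =
    (1536 * C_star * sigma ^+ 2) / (16 * C_star * (chi * eps) ^+ 2).
  by field; rewrite !lt0r_neq0.
apply: ler_wpM2r; last exact: Br_sc_ge.
rewrite invr_ge0; apply: mulr_ge0; last exact: sqr_ge0.
by apply: mulr_ge0; [rewrite ler0n|exact: ltW].
Qed.

Lemma ratio_le : Br%:R / A <= rate_q sigma * (chi * eps) ^- 2.
Proof.
have C0 : 0 < C_star :> R by rewrite /C_star ltr0n.
have x0 : 0 <= 1536 * C_star * sigma ^+ 2 / (be ^+ 2 * eps ^+ 2).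
  apply: mulr_ge0; first by apply: mulr_ge0; [rewrite /C_star; lra|exact: sqr_ge0].
  by rewrite invr_ge0; apply: mulr_ge0; exact: sqr_ge0.
have h : Br%:R <= 1536 * C_star * sigma ^+ 2 / (be ^+ 2 * eps ^+ 2) + 1.
  by rewrite /Br_sc natr_maxn1 ge_max lerDr x0 absz_ceil_le.
have iA : A^-1 <= (chi * eps) ^- 2.
  rewrite lef_pV2 ?posrE ?exprn_gt0//.
  have hA : 2 * (chi * L / L) ^+ 2 <= A by exact: A_vrsc_ge.
  rewrite mulfK ?lt0r_neq0// in hA.
  have : (chi * eps) ^+ 2 <= 1 * 1 by rewrite mulr1 exprn_ile1// ltW.
  have : 1 <= chi ^+ 2 by exact: exprn_ege1.
  lra.
apply: (@le_trans _ _ ((1536 * C_star * sigma ^+ 2 / (be ^+ 2 * eps ^+ 2) + 1) / A)).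
  by apply: ler_wpM2r => //; rewrite invr_ge0 ltW.
rewrite [leLHS]mulrDl mul1r /rate_q [leRHS]mulrDl [X in _ <= _ + X]mul1r.
apply: lerD iA; rewrite le_eqVlt; apply/orP; left; apply/eqP.
rewrite /A_vrsc mulfK ?lt0r_neq0//.
have b20 : be ^+ 2 != 0 by apply: lt0r_neq0; exact: exprn_gt0.
by move: (be ^+ 2) b20 => z z0; field; rewrite z0 !lt0r_neq0.
Qed.

Lemma q_rate_ge : 4 * sigma * (chi * eps)^-1 <= q%:R.
Proof.
have h := q_sc_sqrt_le L mu (chi * L) sigma eps.
have i0 : 0 <= (chi * eps)^-1 by rewrite invr_ge0 ltW.
have s8 : 0 <= 8 * sigma * (chi * eps)^-1.
  by apply: mulr_ge0 => //; apply: mulr_ge0; [rewrite ler0n|exact: ltW].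
suff : 8 * sigma * (chi * eps)^-1 <= Num.sqrt (Br%:R / A) by lra.
rewrite -(ger0_norm s8) -sqrtr_sqr ler_wsqrtr//; apply: le_trans ratio_ge.
rewrite -exprVn; have : 0 <= (sigma * (chi * eps)^-1) ^+ 2 by exact: sqr_ge0.
by move: (chi * eps)^-1 => z; rewrite !exprMn; lra.
Qed.

Lemma rate_q_ge1 : 1 <= rate_q sigma.
Proof. by rewrite /rate_q lerDr; apply: mulr_ge0; [rewrite ler0n|exact: sqr_ge0]. Qed.

Lemma q_rate_le : q%:R <= rate_q sigma * (chi * eps)^-1.
Proof.
have i1 : 1 <= (chi * eps)^-1 by rewrite invf_ge1.
have i0 : 0 <= (chi * eps)^-1 by exact: le_trans i1.
apply: le_trans (q_sc_le L mu (chi * L) sigma eps) _.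
rewrite ge_max (mulr_ege1 rate_q_ge1 i1)/=.
apply: sqrt_le_sq; first by apply: mulr_ge0 => //; exact: le_trans rate_q_ge1.
apply: le_trans ratio_le _; rewrite -exprVn exprMn; apply: ler_wpM2r; first exact: sqr_ge0.
by rewrite expr2 ler_peMr ?rate_q_ge1// (le_trans _ rate_q_ge1).
Qed.

(** As [A q >= 1], rounding up at most doubles [A q], and [A q] is
    [chi^2 kappa / (chi eps)] up to constants. *)
Lemma b_rate : b%:R <= rate_b sigma * (chi * kappa * eps^-1).
Proof.
have hb : b%:R <= A * q%:R + 1 by exact: b_sc_le.
have q1 : 1 <= q%:R :> R by rewrite ler1n q_sc_gt0.
have A1 : 1 <= A.
  by apply: le_trans (A_vrsc_ge2 L0 mu0 muL ellL); rewrite ler1n.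
have Aq1 := mulr_ege1 A1 q1.
have h2 := ler_wpM2l (ltW A0) q_rate_le.
apply: (@le_trans _ _ (2 * (A * (rate_q sigma * (chi * eps)^-1)))); first lra.
rewrite le_eqVlt; apply/orP; left; apply/eqP; rewrite A_chiE /rate_b.
move: (C_star) (kbeta) (rate_q sigma) => c K r.
by field; rewrite !lt0r_neq0.
Qed.

Definition rate_sfo (L Bbar sigma : R) : R :=
  rate_Br sigma + 18 * (rate_T L Bbar * (16 * C_star * kbeta * rate_Br sigma)).

Lemma powR32 (x : R) : 0 < x -> x `^ (3 / 2) = x * Num.sqrt x.
Proof.
move=> x0; have -> : 3 / 2 = 1 + 2^-1 :> R by lra.
by rewrite powRD ?powRr1 ?(ltW x0)// ?powR12_sqrt ?(ltW x0)// (gt_eqF x0) implybT.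
Qed.

Lemma rate_Br_ge1 : 1 <= rate_Br sigma.
Proof.
rewrite /rate_Br lerDr; apply: mulr_ge0; last exact: ltW (@kbeta_gt0 R).
by apply: mulr_ge0; [rewrite /C_star; lra|exact: sqr_ge0].
Qed.

(** [sqrt (A Br)] is of the order of [chi kappa / eps], to be multiplied by
    [T], of the order of [sqrt kappa / eps^2]. *)
Lemma sfo_rate c : sfo_costs q Br b c ->
  (sfo_total T c)%:R <= rate_sfo L Bbar sigma *
    (kappa * eps ^- 2 + chi * kappa `^ (3 / 2) * eps ^- 3).
Proof.
move=> hc; have k0 : 0 < kappa by exact: lt_le_trans k1.
have h : (sfo_total T c)%:R <= Br%:R + 18 * T%:R * Num.min Br%:R (Num.sqrt (A * Br%:R)).
  exact: sfo_complexity.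
pose M : R := 16 * C_star * kbeta * rate_Br sigma.
have M1 : 1 <= M.
  apply: mulr_ege1 rate_Br_ge1; apply: mulr_ege1 (@kbeta_ge1 R).
  by rewrite /C_star; lra.
have M0 : 0 <= M by exact: le_trans M1.
have z0 : 0 <= chi * kappa * eps^-1.
  by apply: mulr_ge0; [apply: mulr_ge0; exact: ltW|rewrite invr_ge0 ltW].
have hS : Num.sqrt (A * Br%:R) <= M * (chi * kappa * eps^-1).
  apply: sqrt_le_sq; first exact: mulr_ge0.
  apply: le_trans (ler_wpM2l (ltW A0) Br_rate) _.
  have -> : A * (rate_Br sigma * (kappa * eps ^- 2)) = M * (chi * kappa * eps^-1) ^+ 2.
    rewrite A_chiE /M; move: (C_star) (kbeta) (rate_Br sigma) => c' K r.
    by field; rewrite !lt0r_neq0.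
  rewrite [leRHS]exprMn; apply: ler_wpM2r; first exact: sqr_ge0.
  by rewrite expr2 ler_peMr.
have hT := T_rate; have hB := Br_rate.
have hTS : T%:R * Num.min Br%:R (Num.sqrt (A * Br%:R)) <=
    rate_T L Bbar * M * (chi * kappa `^ (3 / 2) * eps ^- 3).
  have -> : rate_T L Bbar * M * (chi * kappa `^ (3 / 2) * eps ^- 3) =
      (rate_T L Bbar * (Num.sqrt kappa * eps ^- 2)) * (M * (chi * kappa * eps^-1)).
    rewrite powR32//; move: (Num.sqrt kappa) (rate_T L Bbar) (M) => s r m.
    by field; rewrite !lt0r_neq0.
  have m0 : 0 <= Num.min Br%:R (Num.sqrt (A * Br%:R)) by rewrite le_min ler0n sqrtr_ge0.
  have mS : Num.min Br%:R (Num.sqrt (A * Br%:R)) <= Num.sqrt (A * Br%:R).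
    by rewrite ge_min lexx orbT.
  exact: ler_pM (ler0n _ _) m0 hT (le_trans mS hS).
have p0 : 0 <= kappa * eps ^- 2.
  by apply: mulr_ge0; [exact: ltW|rewrite invr_ge0 sqr_ge0].
have p1 : 0 <= chi * kappa `^ (3 / 2) * eps ^- 3.
  apply: mulr_ge0; first by apply: mulr_ge0; [exact: ltW|exact: powR_ge0].
  by rewrite invr_ge0; apply: exprn_ge0; exact: ltW.
have r1 := rate_Br_ge1.
have t0 : 0 <= rate_T L Bbar.
  rewrite /rate_T; apply: addr_ge0; last exact: ler01.
  apply: mulr_ge0; last exact: ltW (@kbeta_gt0 R).
  by apply: mulr_ge0; [apply: mulr_ge0; [rewrite ler0n|exact: ltW]|exact: ltW].
have tM0 : 0 <= rate_T L Bbar * M by exact: mulr_ge0.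
rewrite /rate_sfo -/M.
have e1 := mulr_ge0 (le_trans ler01 r1) p1; have e2 := mulr_ge0 tM0 p0.
rewrite -mulrA in h.
have arith (N B Tw x r m u : R) : N <= B + 18 * Tw -> B <= r * x -> Tw <= m * u ->
  0 <= r * u -> 0 <= m * x -> N <= (r + 18 * m) * (x + u) by lra.
exact: arith h hB hTS e1 e2.
Qed.

End Rates.
End Asymptotics.

Theorem theorem4 (R : realType) :
  (* accuracy and complexity of a run on a given instance *)
  (forall (n p : nat) (X : set 'rV[R]_n) (Y : set 'rV[R]_p)
      (dW : measure_display) (W : measurableType dW) (D : probability W R)
      (f : 'rV[R]_n * 'rV[R]_p -> W -> R)
      (dO : measure_display) (O : measurableType dO) (P : probability O R)
      (L mu ell sigma eps Bbar : R) (x0 : 'rV[R]_n) (y0 : 'rV[R]_p),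
    0 < eps ->
    standing_assumptions D X Y f L ->
    strong_concavity X Y (objective D f) L mu ->
    stochastic_oracle D P X Y f sigma ->
    paired_oracle D P X Y f L ell ->
    X x0 -> Y y0 ->
    initial_quantity X Y (objective D f) L x0 y0 <= Bbar ->
    let T := T_sc L mu Bbar eps in
    let Br := Br_sc L mu sigma eps in
    let A := A_vrsc L mu ell in
    let q := q_sc L mu ell sigma eps in
    let b := b_sc L mu ell sigma eps in
    (forall (omega : nat -> nat -> O -> W) (J : O -> 'I_T),
      fresh_batches D P T q Br b omega ->
      uniform_index P q Br b omega J ->
      let out w := vr_spde X Y (sgrad f) L (h_sc L) (alpha_sc L mu)
        (k_sc L mu) (beta_sc L mu) q Br b (fun j i => omega j i w)
        x0 y0 (J w).+1 in
      ('E_P[fun w => residual_sq X Y (objective D f)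
                       (st_x (out w)) (st_y (out w))] <= (eps ^+ 2)%:E)%E)
    /\ (forall c : nat -> nat, sfo_costs q Br b c ->
      (sfo_total T c)%:R
        <= Br%:R + 18 * T%:R * Num.min Br%:R (Num.sqrt (A * Br%:R)))
    /\ (sigma = 0 -> [/\ Br = 1%N, q = 1%N &
      forall c : nat -> nat, sfo_costs q Br b c ->
        (sfo_total T c <= 3 * T)%N]))
  /\
  (* asymptotics as eps tends to 0, for fixed positive sigma and chi *)
  (forall L Bbar sigma : R, 0 < L -> 0 < Bbar -> 0 < sigma ->
    exists c0 C : R, [/\ 0 < c0, 0 < C &
      forall chi : R, 1 <= chi -> \forall eps \near 0^'+,
        forall mu : R, 0 < mu -> mu <= L ->
        let kappa := L / mu in
        let ell := chi * L in
        let T := T_sc L mu Bbar eps in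
        let Br := Br_sc L mu sigma eps in
        let q := q_sc L mu ell sigma eps in
        let b := b_sc L mu ell sigma eps in
        [/\ T%:R <= C * (Num.sqrt kappa * eps ^- 2),
            Br%:R <= C * (kappa * eps ^- 2),
            c0 * (chi * eps)^-1 <= q%:R <= C * (chi * eps)^-1,
            b%:R <= C * (chi * kappa * eps^-1) &
            forall c : nat -> nat, sfo_costs q Br b c ->
              (sfo_total T c)%:R
                <= C * (kappa * eps ^- 2
                        + chi * kappa `^ (3 / 2) * eps ^- 3)]])
  /\
  (* asymptotics for sigma = 0 *)
  (forall L Bbar : R, 0 < L -> 0 < Bbar ->
    exists C : R, 0 < C /\
      \forall eps \near 0^'+, forall mu : R, 0 < mu -> mu <= L ->
        (3 * T_sc L mu Bbar eps)%:R
          <= C * (Num.sqrt (L / mu) * eps ^- 2)).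
Proof.
split; [|split].
- move=> n p X Y dW W D f dO O P L mu ell sigma eps Bbar x0 y0 e0 sa sc SO PO Xx Yy hB T Br A q b.
  have L0 := sa_L_gt0 sa; have [m0 mL _] := sc; have lL := PO.1.
  split; [|split].
  + move=> omega J FB UI.
    pose out w := vr_spde X Y (sgrad f) L (h_sc L) (alpha_sc L mu) (k_sc L mu)
      (beta_sc L mu) q Br b (fun j i => omega j i w) x0 y0 (J w).+1.
    exact: (expected_residual_sq e0 sa sc SO PO Xx Yy hB FB UI (fun w => erefl (out w))).
  + by move=> c hc; exact: sfo_complexity.
  + move=> s0; have [Br1 q1] := sizes_noiseless eps L0 m0 mL lL s0.
    by split => // c hc; exact: sfo_noiseless hc.
- move=> L Bbar sigma L0 B0 s0.
  pose C := rate_T L Bbar + rate_Br sigma + rate_q sigma + rate_b sigma + rate_sfo L Bbar sigma.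
  have kb0 := @kbeta_gt0 R.
  have Bq0 : 0 < rate_Br sigma by exact: (lt_le_trans ltr01 (rate_Br_ge1 sigma)).
  have q0 : 0 < rate_q sigma by exact: (lt_le_trans ltr01 (rate_q_ge1 sigma)).
  have T0 : 0 < rate_T L Bbar.
    apply: addr_gt0; last exact: ltr01.
    apply: (mulr_gt0 _ kb0); apply: (mulr_gt0 _ B0); apply: (mulr_gt0 _ L0); by rewrite ltr0n.
  have C0 : 0 < C_star :> R by rewrite /C_star ltr0n.
  have b0 : 0 < rate_b sigma.
    by apply: (mulr_gt0 _ q0); apply: (mulr_gt0 _ kb0); apply: (mulr_gt0 _ C0); rewrite ltr0n.
  have S0 : 0 < rate_sfo L Bbar sigma.
    apply: (addr_gt0 Bq0); apply: mulr_gt0; first by rewrite ltr0n.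
    apply: (mulr_gt0 T0); apply: (mulr_gt0 _ Bq0); apply: (mulr_gt0 _ kb0).
    by apply: (mulr_gt0 _ C0); rewrite ltr0n.
  have scale (r z x : R) : z <= r * x -> 0 <= x -> r <= C -> z <= C * x.
    by move=> zr x0 rC; apply: le_trans zr _; apply: ler_wpM2r.
  exists (4 * sigma), C; split.
  + by apply: (mulr_gt0 _ s0); rewrite ltr0n.
  + exact: (addr_gt0 (addr_gt0 (addr_gt0 (addr_gt0 T0 Bq0) q0) b0) S0).
  move=> chi chi1; have chi0 : 0 < chi by exact: lt_le_trans chi1.
  near=> eps => mu m0 mL.
  have e0 : 0 < eps by near: eps; exact: nbhs_right_gt.
  have e1 : eps <= 1 by near: eps; apply: nbhs_right_le.
  have ce : chi * eps <= 1.
    rewrite mulrC -ler_pdivlMr//; near: eps; apply: nbhs_right_le.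
    by rewrite divr_gt0.
  have k0 : 0 <= L / mu by rewrite divr_ge0// ltW.
  have i0 : 0 <= eps^-1 by rewrite invr_ge0 ltW.
  have i2 : 0 <= eps ^- 2 by rewrite invr_ge0 sqr_ge0.
  have i3 : 0 <= eps ^- 3 by rewrite invr_ge0; apply: exprn_ge0; exact: ltW.
  split.
  + apply: (scale _ _ _ (T_rate L0 m0 mL e0 e1 B0)); first by rewrite mulr_ge0 ?sqrtr_ge0.
    rewrite /C; lra.
  + apply: (scale _ _ _ (Br_rate sigma L0 m0 mL e0 e1)); first by rewrite mulr_ge0.
    rewrite /C; lra.
  + rewrite (q_rate_ge L0 m0 chi1 e0 s0)/=.
    apply: (scale _ _ _ (q_rate_le sigma L0 m0 mL chi1 e0 ce)).
      by rewrite invr_ge0 mulr_ge0// ltW.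
    rewrite /C; lra.
  + apply: (scale _ _ _ (b_rate sigma L0 m0 mL chi1 e0 ce)).
      by apply: mulr_ge0 => //; apply: mulr_ge0 => //; exact: ltW.
    rewrite /C; lra.
  + move=> c hc; apply: (scale _ _ _ (sfo_rate L0 m0 mL chi1 e0 e1 B0 hc)).
      apply: addr_ge0; first exact: mulr_ge0.
      by apply: mulr_ge0 => //; apply: mulr_ge0; [exact: ltW|exact: powR_ge0].
    rewrite /C; lra.
- move=> L Bbar L0 B0; exists (3 * rate_T L Bbar); split.
    apply: mulr_gt0; first by rewrite ltr0n.
    apply: addr_gt0; last exact: ltr01.
    apply: (mulr_gt0 _ (@kbeta_gt0 R)); apply: (mulr_gt0 _ B0); apply: (mulr_gt0 _ L0); by rewrite ltr0n.
  near=> eps => mu m0 mL.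
  have e0 : 0 < eps by near: eps; exact: nbhs_right_gt.
  have e1 : eps <= 1 by near: eps; apply: nbhs_right_le.
  rewrite natrM -mulrA ler_pM2l ?ltr0n//.
  exact: T_rate.
Unshelve. all: by end_near.
Qed.
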